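(* Let $m\in\mathbb{N}$, $1<p_1,\dots,p_m<\infty$, $\frac1p=\frac1{p_1}+\cdots+\frac1{p_m}$ and $\frac1m<p\le q<\infty$. Let $(X,\rho,\mu)$ be a space of homogeneous type satisfying the reverse doubling property, and let $K$ be a kernel satisfying the growth conditions whose associated functional $\varphi$ satisfies the decay condition (all as defined in the context). Let $\Phi_1,\dots,\Phi_m$ and (when $q>1$) $\Psi$ be Young functions such that for some $c>0$ $$\int_c^\infty\left(\frac{t^{p_i'}}{\Phi_i(t)}\right)^{p_i-1}\frac{dt}{t}<\infty,\quad 1\le i\le m,\qquad\text{and, when } q>1,\qquad \int_c^\infty\left(\frac{t^q}{\Psi(t)}\right)^{q'-1}\frac{dt}{t}<\infty.$$ Let $u,v_1,\dots,v_m$ be weights on $X$ such that: if $q>1$, $$\sup_B\ \varphi(B)\,\mu(B)^{\frac1q+\frac1{p_1'}+\cdots+\frac1{p_m'}}\,\|u\|_{\Psi,B}\prod_{i=1}^m\|v_i^{-1}\|_{\Phi_i,B}<\infty,$$ and if $q\le1$, $$\sup_B\ \varphi(B)\,\mu(B)^{\frac1q+\frac1{p_1'}+\cdots+\frac1{p_m'}}\left(\frac1{\mu(B)}\int_B u^q\,d\mu\right)^{1/q}\prod_{i=1}^m\|v_i^{-1}\|_{\Phi_i,B}<\infty,$$ the suprema being over $\rho$-balls $B$. Then there exists a constant $C$ such that $$\left(\int_X\left(|\mathcal{T}\vec f\,|\,u\right)^q d\mu\right)^{1/q}\le C\prod_{k=1}^m\left(\int_X(|f_k|v_k)^{p_k}\,d\mu\right)^{1/p_k}$$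 for all $\vec f=(f_1,\dots,f_m)\in L^{p_1}(X,v_1^{p_1}d\mu)\times\cdots\times L^{p_m}(X,v_m^{p_m}d\mu)$, where $\mathcal{T}$ is the multilinear potential operator with kernel $K$.
   Context: A weight is a nonnegative measurable function. For $s>1$, $s'=s/(s-1)$. Young functions and Orlicz averages: a Young function is a continuous, convex, increasing $\psi:[0,\infty)\to[0,\infty)$ with $\psi(0)=0$, $\psi(t)\to\infty$ as $t\to\infty$, normalized by $\psi(1)=1$, and doubling: there are constants $C,N$ with $\psi(2t)\le C\psi(t)$ for all $t\ge N$. For a ball $B$, $\|f\|_{\psi,B}=\inf\{\lambda>0:\frac1{\mu(B)}\int_B\psi(|f|/\lambda)\,d\mu\le1\}$. Space of homogeneous type: $(X,\rho,\mu)$ with $\rho$ a quasi-metric, $\rho(x,y)\le\kappa(\rho(x,z)+\rho(z,y))$ for some $\kappa\ge1$, and $\mu$ a Borel measure with the doubling property $0<\mu(B_\rho(x,2r))\le L\,\mu(B_\rho(x,r))<\infty$ for all $x\in X$, $r>0$, where $B_\rho(x,r)=\{y:\rho(x,y)<r\}$ (assumed open). $r(B)$ denotes the radius of $B$ and $\operatorname{diam}_\rho(X)=\sup\{\rho(x,y):x,y\in X\}$. Reverse doubling property: for all $\eta>1$ there are $c(\eta)>0$ and $\delta>0$ such that $\frac{\mu(B_\rho(x_1,r_1))}{\mu(B_\rho(x_2,r_2))}\ge c(\eta)\left(\frac{r_1}{r_2}\right)^\delta$ whenever $B_\rho(x_2,r_2)\subset B_\rho(x_1,r_1)$, $x_1,x_2\in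 X$, $0<r_1,r_2\le\eta\operatorname{diam}_\rho(X)$. Notation: for $x\in X$, $\vec x,\vec y\in X^m$: $\rho(x,\vec y)=\sum_{i=1}^m\rho(x,y_i)$, $\rho(\vec x,\vec y)=\sum_{i=1}^m\rho(x_i,y_i)$, $\vec f(\vec y)=f_1(y_1)\cdots f_m(y_m)$, $d\mu(\vec y)=d\mu(y_1)\cdots d\mu(y_m)$. Operator: $\mathcal{T}(\vec f)(x)=\int_{X^m}\vec f(\vec y)K(x,\vec y)\,d\mu(\vec y)$, where $K(x,\vec y)=\tilde K((x,\dots,x),\vec y)$ for a nonnegative kernel $\tilde K(\vec x,\vec y)$ on $X^m\times X^m$, continuous off the diagonal $\vec x=\vec y$ (where it may be singular). Growth conditions: for every $c>1$ there is $C>1$ such that (off the diagonal) $\tilde K(\vec x,\vec y)\le C\tilde K(\vec z,\vec y)$ if $\rho(\vec z,\vec y)\le c\,\rho(\vec x,\vec y)$, and $\tilde K(\vec x,\vec y)\le C\tilde K(\vec y,\vec z)$ if $\rho(\vec y,\vec z)\le c\,\rho(\vec x,\vec y)$. Functional $\varphi$: for a fixed $\eta>1$ and a sufficiently small $c_0>0$ (any $c_0$ with $0<c_0^\delta<c(\eta)$), for $\rho$-balls $B$ with $r(B)\le\eta\operatorname{diam}_\rho(X)$, $$\varphi(B)=\sup\{K(x,\vec y):(x,\vec y)\in B^{m+1},\ \rho(x,\vec y)\ge c_0\,r(B)\}.$$ When $\operatorname{diam}_\rho(X)<\infty$, $\eta$ is a fixed structural constant that may be taken as large as needed; different choices of $\eta,c_0$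 give comparable values of $\varphi$. Suprema over $\rho$-balls involving $\varphi$ are over balls for which $\varphi$ is defined. Decay condition: there is $\epsilon>0$ such that for all $C_1>1$ there is $C_2>0$ with $$\varphi(B')\mu(B')^m\le C_2\left(\frac{r(B')}{r(B)}\right)^\epsilon\varphi(B)\mu(B)^m$$ for all balls $B'\subset B$ with $r(B'),r(B)<C_1\operatorname{diam}_\rho(X)$ (with $\varphi$ defined using some $\eta\ge C_1$). *)

(* Defs.v *)
From HB Require Import structures.
From mathcomp Require Import all_boot all_order all_algebra.
From mathcomp Require Import all_classical all_reals all_analysis.
Set Implicit Arguments.
Unset Strict Implicit.
Unset Printing Implicit Defensive.
Import Order.TTheory GRing.Theory Num.Theory.
Import numFieldNormedType.Exports.
Local Open Scope classical_set_scope.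
Local Open Scope ring_scope.

Definition conj_exp (R : realType) (s : R) : R := s / (s - 1).

Section Young.
Context (R : realType).
Implicit Types psi : R -> R.

(* A Young function is only meaningful on [0, +oo[: its values at negative
   reals are arbitrary. "Increasing" is read in the weak sense. *)
Record young_function psi : Prop := YoungFunction {
  young_ge0 : forall t : R, 0 <= t -> 0 <= psi t ;
  young_continuous : {within `[0, +oo[, continuous psi} ;
  young_convex : convex_function (`[0, +oo[%classic : set R) psi ;
  young_increasing : forall s t : R, 0 <= s -> s <= t -> psi s <= psi t ;
  young0 : psi 0 = 0 ;
  young_unbounded : psi t @[t --> +oo] --> +oo ;
  young1 : psi 1 = 1 ;
  young_doubling : exists C N : R, forall t, N <= t -> psi (2 * t) <= C * psi t
}.

Definition young_ext psi (x : \bar R) : \bar R :=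
  if x is r%:E then (psi r)%:E else +oo%E.

Definition tail_integral psi (a b c : R) : \bar R :=
  \int[lebesgue_measure]_(t in `[c, +oo[)
    (((t `^ a) / psi t) `^ b / t)%:E.

End Young.

Section Space.
Context (d : measure_display) (X : measurableType d) (R : realType).
Variables (rho : X -> X -> R) (mu : {measure set X -> \bar R}).

Definition qball (x : X) (r : R) : set X := [set y | rho x y < r].

Definition qopen (U : set X) : Prop :=
  forall x, U x -> exists2 r : R, 0 < r & qball x r `<=` U.

Definition qdiam : \bar R :=
  ereal_sup [set (rho z.1 z.2)%:E | z in [set: X * X]].

Record quasi_metric : Prop := QuasiMetric {
  qm_ge0 : forall x y, 0 <= rho x y ;
  qm_eq0 : forall x y, rho x y = 0 <-> x = y ;
  qm_sym : forall x y, rho x y = rho y x ;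
  qm_triangle : exists2 kappa : R, 1 <= kappa &
    forall x y z, rho x y <= kappa * (rho x z + rho z y)
}.

Record homogeneous_type : Prop := HomogeneousType {
  ht_quasi_metric : quasi_metric ;
  ht_ball_open : forall x r, qopen (qball x r) ;
  ht_borel : @measurable d X = <<s qopen >> ;
  ht_doubling : exists L : R, forall x (r : R), 0 < r ->
    [/\ (0 < mu (qball x (2 * r)))%E,
        (mu (qball x (2 * r)) <= L%:E * mu (qball x r))%E &
        (L%:E * mu (qball x r) < +oo)%E]
}.

Definition reverse_doubling_with (eta c delta : R) : Prop :=
  forall x1 x2 (r1 r2 : R), 0 < r1 -> 0 < r2 ->
    (r1%:E <= eta%:E * qdiam)%E -> (r2%:E <= eta%:E * qdiam)%E ->
    qball x2 r2 `<=` qball x1 r1 ->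
    c * (r1 / r2) `^ delta <= fine (mu (qball x1 r1)) / fine (mu (qball x2 r2)).

Definition reverse_doubling : Prop :=
  forall eta : R, 1 < eta ->
    exists c delta : R, [/\ 0 < c, 0 < delta & reverse_doubling_with eta c delta].

(* The pairs (eta, c0) allowed in the definition of the functional phi. *)
Definition phi_admissible (eta c0 : R) : Prop :=
  exists c delta : R,
    [/\ 0 < c, 0 < delta, reverse_doubling_with eta c delta,
        0 < c0 & c0 `^ delta < c].

(* Balls are represented by centre and radius: distinct pairs may describe the
   same set. These are the balls on which phi is defined. *)
Definition phi_balls (eta : R) : set (X * R) :=
  [set B | 0 < B.2 /\ (B.2%:E <= eta%:E * qdiam)%E].

Definition average (x : X) (r : R) (g : X -> \bar R) : \bar R :=
  ((mu (qball x r))^-1 * \int[mu]_(y in qball x r) g y)%E.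

(* [f] is extended-real-valued because it is applied to the reciprocal of a
   weight, which is +oo where the weight vanishes. *)
Definition orlicz_norm (psi : R -> R) (x : X) (r : R) (f : X -> \bar R) : \bar R :=
  ereal_inf [set lambda%:E | lambda in [set lambda : R | 0 < lambda /\
    (average x r (fun y => young_ext psi (`|f y| * (lambda^-1)%:E)) <= 1)%E]].

Definition weight (w : X -> R) : Prop :=
  measurable_fun setT w /\ forall x, 0 <= w x.

(* The m-fold product of [mu], built along X^(n+1) = X * X^n. *)
Fixpoint power_measure (n : nat) : set (n.-tuple X) -> \bar R :=
  match n with
  | 0 => fun A => \d_([tuple] : 0.-tuple X) A
  | k.+1 => fun A =>
      (mu \x @power_measure k)%E
        ((fun z : X * k.-tuple X => cons_tuple z.1 z.2) @^-1` A)
  end.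

Section Kernel.
Variable m : nat.

Definition rho_vec (xs ys : m.-tuple X) : R :=
  \sum_(i < m) rho (tnth xs i) (tnth ys i).

Definition diag_tuple (x : X) : m.-tuple X := nseq_tuple m x.

(* The kernel may take the value +oo, but only on the diagonal. *)
Variable K : m.-tuple X -> m.-tuple X -> \bar R.

Definition continuous_off_diagonal : Prop :=
  forall xs ys, xs != ys -> forall e : R, 0 < e ->
    exists2 t : R, 0 < t & forall xs' ys',
      rho_vec xs xs' < t -> rho_vec ys ys' < t ->
      `|fine (K xs' ys') - fine (K xs ys)| < e.

Record kernel_off_diagonal : Prop := KernelOffDiagonal {
  ker_ge0 : forall xs ys, (0 <= K xs ys)%E ;
  ker_fin : forall xs ys, xs != ys -> K xs ys \is a fin_num ;
  ker_continuous : continuous_off_diagonal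
}.

Definition growth_conditions : Prop :=
  forall c : R, 1 < c -> exists2 C : R, 1 < C &
    (forall xs ys zs, xs != ys -> zs != ys ->
       rho_vec zs ys <= c * rho_vec xs ys -> (K xs ys <= C%:E * K zs ys)%E) /\
    (forall xs ys zs, xs != ys -> ys != zs ->
       rho_vec ys zs <= c * rho_vec xs ys -> (K xs ys <= C%:E * K ys zs)%E).

Definition phi (c0 : R) (x : X) (r : R) : \bar R :=
  ereal_sup [set K (diag_tuple z.1) z.2 |
    z in [set z : X * m.-tuple X |
      [/\ qball x r z.1, forall i, qball x r (tnth z.2 i) &
          c0 * r <= rho_vec (diag_tuple z.1) z.2]]].

Definition decay_condition : Prop :=
  exists2 eps : R, 0 < eps & forall C1 : R, 1 < C1 ->
    exists eta c0 C2 : R,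
      [/\ C1 <= eta, phi_admissible eta c0, 0 < C2 &
        forall x x' (r r' : R), 0 < r -> 0 < r' ->
          (r%:E < C1%:E * qdiam)%E -> (r'%:E < C1%:E * qdiam)%E ->
          qball x' r' `<=` qball x r ->
          (phi c0 x' r' * mu (qball x' r') ^+ m <=
           (C2 * (r' / r) `^ eps)%:E * (phi c0 x r * mu (qball x r) ^+ m))%E].

Definition potential (f : 'I_m -> X -> R) (x : X) : \bar R :=
  (\int[@power_measure m]_ys
     ((\prod_(i < m) f i (tnth ys i))%:E * K (diag_tuple x) ys))%E.

End Kernel.

Definition weighted_norm (p : R) (w f : X -> R) : \bar R :=
  ((\int[mu]_x ((`|f x| * w x) `^ p)%:E) `^ p^-1)%E.

Definition in_weighted_Lp (p : R) (w f : X -> R) : Prop :=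
  measurable_fun setT f /\
  (\int[mu]_x ((`|f x| `^ p) * (w x) `^ p)%:E < +oo)%E.

End Space.

(* Main.v *)
Require Import Defs.
From HB Require Import structures.
From mathcomp Require Import finmap.
From mathcomp Require Import all_boot all_order all_algebra.
From mathcomp Require Import all_classical all_reals all_analysis.
From mathcomp Require Import measurable_realfun ring lra.
Set Implicit Arguments.
Unset Strict Implicit.
Unset Printing Implicit Defensive.
Import Order.TTheory GRing.Theory Num.Theory.
Import numFieldNormedType.Exports.
Local Open Scope classical_set_scope.
Local Open Scope ring_scope.

(** The potential is compared with a sum over scales, which is dominated by a sparse
    sum; on each ball of the sparse family the bump condition trades the weights for
    Orlicz averages, and these are summed by a Carleson embedding.

    Discretization. If [t] is the largest of the distances from [x] to the [y_i] and
    [r_(k+1) <= t < r_k] for radii [r_k] with ratio [c0], then [K (x, ys) <= phi (B (x, r_k))].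
    Hence [T f (x)] is at most the sum over [k] of [Lam (x, r_k)] times the product of
    the averages of the [|f_i|] over [B (x, r_k)], where [Lam = phi * mu ^+ m]
    ([potential_le_liminf]). Points have measure zero by reverse doubling, so the
    diagonal does not count.

    Sparse domination. For a fixed ball and bounded functions, a stopping-time argument
    on the products of averages, with Vitali's lemma in place of dyadic cubes, gives a
    countable sparse family of balls ([stopping_family]). The decay condition makes the
    sum over the scales that belong to one stopping ball geometric
    ([sparse_domination]), so that a sum of constants over the sparse balls dominates the
    sum over scales.

    One ball. Hoelder's inequality in Orlicz form splits the average of [f_i] into a norm
    of [1 / v_i] and a conjugate average of [f_i * v_i]; the bump condition bounds the
    product of the norms ([ball_estimate_le1], [ball_estimate_gt1]). The conjugate Young
    function is replaced by the explicit sum of truncations [theta], and the conjugate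
    average is used only through the inequality [carleson].

    Summation. Over a sparse family, the conjugate averages of a function [a], raised to the
    power [s] and weighted by the volumes, sum to at most a constant times the integral of
    [a ^ s] ([sparse_orlicz]). This is the boundedness on [L^s] of the maximal function of
    the conjugate Young function; it follows from the weak-type bound at each level and
    from the tail condition, rewritten as a convergent dyadic sum in [tail_slope_sum].
    For [q > 1] the sum is tested against a dual function, which contributes a Carleson
    sum for [Psi] ([dyadic_bound_gt1]); for [q <= 1] the power [q] is subadditive and
    distributes over the sparse sum ([dyadic_bound_le1]). The product of [m] averages is in
    [l^pbar], hence in [l^q].

    The estimates are uniform in the ball and in the truncation of the [f_i], so they
    pass to the limit by Fatou's lemma, in a form that does not require the potential
    or its kernel to be measurable ([lower_fatou]). *)

(** * Integrals of functions that need not be measurable *)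

Section IntegralPrelim.
Local Open Scope ereal_scope.
Context {d : measure_display} {T : measurableType d} {R : realType}.
Variable mu : {measure set T -> \bar R}.

(** No measurability is needed, because the integral of a nonnegative function
    is a supremum over the simple functions below it. *)
Lemma le_lower_integral (D : set T) (f g : T -> \bar R) :
  (forall x, D x -> 0 <= f x) -> (forall x, D x -> f x <= g x) ->
  \int[mu]_(x in D) f x <= \int[mu]_(x in D) g x.
Proof.
move=> f0 fg.
have g0 x : D x -> 0 <= g x by move=> Dx; rewrite (le_trans (f0 _ Dx))// fg.
rewrite !ge0_integralE//; apply: ereal_sup_le => _ [h hf <-].
exists h => //= x; apply: (le_trans (hf x)).
rewrite /patch; case: ifPn => // xD; apply: fg; exact: set_mem.
Qed.

(** The positive and the negative part of [f] both lie below [g]; no measurability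
    is available, so the integrals are compared through these parts. *)
Lemma abse_integral_le (f g : T -> \bar R) : (forall x, `|f x| <= g x) ->
  `|\int[mu]_x f x| <= \int[mu]_x g x.
Proof.
move=> fg; rewrite integralE.
have p0 : 0 <= \int[mu]_x f^\+ x by apply: integral_ge0 => x _; exact: funepos_ge0.
have n0 : 0 <= \int[mu]_x f^\- x by apply: integral_ge0 => x _; exact: funeneg_ge0.
have pg : \int[mu]_x f^\+ x <= \int[mu]_x g x.
  apply: le_lower_integral => x _; first exact: funepos_ge0.
  apply: le_trans (fg x); by rewrite funeposE ge_max abse_ge0 lee_abs.
have ng : \int[mu]_x f^\- x <= \int[mu]_x g x.
  apply: le_lower_integral => x _; first exact: funeneg_ge0.
  apply: le_trans (fg x); by rewrite funenegE ge_max abse_ge0 -abseN lee_abs.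
move: (\int[mu]_x f^\+ x) (\int[mu]_x f^\- x) p0 n0 pg ng => a c a0 c0 ag cg.
move: a c a0 c0 ag cg => [a||] [c||]//= a0 c0 ag cg.
move: (\int[mu]_x g x) ag cg => [e| |]//=; rewrite ?leey// !lee_fin in a0 c0 *.
rewrite ler_norml => ag cg; apply/andP; split; lra.
Qed.

Lemma lt_limn_einf (u : (\bar R)^nat) (c y : \bar R) :
  c < y -> y <= limn_einf u -> exists N0, forall N, (N0 <= N)%N -> c <= u N.
Proof.
move=> cy; rewrite limn_einf_lim => yl.
have := lt_le_trans cy yl.
rewrite (cvg_lim _ (@cvg_einfs_sup _ u))// => /ereal_sup_gt[_ [N0 _ <-] cN].
exists N0 => N N0N; apply: (le_trans (ltW cN)).
by apply: ereal_inf_lbound; exists N.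
Qed.

Lemma le_by_reals (y z : \bar R) :
  (forall c : R, c%:E < y -> c%:E <= z) -> y <= z.
Proof.
move=> H; rewrite leNgt; apply/negP.
case: z y H => [z||] [y||]//= H.
- rewrite lte_fin => zy; have := H ((y + z) / 2)%R; rewrite lte_fin lee_fin.
  have yz : ((y + z) / 2 < y)%R by lra.
  by move=> /(_ yz); lra.
- by move=> _; have := H (z + 1)%R (ltry _); rewrite lee_fin; lra.
- by move=> _; have := H (y - 1)%R; rewrite lte_fin leeNy_eq => /(_ _)/eqP H';
    have := H' ltac:(lra).
- by move=> _; have := H 0%R (ltry _).
Qed.

Lemma le_limn_einf (u : (\bar R)^nat) (y : \bar R) :
  (forall c : R, c%:E < y -> exists N0, forall N, (N0 <= N)%N -> c%:E <= u N) ->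
  y <= limn_einf u.
Proof.
move=> H; rewrite limn_einf_lim (cvg_lim _ (@cvg_einfs_sup _ u))//.
apply: le_by_reals => c /H[N0 HN0].
apply: le_ereal_sup_tmp; exists (einfs u N0); first by exists N0.
by apply: le_ereal_inf_tmp => _ [N /= N0N <-]; exact: HN0.
Qed.

(** Fatou's lemma in the form in which the potential is handled: neither its
    integrand nor the potential itself is known to be measurable, but each is
    eventually dominated pointwise by measurable functions [g N]. *)
Lemma lower_fatou (f : T -> \bar R) (g : (T -> \bar R)^nat) :
  (forall x, 0 <= f x) -> (forall N x, 0 <= g N x) ->
  (forall N, measurable_fun [set: T] (g N)) ->
  (forall x (c : R), c%:E < f x -> exists N0, forall N, (N0 <= N)%N -> c%:E <= g N x) ->
  \int[mu]_x f x <= limn_einf (fun N => \int[mu]_x g N x).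
Proof.
move=> f0 g0 mg fg; apply: le_trans (fatou mu measurableT mg (fun n x _ => g0 n x)).
by apply: le_lower_integral => // x _; apply: le_limn_einf => c; exact: fg.
Qed.

End IntegralPrelim.

(** * Integration over a power of the space *)

Lemma emeasurable_prod {d : measure_display} {T : measurableType d} {R : realType} (I : Type)
    (s : seq I) (D : set T) (f : I -> T -> \bar R) :
  (forall i, measurable_fun D (f i)) ->
  measurable_fun D (fun x => \prod_(i <- s) f i x)%E.
Proof.
move=> mf; elim: s => [|i s IH].
  by under eq_fun do rewrite big_nil; exact: measurable_cst.
by under eq_fun do rewrite big_cons; exact: emeasurable_funM.
Qed.

Section PowerMeasure.
Local Open Scope ereal_scope.
Context {d : measure_display} {X : measurableType d} {R : realType}.
Variable mu : {measure set X -> \bar R}.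
Hypothesis sf : sigma_finite [set: X] mu.

Let muf : set X -> \bar R := mu.
HB.instance Definition _ := Measure.on muf.
HB.instance Definition _ := Measure_isSigmaFinite.Build _ _ _ muf sf.
Let mus : {sigma_finite_measure set X -> \bar R} := muf.

Let consf k := fun z : X * k.-tuple X => cons_tuple z.1 z.2.

Let mconsf k : measurable_fun [set: X * k.-tuple X] (@consf k).
Proof.
apply: (@measurable_cons _ _ _ _ fst _ snd).
  exact: measurable_fst.
exact: measurable_snd.
Qed.

(** The product of sigma-finite measures is again sigma-finite, which is what
    Tonelli needs at the next stage of the induction. *)
Lemma power_measureP n : exists nu : {sigma_finite_measure set (n.-tuple X) -> \bar R},
  (nu : set _ -> _) = @power_measure _ _ _ mu n /\
  forall F : 'I_n -> X -> \bar R, (forall i, measurable_fun [set: X] (F i)) ->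
    (forall i x, 0 <= F i x) ->
    \int[nu]_ys (\prod_(i < n) F i (tnth ys i)) = \prod_(i < n) \int[mu]_x F i x.
Proof.
elim: n => [|k [nu [nuE IH]]].
  exists (\d_([tuple] : 0.-tuple X)); split => // F mF F0.
  rewrite big_ord0 (eq_integral (cst 1)); last by move=> ys _; rewrite big_ord0.
  by rewrite integral_cst//= mul1e diracT.
pose pm0 : {measure set (k.+1.-tuple X) -> \bar R} := pushforward (mus \x nu) (@consf k).
pose pm := pm0 (@mconsf k).
have pmE Z : pm Z = (mus \x nu) (@consf k @^-1` Z) by [].
have pmsf : sigma_finite [set: k.+1.-tuple X] pm.
  have /sigma_finiteP[A [AT And Afin]] := sigma_finiteT mus.
  have /sigma_finiteP[B [BT Bnd Bfin]] := sigma_finiteT nu.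
  pose tl := fun ys : k.+1.-tuple X => [tuple of behead ys] : k.-tuple X.
  exists (fun n => (@tnth _ X ^~ ord0) @^-1` (A n) `&` tl @^-1` (B n)).
    apply/esym; rewrite -subTset => ys _.
    have [n1 _ An1] : (\bigcup_n A n) (tnth ys ord0) by rewrite -AT.
    have [n2 _ Bn2] : (\bigcup_n B n) (tl ys) by rewrite -BT.
    exists (maxn n1 n2) => //; split.
      by have := And _ _ (leq_maxl n1 n2); rewrite subsetEset; exact.
    by have := Bnd _ _ (leq_maxr n1 n2); rewrite subsetEset; exact.
  move=> n; split.
    apply: measurableI; rewrite -[X in measurable X]setTI.
      by apply: measurable_tnth => //; have [] := Afin n.
    by apply: measurable_behead => //; have [] := Bfin n.
  rewrite pmE (_ : _ @^-1` _ = A n `*` B n); last first.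
    have tlE x ys : tl (consf (x, ys)) = ys by exact/val_inj.
    apply/seteqP; split => -[x ys].
      by move=> [/= Ax]; rewrite tlE.
    by move=> [/= Ax By]; split; rewrite /= ?tlE.
  have [[mA fA] [mB fB]] := (Afin n, Bfin n).
  rewrite product_measure1E//.
  by rewrite lte_mul_pinfty// ge0_fin_numE.
pose pms : {sigma_finite_measure set (k.+1.-tuple X) -> \bar R} :=
   HB.pack_for {sigma_finite_measure set (k.+1.-tuple X) -> \bar R} (Measure.sort pm)
    (isSFinite.Build _ _ _ _ (sfinite_measure_sigma_finite pmsf))
    (isSigmaFinite.Build _ _ _ (Measure.sort pm) pmsf).
exists pms; split.
  by apply/funext => A; rewrite /= /pm /pushforward/= nuE.
move=> F mF F0.
have mp n (G : 'I_n -> X -> \bar R) : (forall i, measurable_fun [set: X] (G i)) ->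
  measurable_fun [set: n.-tuple X] (fun ys => \prod_(i < n) G i (tnth ys i)).
  move=> mG; apply: emeasurable_prod => i.
  by apply: measurableT_comp => //; exact: measurable_tnth.
rewrite [LHS](@ge0_integral_pushforward _ _ _ _ _ (@consf k) _ (mus \x nu) setT) //; first last.
- by move=> ys _; exact: prode_ge0.
- exact: mp.
- exact: mconsf.
rewrite preimage_setT fubini_tonelli1; first last.
- by move=> z; exact: prode_ge0.
- by apply: measurableT_comp; [exact: mp|exact: mconsf].
rewrite /fubini_F big_ord_recl -(IH (fun i => F (lift ord0 i)))//.
have P0 ys : 0 <= \prod_(i < k) F (lift ord0 i) (tnth ys i) by exact: prode_ge0.
rewrite -ge0_integralZr//; last by apply: integral_ge0 => ys _; exact: P0.
apply: eq_integral => x _; rewrite -ge0_integralZl//; last exact: (mp k (fun i => F (lift ord0 i))).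
apply: eq_integral => ys _; rewrite /= /consf/= big_ord_recl tnth0.
by congr (_ * _); apply: eq_bigr => i _; rewrite tnthS.
Qed.
End PowerMeasure.

(** * Balls in a space of homogeneous type *)

Section Geometry.
Context {d : measure_display} {X : measurableType d} {R : realType}.
Variables (rho : X -> X -> R) (mu : {measure set X -> \bar R}).
Hypothesis hX : homogeneous_type rho mu.

Let qm := ht_quasi_metric hX.

Definition vol (x : X) (r : R) : R := fine (mu (qball rho x r)).

Lemma rho_xx x : rho x x = 0.
Proof. exact: (qm_eq0 qm x x).2. Qed.

Lemma qball_center x (r : R) : 0 < r -> qball rho x r x.
Proof. by move=> r0; rewrite /qball/= rho_xx. Qed.

Lemma qball_mono x (r s : R) : r <= s -> qball rho x r `<=` qball rho x s.
Proof. by move=> rs y /lt_le_trans; exact. Qed.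

Lemma measurable_qball x r : measurable (qball rho x r).
Proof.
by rewrite (ht_borel hX); apply: sub_gen_smallest; exact: (ht_ball_open hX).
Qed.

Lemma mu_qball_fin x (r : R) : mu (qball rho x r) \is a fin_num.
Proof.
have [r0|r0] := leP r 0.
  rewrite (_ : qball _ _ _ = set0) ?measure0//.
  apply/seteqP; split => // y; rewrite /qball/= => /lt_le_trans/(_ r0).
  by rewrite ltNge (qm_ge0 qm).
have [L hL] := ht_doubling hX.
have [p le fin] := hL x r r0.
have r2 : 0 < r / 2 by rewrite divr_gt0.
have [_ le2 fin2] := hL x _ r2.
rewrite ge0_fin_numE//.
have : (mu (qball rho x (2 * (r / 2))) < +oo)%E by exact: le_lt_trans le2 fin2.
by rewrite mulrC divfK// pnatr_eq0.
Qed.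

Lemma mu_qballE x r : mu (qball rho x r) = (vol x r)%:E.
Proof. by rewrite /vol fineK// mu_qball_fin. Qed.

Lemma vol_gt0 x r : 0 < r -> 0 < vol x r.
Proof.
move=> r0; rewrite -lte_fin -mu_qballE.
have [L hL] := ht_doubling hX.
have r2 : 0 < r / 2 by rewrite divr_gt0.
have [+ _ _] := hL x _ r2.
by rewrite mulrC divfK// pnatr_eq0.
Qed.

Lemma vol_le x y r s : qball rho x r `<=` qball rho y s -> vol x r <= vol y s.
Proof.
move=> sub; rewrite -lee_fin -!mu_qballE; apply: le_measure => //;
  exact/mem_set/measurable_qball.
Qed.

Lemma vol_doubling : exists2 L : R, 1 <= L &
  forall x r (k : nat), 0 < r -> vol x (2 ^+ k * r) <= L ^+ k * vol x r.
Proof.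
have [L hL] := ht_doubling hX.
exists (Num.max L 1); first by rewrite le_max lexx orbT.
move=> x r k r0; elim: k => [|k IH]; first by rewrite !expr0 !mul1r.
have L1 : 1 <= Num.max L 1 by rewrite le_max lexx orbT.
have rk : 0 < 2 ^+ k * r by rewrite mulr_gt0// exprn_gt0.
have [_ + _] := hL x _ rk.
rewrite mulrA -exprS !mu_qballE lee_fin => /le_trans; apply.
rewrite [X in _ <= X * _]exprS -mulrA.
apply: (le_trans (y := Num.max L 1 * vol x (2 ^+ k * r))).
  by rewrite ler_wpM2r ?le_max ?lexx// ltW// vol_gt0.
by rewrite ler_wpM2l// (le_trans _ L1).
Qed.

(** The balls of radius [n] around any point exhaust the space. *)
Lemma qball_sigma_finite : (exists x : X, True) -> sigma_finite [set: X] mu.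
Proof.
move=> [x _]; exists (fun n => qball rho x n%:R).
  apply/esym; rewrite -subTset => y _.
  exists (Num.truncn (rho x y)).+1 => //=.
  by rewrite /qball/=; exact: truncnS_gt.
by move=> n; split; [exact: measurable_qball|rewrite mu_qballE ltry].
Qed.

Variable kappa : R.
Hypothesis kappa1 : 1 <= kappa.
Hypothesis tri : forall x y z, rho x y <= kappa * (rho x z + rho z y).

(** Two applications of the quasi-triangle inequality, through the common point
    [z] and then through the centre [y]. *)
Lemma engulf (D : R) x y r s z : 0 <= D -> s <= D * r ->
  qball rho x r z -> qball rho y s z ->
  qball rho y s `<=` qball rho x (kappa * (1 + 2 * kappa * D) * r).
Proof.
move=> D0 sD xz yz w yw; rewrite /qball/= in xz yz yw *.
have k0 : 0 < kappa by exact: lt_le_trans kappa1.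
have h1 := tri x w z.
have h2 := tri z w y; rewrite (qm_sym qm z y) in h2.
apply: (le_lt_trans h1); rewrite -mulrA ltr_pM2l//.
have : kappa * (rho y z + rho y w) <= kappa * (2 * (D * r)).
  by rewrite ler_wpM2l// ?(ltW k0)//; lra.
lra.
Qed.

(** A ball that meets another one of comparable radius lies in a dilation of it, so
    iterated doubling bounds its volume. All comparisons of averages over
    different balls rest on this. *)
Lemma vol_engulf (D : R) : 0 <= D -> exists2 C : R, 1 <= C &
  forall x y r s z, 0 < r -> s <= D * r ->
    qball rho x r z -> qball rho y s z -> vol y s <= C * vol x r.
Proof.
move=> D0; have [L L1 hL] := vol_doubling.
set E := kappa * (1 + 2 * kappa * D).
pose k := (Num.truncn E).+1.
exists (L ^+ k); first by rewrite exprn_ege1.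
move=> x y r s z r0 sD xz yz.
apply: le_trans (hL x r k r0); apply: vol_le.
apply: subset_trans (engulf D0 sD xz yz) _; apply: qball_mono.
rewrite ler_wpM2r ?(ltW r0)//.
apply: le_trans (ltW (truncnS_gt E)) _.
by rewrite -natrX ler_nat ltnW// ltn_expl.
Qed.

End Geometry.

(** * Covering lemma and weak-type bound *)

Lemma ex_least_nat (P : nat -> Prop) : (exists n, P n) ->
  exists n, P n /\ forall k, (k < n)%N -> ~ P k.
Proof.
move=> [n Pn]; have ex : exists n, `[< P n >] by exists n; exact/asboolP.
exists (ex_minn ex); case: ex_minnP => k /asboolP Pk kmin; split => // l lk Pl.
by have := kmin l (introT (asboolP _) Pl); rewrite leqNgt lk.
Qed.

(** Vitali selection for sets graded by [j] (larger [j] meaning smaller sets).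
    Zorn's lemma is applied to the disjoint subfamilies that dominate every set
    they meet; if some set met none of a maximal such subfamily, one of least
    grade could be added to it. *)
Lemma vitali_selection (X I : Type) (F : set I) (B : I -> set X) (j : I -> nat) :
  (forall i, F i -> B i !=set0) ->
  exists D : set I, [/\ D `<=` F, trivIset D B &
    forall i, F i -> exists k, [/\ D k, (j k <= j i)%N & B i `&` B k !=set0]].
Proof.
move=> Bn0.
pose dom (D : set I) i := exists k, [/\ D k, (j k <= j i)%N & B i `&` B k !=set0].
pose apart (D : set I) i := forall k, D k -> B i `&` B k = set0.
pose P (D : set I) := [/\ D `<=` F, trivIset D B &
  forall i, F i -> apart D i \/ dom D i].
have [D [[DF tD PD] Dmax]] : exists D, P D /\ forall E, D `<` E -> ~ P E.
  apply: Zorn_bigcup => C CP Ctot; split.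
  - by move=> i [E CE Ei]; have [EF _ _] := CP _ CE; exact: EF.
  - move=> i k [E CE Ei] [G CG Gk].
    have [EG|GE] := Ctot _ _ CE CG.
      by have [_ tG _] := CP _ CG; exact: tG (EG _ Ei) Gk.
    by have [_ tE _] := CP _ CE; exact: tE Ei (GE _ Gk).
  - move=> i Fi; have [[E [CE dE]]|nE] := pselect (exists E, C E /\ dom E i).
      right; have [k [Ek jk ik]] := dE; exists k; split => //; by exists E.
    left => k [E CE Ek]; have [_ _ /(_ i Fi)[aE|dE]] := CP _ CE; first exact: aE.
    by exfalso; apply: nE; exists E.
exists D; split => // i Fi; have [aD|//] := PD i Fi.
exfalso.
have [n [[k [jk Fk ak]] nmin]] : exists n, (exists k, [/\ j k = n, F k & apart D k])
    /\ forall l, (l < n)%N -> ~ exists k, [/\ j k = l, F k & apart D k].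
  by apply: ex_least_nat; exists (j i), i.
have Dk : ~ D k.
  by move=> Dk; have := ak k Dk; rewrite setIid; apply/eqP/set0P/Bn0.
apply: (Dmax (D `|` [set k])).
  by split; [exact: subsetUl|move=> /(_ k (or_intror erefl))].
split.
- by move=> l [/DF//|->].
- move=> a b [Da|->] [Db|->] //.
  + exact: tD.
  + by rewrite setIC => /set0P/eqP; rewrite ak.
  + by move=> /set0P/eqP; rewrite ak.
- move=> l Fl; have [al|[m [Dm jm lm]]] := PD l Fl; last first.
    by right; exists m; split => //; left.
  have [lk|/set0P lk] := eqVneq (B l `&` B k) set0.
    by left=> m [/al//|->].
  right; exists k; split => //; first by right.
  rewrite leqNgt; apply/negP => jl; apply: (nmin (j l)); first by rewrite -jk.
  by exists l.
Qed.

Section WeakType.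
Context {d : measure_display} {X : measurableType d} {R : realType}.
Variables (rho : X -> X -> R) (mu : {measure set X -> \bar R}).
Hypothesis hX : homogeneous_type rho mu.
Variable kappa : R.
Hypothesis kappa1 : 1 <= kappa.
Hypothesis tri : forall x y z, rho x y <= kappa * (rho x z + rho z y).

(** The dilations of the balls selected by Vitali's lemma cover the union, and the
    selected balls are disjoint, so their integrals of [h] add up. This replaces
    the weak-type bound of the maximal function of [h]. *)
Lemma weak_type : exists2 C : R, 1 <= C &
  forall (rad : nat -> R) (c : nat -> X) (j : nat -> nat) (F : set nat) (h : X -> \bar R),
  (forall n, 0 < rad n) -> (forall n k, (n <= k)%N -> rad k <= rad n) ->
  measurable_fun [set: X] h -> (forall x, 0 <= h x)%E ->
  (forall n, F n -> (mu (qball rho (c n) (rad (j n))) <=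
     \int[mu]_(x in qball rho (c n) (rad (j n))) h x)%E) ->
  (mu (\bigcup_(n in F) qball rho (c n) (rad (j n))) <= C%:E * \int[mu]_x h x)%E.
Proof.
pose E := kappa * (1 + 2 * kappa).
have k0 : 0 < kappa by exact: lt_le_trans kappa1.
have E0 : 0 < E by rewrite /E mulr_gt0// addr_gt0// mulr_gt0.
have [C C1 hC] := vol_engulf hX kappa1 tri (ltW E0).
exists C => // rad c j F h rad0 radS mh h0 hF.
pose B n := qball rho (c n) (rad (j n)).
have [D [DF tD hD]] := @vitali_selection X nat F B j
  (fun n _ => ex_intro _ (c n) (qball_center hX (c n) (rad0 (j n)))).
pose B' n := if n \in D then B n else set0.
pose S n := if n \in D then qball rho (c n) (E * rad (j n)) else set0.
have mB n : measurable (B' n) by rewrite /B'; case: ifP => _ //; exact: (measurable_qball hX).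
have mS n : measurable (S n) by rewrite /S; case: ifP => _ //; exact: (measurable_qball hX).
have mU : measurable (\bigcup_(n in F) B n).
  by apply: bigcup_measurable => n _; exact: (measurable_qball hX).
have tB : trivIset setT B' by rewrite -(trivIset_mkcond D B).
have sub : \bigcup_(n in F) B n `<=` \bigcup_n S n.
  move=> x [n Fn Bx]; have [k [Dk jk [z [Bnz Bkz]]]] := hD n Fn.
  exists k => //; rewrite /S mem_set//.
  have := @engulf _ _ _ _ _ hX kappa kappa1 tri 1 (c k) (c n) (rad (j k)) (rad (j n)) z.
  rewrite mulr1 mul1r => /(_ ler01 (radS _ _ jk) Bkz Bnz); exact.
apply: (le_trans (measure_sigma_subadditive _ mS mU sub)).
have mus n : (mu (S n) <= C%:E * \int[mu]_(x in B' n) h x)%E.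
  rewrite /S /B'; case: ifPn => [/set_mem Dn|_]; last first.
    by rewrite measure0 integral_set0 mule0.
  apply: (@le_trans _ _ (C%:E * mu (B n))%E); last first.
    by rewrite lee_pmul2l ?lte_fin ?(lt_le_trans _ C1)//; exact/hF/DF.
  rewrite /B !(mu_qballE hX) -EFinM lee_fin.
  apply: (@hC _ _ _ _ (c n)) => //; try exact: (qball_center hX).
  by apply: (qball_center hX); rewrite mulr_gt0.
apply: (le_trans (lee_nneseries _ (fun n _ => mus n))) => //.
rewrite nneseriesZl//; last by move=> n _; exact: integral_ge0.
apply: lee_wpmul2l; first by rewrite lee_fin (le_trans _ C1).
rewrite -ge0_integral_bigcup//; last by apply: measurable_funS mh.
by apply: ge0_subset_integral => //; exact: bigcup_measurable.
Qed.

End WeakType.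

(** * Young functions and a dyadic conjugate *)

Section YoungBasics.
Context {R : realType}.
Variables (Phi : R -> R) (hPhi : young_function Phi).

Lemma young_convex0 (t x : R) : 0 <= t -> t <= 1 -> 0 <= x -> Phi (t * x) <= t * Phi x.
Proof.
move=> t0 t1 x0.
have := @young_convex _ _ hPhi (Itv01 t0 t1) x 0.
rewrite !inE/= !in_itv/= !andbT lexx x0 => /(_ isT isT).
move=> h.
have {}h : Phi (t * x + (1 - t) * 0) <= t * Phi x + (1 - t) * Phi 0 := h.
by rewrite (young0 hPhi) !mulr0 !addr0 in h.
Qed.

(** Convexity and [Phi 0 = 0]. *)
Lemma young_slope_le (x y : R) : 0 < x -> x <= y -> Phi x / x <= Phi y / y.
Proof.
move=> x0 xy; have y0 : 0 < y by exact: lt_le_trans xy.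
have := @young_convex0 (x / y) y; rewrite divfK ?gt_eqF// => h.
rewrite ler_pdivrMr// (_ : Phi y / y * x = x / y * Phi y); last by ring.
by apply: h; rewrite ?divr_ge0 ?ler_pdivrMr ?mul1r ?(ltW x0) ?(ltW y0).
Qed.

Definition slope (j : nat) : R := Phi (2 ^+ j) / 2 ^+ j.

Lemma slope_ge1 j : 1 <= slope j.
Proof.
have := @young_slope_le 1 (2 ^+ j); rewrite (young1 hPhi) divr1; apply => //.
by rewrite exprn_ege1// ler1n.
Qed.

(** A substitute for the complementary Young function of [Phi]: it dominates it up
    to constants, and being a sum of truncated linear functions it can be summed
    against powers term by term. *)
Definition theta (s : R) : \bar R :=
  (\sum_(j <oo) (if slope j < s then s * 2 ^+ j else 0)%:E)%E.

Let theta_term_ge0 s j : 0 <= (if slope j < s then s * 2 ^+ j else 0).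
Proof.
case: ifPn => // sj; rewrite mulr_ge0 ?exprn_ge0//.
by rewrite (le_trans _ (ltW sj))// (le_trans _ (slope_ge1 j)).
Qed.

Lemma theta_ge0 s : (0 <= theta s)%E.
Proof. by apply: nneseries_ge0 => j _ _; rewrite lee_fin theta_term_ge0. Qed.

Lemma theta_le1 s : s <= 1 -> theta s = 0%E.
Proof.
move=> s1; apply: eseries0 => j _ _.
by rewrite ltNge (le_trans s1 (slope_ge1 j)).
Qed.

Lemma measurable_theta d (T : measurableType d) (a : T -> R) :
  measurable_fun [set: T] a -> measurable_fun [set: T] (theta \o a).
Proof.
move=> ma; apply: (@ge0_emeasurable_sum _ _ _ _
   (fun j x => (if slope j < a x then a x * 2 ^+ j else 0)%:E) xpredT).
  by move=> k x _ _; rewrite lee_fin theta_term_ge0.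
move=> j _; apply/measurable_EFinP.
apply: measurable_fun_ifT => //.
  exact: measurable_fun_ltr.
exact: measurable_funM.
Qed.

(** Young's inequality for the pair [Phi], [theta]: if [Phi t < s * t] then [t]
    is below twice a power of 2 whose slope is below [s]. *)
Lemma young_theta (s t : R) : 0 <= s -> 0 <= t ->
  ((s * t)%:E <= 1 + (Phi t)%:E + 2%:E * theta s)%E.
Proof.
move=> s0 t0; have P0 := young_ge0 hPhi t0; have T0 := theta_ge0 s.
have T20 : (0 <= 2%:E * theta s)%E by rewrite mule_ge0.
have small : s * t <= 1 + Phi t -> ((s * t)%:E <= 1 + (Phi t)%:E + 2%:E * theta s)%E.
  by move=> h; rewrite -[leLHS]adde0 leeD// -EFinD lee_fin.
have [h|h] := leP (s * t) (1 + Phi t); first exact: small.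
have key (j : nat) : slope j < s -> t <= 2 ^+ j.+1 ->
    ((s * t)%:E <= 1 + (Phi t)%:E + 2%:E * theta s)%E.
  move=> js tj; apply: (@le_trans _ _ (2%:E * theta s)%E); last first.
    by rewrite -[leLHS]add0e leeD// -EFinD lee_fin; lra.
  apply: (@le_trans _ _ (2%:E * (s * 2 ^+ j)%:E)%E).
    by rewrite -EFinM lee_fin mulrCA -exprS ler_wpM2l.
  rewrite lee_pmul2l// /theta.
  apply: le_trans (nneseries_lim_ge j.+1 _); last first.
    by move=> k _ _; rewrite lee_fin theta_term_ge0.
  rewrite big_nat_recr//= js -[leLHS]add0e leeD// sume_ge0// => k _.
  by rewrite lee_fin theta_term_ge0.
have [t1|t1] := leP t 1.
  have [s1|s1] := leP s 1; first by apply: small; nra.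
  apply: (key 0%N); last by rewrite expr1 (le_trans t1)// ler1n.
  by rewrite /slope expr0 divr1 (young1 hPhi).
have [n [tn nmin]] : exists n, t <= 2 ^+ n.+1 /\ forall k, (k < n)%N -> ~ (t <= 2 ^+ k.+1).
  apply: ex_least_nat; exists (Num.truncn t).
  by rewrite (le_trans (ltW (truncnS_gt t)))// -natrX ler_nat ltnW// ltn_expl.
have nt : 2 ^+ n <= t.
  case: n tn nmin => [|n] tn nmin; first by rewrite expr0 ltW.
  by rewrite leNgt; apply/negP => /ltW; exact: nmin.
apply: (key n) => //.
apply: le_lt_trans (young_slope_le _ nt) _; first by rewrite exprn_gt0.
by rewrite ltr_pdivrMr ?(lt_trans _ t1)//; lra.
Qed.

End YoungBasics.

(** * Dyadic sums and the tail condition *)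

Lemma nneseries_le_bound {R : realType} (u : (\bar R)^nat) (C : \bar R) :
  (forall n, (0 <= u n)%E) -> (forall n, (\sum_(0 <= k < n) u k <= C)%E) ->
  (\sum_(k <oo) u k <= C)%E.
Proof.
move=> u0 uC; apply: lime_le; first by apply: is_cvg_nneseries => *; exact: u0.
by apply: nearW => n; exact: uC.
Qed.

Section DyadicSums.
Context {R : realType}.

Lemma powR_pred (x s : R) : 0 < x -> x `^ s = x `^ (s - 1) * x.
Proof.
move=> x0; rewrite -[X in _ = _ * X](powRr1 (ltW x0)) -powRD ?subrK//.
by rewrite (gt_eqF x0) implybT.
Qed.

(** A geometric sum dominated by its last term, uniformly in the ratio [tau / eps]. *)
Lemma dyadic_powR_sum (beta : R) : 0 < beta -> exists2 C : R, 0 <= C &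
  forall eps tau : R, 0 < eps -> 0 <= tau ->
  (\sum_(k <oo) (if (eps * 2 ^+ k < tau) then (eps * 2 ^+ k) `^ beta else 0)%:E
    <= (C * tau `^ beta)%:E)%E.
Proof.
move=> b0; have p2 : 1 < 2 `^ beta :> R.
  have := @gt0_ltr_powR R beta b0 1 2; rewrite powR1 !nnegrE ler01 ler0n.
  by move=> /(_ isT isT); apply; rewrite ltr1n.
have p20 : 0 < 2 `^ beta - 1 :> R by rewrite subr_gt0.
exists (2 `^ beta / (2 `^ beta - 1)).
  by rewrite divr_ge0 ?(ltW p20)// powR_ge0.
move=> eps tau eps0 tau0; apply: nneseries_le_bound => [k|n].
  by case: ifP => // _; rewrite lee_fin powR_ge0.
rewrite sumEFin lee_fin.
pose x k : R := eps * 2 ^+ k.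
have x0 k : 0 < x k by rewrite /x mulr_gt0// exprn_gt0.
have xS k : x k.+1 = 2 * x k by rewrite /x exprS mulrCA.
rewrite mulrAC -powRM//.
set S := (X in X <= _).
suff : S <= Num.min (x n `^ beta) ((2 * tau) `^ beta) / (2 `^ beta - 1).
  move=> /le_trans; apply; rewrite ler_pM2r ?invr_gt0//.
  by rewrite ge_min lexx orbT.
rewrite {}/S; elim: n => [|n IH].
  by rewrite big_nil divr_ge0 ?(ltW p20)// le_min !powR_ge0.
rewrite big_nat_recr//=; rewrite -/(x n).
have xb k : x k.+1 `^ beta = 2 `^ beta * x k `^ beta by rewrite xS powRM// ltW.
case: ifPn => [xt|_]; last first.
  rewrite addr0 (le_trans IH)// ler_pM2r ?invr_gt0// le_min !ge_min lexx orbT andbT.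
  by rewrite xb ler_peMl ?powR_ge0// ltW.
rewrite (min_idPl _); last first.
  apply: ge0_ler_powR; rewrite ?nnegrE ?(ltW b0) ?(ltW (x0 _)) ?mulr_ge0//.
  by rewrite xS ler_pM2l// ltW.
rewrite ler_pdivlMr// mulrDl -[X in _ <= X]subr0 xb.
have : \sum_(0 <= i < n) (if eps * 2 ^+ i < tau then (eps * 2 ^+ i) `^ beta else 0)
   <= x n `^ beta / (2 `^ beta - 1).
  by rewrite (le_trans IH)// ler_pM2r ?invr_gt0// ge_min lexx.
rewrite ler_pdivlMr//; lra.
Qed.

Variables (Phi : R -> R) (hPhi : young_function Phi).

(** Exchanging the sum over the levels [eps * 2 ^+ k] with the sum defining [theta]
    leaves, for each [j], a geometric sum of size [a `^ s * 2 ^+ j * slope Phi j `^ (1 - s)].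
    This is where the tail condition on [Phi] enters. *)
Lemma theta_sum (s : R) : 1 < s ->
  (\sum_(j <oo) (2 ^+ j * slope Phi j `^ (1 - s))%:E < +oo)%E ->
  exists2 C : R, 0 <= C & forall eps a : R, 0 < eps -> 0 <= a ->
  (\sum_(k <oo) ((eps * 2 ^+ k) `^ s)%:E * theta Phi (a / (eps * 2 ^+ k))
    <= (C * a `^ s)%:E)%E.
Proof.
move=> s1 fin; have [C C0 hC] := @dyadic_powR_sum (s - 1) ltac:(lra).
set S := (\sum_(j <oo) _)%E in fin.
have S0 : (0 <= S)%E.
  by apply: nneseries_ge0 => j _ _; rewrite lee_fin mulr_ge0 ?exprn_ge0 ?powR_ge0.
exists (C * fine S); first by rewrite mulr_ge0// fine_ge0.
move=> eps a eps0 a0.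
pose x k : R := eps * 2 ^+ k.
have x0 k : 0 < x k by rewrite /x mulr_gt0// exprn_gt0.
have sl0 j : 0 < slope Phi j by exact: lt_le_trans (slope_ge1 hPhi j).
pose t k j : \bar R := (a * 2 ^+ j * (if x k < a / slope Phi j then x k `^ (s - 1) else 0))%:E.
have t0 k j : (0 <= t k j)%E.
  rewrite lee_fin mulr_ge0// ?mulr_ge0 ?exprn_ge0//.
  by case: ifP => // _; rewrite powR_ge0.
rewrite (eq_eseriesr (g := fun k => (\sum_(j <oo) t k j)%E)); last first.
  move=> k _; rewrite /theta -nneseriesZl; last first.
    move=> j _; case: ifP => // _.
    by rewrite lee_fin mulr_ge0 ?exprn_ge0// divr_ge0// ltW// x0.
  apply: eq_eseriesr => j _; rewrite -EFinM; congr EFin.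
  rewrite -/(x k) ltr_pdivlMr// [in RHS]ltr_pdivlMr// [x k * _]mulrC.
  case: ifPn => _; last by rewrite !mulr0.
  rewrite (powR_pred s (x0 k)).
  by field; rewrite gt_eqF.
rewrite nneseries_interchange//.
apply: (@le_trans _ _ (\sum_(j <oo) ((C * a `^ s)%:E * (2 ^+ j * slope Phi j `^ (1 - s))%:E))%E).
  apply: lee_nneseries => [j _ _|j _]; first exact: nneseries_ge0.
  rewrite /t; under eq_eseriesr do rewrite EFinM.
  rewrite nneseriesZl; last by move=> k _; case: ifP => // _; rewrite lee_fin powR_ge0.
  have aj : 0 <= a / slope Phi j by rewrite divr_ge0// ltW.
  apply: (@le_trans _ _ ((a * 2 ^+ j)%:E * (C * (a / slope Phi j) `^ (s - 1))%:E)%E).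
    by apply: lee_wpmul2l; [rewrite lee_fin mulr_ge0 ?exprn_ge0|exact: hC].
  rewrite -EFinM lee_fin powRM ?invr_ge0 ?(ltW (sl0 j))//.
  rewrite -[(slope Phi j)^-1]powR_inv1 ?(ltW (sl0 j))// -powRrM mulN1r opprB.
  have [->|an0] := eqVneq a 0; first by rewrite !mul0r mulr_ge0 ?mulr_ge0 ?exprn_ge0 ?powR_ge0.
  rewrite (@powR_pred a s) ?lt_neqAle ?a0 ?andbT 1?eq_sym//.
  by rewrite le_eqVlt; apply/orP; left; apply/eqP; ring.
rewrite nneseriesZl; last by move=> j _; rewrite lee_fin mulr_ge0 ?exprn_ge0 ?powR_ge0.
rewrite -/S -[S]fineK ?ge0_fin_numE// -EFinM lee_fin.
by rewrite le_eqVlt; apply/orP; left; apply/eqP; ring.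
Qed.

End DyadicSums.

Lemma nneseries_single {R : realType} (u : (\bar R)^nat) (k : nat) :
  (forall n, (0 <= u n)%E) -> (forall n, n <> k -> u n = 0%E) ->
  (\sum_(n <oo) u n = u k)%E.
Proof.
move=> u0 uk; rewrite (@nneseriesD1 _ u k)// eseries0 ?adde0// => n _ /andP[_ /eqP].
exact: uk.
Qed.

Section Tail.
Context {R : realType}.
Variables (Phi : R -> R) (hPhi : young_function Phi).

Lemma conj_expK (s : R) : 1 < s -> conj_exp (conj_exp s) = s.
Proof.
move=> s1; rewrite /conj_exp; have h : s - 1 != 0 by rewrite subr_eq0 gt_eqF.
have -> : s / (s - 1) - 1 = (s - 1)^-1 by field.
by rewrite invrK divfK.
Qed.

(** The integrand of the tail condition is [(Phi t / t) `^ (1 - s)], a nonincreasing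
    function of [t], so the integral over [[2 ^+ j, 2 ^+ j.+1]] dominates [2 ^+ j]
    times the value at the right end. *)
Lemma tail_slope_sum (s c : R) : 1 < s -> 0 < c ->
  (tail_integral Phi (conj_exp s) (s - 1) c < +oo)%E ->
  (\sum_(j <oo) (2 ^+ j * slope Phi j `^ (1 - s))%:E < +oo)%E.
Proof.
move=> s1 c0 fin.
pose w j : R := slope Phi j `^ (1 - s).
have w0 j : 0 <= w j by exact: powR_ge0.
(* the dyadic intervals from the J-th on lie beyond c *)
pose J := (Num.truncn c).+1.
have cJ j : (J <= j)%N -> c <= 2 ^+ j.
  move=> Jj; rewrite (le_trans (ltW (truncnS_gt c)))// -natrX ler_nat.
  by rewrite (leq_trans Jj)// ltnW// ltn_expl.
pose I j : set R := `[2 ^+ (j + J), 2 ^+ (j + J).+1[%classic.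
have mI j : measurable (I j) by exact: measurable_itv.
pose g j (t : R) : \bar R := (w (j + J).+1 * \1_(I j) t)%:E.
have g0 j t : (0 <= g j t)%E by rewrite lee_fin mulr_ge0.
have mg j : measurable_fun [set: R] (g j).
  by apply/measurable_EFinP; apply: measurable_funM.
have mgI j : measurable_fun [set: R] (fun t => (\1_(I j) t)%:E : \bar R).
  by apply/measurable_EFinP.
have Idisj j k t : I j t -> I k t -> j = k.
  wlog jk : j k / (j <= k)%N.
    by move=> H; have [jk|/ltnW kj] := leqP j k; [exact: H|move=> ? ?; apply/esym/H].
  rewrite /I/= !in_itv/= => /andP[_ t1] /andP[t2 _].
  apply/eqP; rewrite eqn_leq jk/= leqNgt; apply/negP => jk'.
  have := le_lt_trans t2 t1; rewrite ltNge => /negP; apply.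
  by rewrite ler_weXn2l ?ler1n// ltn_add2r.
have slopej j t : I j t -> w (j + J).+1 <=
    ((t `^ conj_exp s) / Phi t) `^ (s - 1) / t.
  rewrite /I/= in_itv/= => /andP[t1 t2].
  have p1 : 1 <= 2 ^+ (j + J) :> R by rewrite exprn_ege1// ler1n.
  have t0 : 0 < t by rewrite (lt_le_trans _ t1)// exprn_gt0.
  have Pt : 0 < Phi t.
    have := young_slope_le hPhi ltr01 (le_trans p1 t1).
    rewrite (young1 hPhi) divr1 ler_pdivlMr// mul1r; exact: lt_le_trans.
  have -> : ((t `^ conj_exp s) / Phi t) `^ (s - 1) / t = (Phi t / t) `^ (1 - s).
    rewrite !powRM ?invr_ge0 ?powR_ge0 ?(ltW t0) ?(ltW Pt)//.
    rewrite -[(Phi t)^-1]powR_inv1 ?(ltW Pt)// -[(t^-1)]powR_inv1 ?(ltW t0)//.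
    rewrite -!powRrM !mulN1r opprB mulrAC mulrC; congr (_ * _).
    rewrite -powRD ?(gt_eqF t0) ?implybT//; congr powR.
    by rewrite /conj_exp divfK ?subr_eq0 ?gt_eqF// opprB.
  have sl0 : 0 < slope Phi (j + J).+1 by exact: lt_le_trans (slope_ge1 hPhi _).
  have Ptt : 0 < Phi t / t by rewrite divr_gt0.
  rewrite /w -[1 - s]opprB !powRN lef_pV2 ?posrE ?powR_gt0//.
  apply: ge0_ler_powR; rewrite ?nnegrE ?subr_ge0 ?(ltW s1) ?(ltW sl0) ?(ltW Ptt)//.
  exact: young_slope_le hPhi _ _ t0 (ltW t2).
have le1 : (\sum_(j <oo) (w (j + J).+1 * 2 ^+ (j + J))%:E < +oo)%E.
  apply: le_lt_trans fin.
  apply: (@le_trans _ _ (\int[lebesgue_measure]_t \sum_(j <oo) g j t)%E).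
    rewrite integral_nneseries//; apply: lee_nneseries => [j _ _|j _].
      by rewrite lee_fin mulr_ge0// exprn_ge0.
    rewrite /g; under eq_integral do rewrite EFinM.
    rewrite ge0_integralZl_EFin//; last exact: mgI.
    rewrite integral_indic; [rewrite setIT (_ : _ (I j) = (2 ^+ (j + J))%:E)|exact: measurableT|exact: mI]; last first.
      have := lebesgue_measure_itv `[2 ^+ (j + J) : R, 2 ^+ (j + J).+1[.
      rewrite /= lte_fin ltr_eXn2l ?ltr1n// ltnSn -EFinB => ->; congr EFin.
      by rewrite exprS; ring.
    by rewrite -EFinM.
  rewrite /tail_integral [leRHS]integral_mkcond.
  apply: le_lower_integral => t _; first exact: nneseries_ge0.
  have [[j Ijt]|nI] := pselect (exists j, I j t); last first.
    rewrite eseries0 => [|j _ _]; last first.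
      rewrite /g indicE memNset ?mulr0// => Ij; apply: nI; by exists j.
    rewrite /patch; case: ifPn => // /set_mem/=; rewrite in_itv/= andbT => ct.
    by rewrite lee_fin divr_ge0 ?powR_ge0// (le_trans (ltW c0)).
  rewrite (nneseries_single (k := j))//; last first.
    move=> k kj; rewrite /g indicE memNset ?mulr0// => Ik; apply: kj.
    exact: Idisj Ik Ijt.
  rewrite /g indicE mem_set// mulr1 patchT; first by rewrite lee_fin; exact: slopej.
  rewrite inE/= in_itv/= andbT; move: Ijt; rewrite /I/= in_itv/= => /andP[+ _].
  by apply: le_trans; apply: cJ; rewrite leq_addl.
pose v j := (2 ^+ j * w j)%:E.
have v0 j : (0 <= v j)%E by rewrite lee_fin mulr_ge0// exprn_ge0.
rewrite (@nneseries_split _ v 0 J.+1)// {1}/v sumEFin add0n.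
rewrite lte_add_pinfty ?ltry//.
rewrite -(@nneseries_addn _ v)//.
rewrite (eq_eseriesr (g := fun j => (2%:E * (w (j + J).+1 * 2 ^+ (j + J))%:E)%E)); last first.
  by move=> j _; rewrite /v addnS exprS -EFinM; congr EFin; ring.
rewrite nneseriesZl; last by move=> j _; rewrite lee_fin mulr_ge0// exprn_ge0.
by rewrite lte_mul_pinfty.
Qed.

End Tail.

(** * Carleson embedding for Orlicz averages *)

Section OrliczPairing.
Context {d : measure_display} {X : measurableType d} {R : realType}.
Variable (mu : {measure set X -> \bar R}).
Variables (Phi : R -> R) (hPhi : young_function Phi).

Lemma measurable_young_ext (w : X -> \bar R) :
  measurable_fun [set: X] w -> (forall x, 0 <= w x)%E ->
  measurable_fun [set: X] (fun x => young_ext Phi (w x)).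
Proof.
move=> mw w0.
rewrite (_ : (fun x => _) = fun x => if w x == +oo%E then +oo%E else (Phi (fine (w x)))%:E); last first.
  by apply/funext => x; have := w0 x; case: (w x).
apply: measurable_fun_ifT => //.
  apply: (@measurable_fun_bool _ _ _ _ true); rewrite setTI.
  rewrite (_ : _ @^-1` _ = w @^-1` [set +oo%E]); last first.
    by apply/seteqP; split => x /= /eqP.
  by rewrite -[X in measurable X]setTI; apply: mw => //; exact: emeasurable_set1.
apply/measurable_EFinP.
apply: (measurable_comp (F := `[0, +oo[%classic : set R) (f := Phi) (g := fine \o w)) => //.
- by move=> _ [x _ <-] /=; rewrite in_itv/= andbT fine_ge0.
- by apply: subspace_continuous_measurable_fun => //; exact: (young_continuous hPhi).
- exact: measurableT_comp.
Qed.

Lemma young_ext_ge0 (x : \bar R) : (0 <= x)%E -> (0 <= young_ext Phi x)%E.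
Proof. by case: x => [r||]//=; rewrite !lee_fin => /(young_ge0 hPhi). Qed.

(** Hoelder's inequality in Orlicz form, from Young's inequality applied to [w / la0]
    and [a / la] pointwise. The level [la] is free: when the average of [F] over [B]
    exceeds [4 * la0 * la], the inequality forces [theta (a / la)] to have average at
    least 1 on [B]. *)
Lemma orlicz_pairing (B : set X) (w F : X -> \bar R) (a : X -> R) (la0 la : R) :
  measurable B -> (mu B < +oo)%E ->
  measurable_fun [set: X] w -> (forall x, 0 <= w x)%E ->
  measurable_fun [set: X] a -> (forall x, 0 <= a x) ->
  (forall x, 0 <= F x)%E ->
  (forall x, w x = +oo%E \/ (F x <= (a x)%:E * w x)%E) ->
  0 < la0 -> 0 < la ->
  (\int[mu]_(x in B) young_ext Phi (w x * (la0^-1)%:E) <= mu B)%E ->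
  (\int[mu]_(x in B) F x <=
   (la0 * la)%:E * (2%:E * mu B + 2%:E * \int[mu]_(x in B) theta Phi (a x / la)))%E.
Proof.
move=> mB fB mw w0 ma a0 F0 Fw la00 la_0 hB.
have lw0 x : (0 <= w x * (la0^-1)%:E)%E by rewrite mule_ge0// lee_fin invr_ge0 ltW.
have mth : measurable_fun [set: X] (fun x => theta Phi (a x / la)).
  by apply: (measurable_theta hPhi (a := fun x => a x / la)); apply: measurable_funM.
have my : measurable_fun [set: X] (fun x => young_ext Phi (w x * (la0^-1)%:E)).
  by apply: measurable_young_ext => //; apply: emeasurable_funM.
pose G x := (1 + young_ext Phi (w x * (la0^-1)%:E) + 2%:E * theta Phi (a x / la))%E.
have y0 x : (0 <= young_ext Phi (w x * (la0^-1)%:E))%E by exact: young_ext_ge0.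
have t0 x : (0 <= theta Phi (a x / la))%E by exact: (theta_ge0 hPhi).
have G0 x : (0 <= G x)%E by rewrite !adde_ge0// mule_ge0.
have ll0 : (0 < (la0 * la)%:E)%E by rewrite lte_fin mulr_gt0.
have mG : measurable_fun [set: X] G.
  apply: emeasurable_funD; first exact: emeasurable_funD.
  exact: measurable_funeM.
apply: (@le_trans _ _ (\int[mu]_(x in B) ((la0 * la)%:E * G x))%E).
  apply: le_lower_integral => // x _.
  have [wy|wfin] := eqVneq (w x) +oo%E.
    rewrite /G wy gt0_mulye ?lte_fin ?invr_gt0//= addey// addye.
      by rewrite gt0_muley// leey.
    have : (0 <= 2%:E * theta Phi (a x / la))%E by rewrite mule_ge0.
    by case: (2%:E * _)%E.
  have Fx : (F x <= (a x)%:E * w x)%E by have [wy|//] := Fw x; rewrite wy in wfin.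
  have wr : w x \is a fin_num by rewrite ge0_fin_numE// ltey.
  apply: (le_trans Fx); rewrite /G -(fineK wr) -!EFinM /=.
  have := @young_theta _ _ hPhi (a x / la) (fine (w x) * la0^-1).
  rewrite !divr_ge0 ?(ltW la00) ?(ltW la_0) ?fine_ge0// => /(_ isT isT) h.
  apply: (le_trans _ (lee_wpmul2l (ltW ll0) h)).
  rewrite lee_fin le_eqVlt; apply/orP; left; apply/eqP.
  by field; rewrite !gt_eqF.
rewrite ge0_integralZl//; [|exact: measurable_funTS|by rewrite ltW].
apply: lee_wpmul2l; first exact: ltW.
rewrite /G ge0_integralD//; first last.
- by apply: measurable_funTS; exact: measurable_funeM.
- by move=> x _; rewrite mule_ge0.
- by apply: measurable_funTS; exact: emeasurable_funD.
- by move=> x _; rewrite adde_ge0.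
rewrite ge0_integralD//; last by apply: measurable_funTS.
rewrite integral_cst// mul1e ge0_integralZl//; last by apply: measurable_funTS.
apply: leeD => //.
rewrite -[X in (_ <= X * _)%E](_ : (1 + 1)%:E = 2%:E) // EFinD ge0_muleDl// mul1e.
exact: leeD.
Qed.

End OrliczPairing.

Section SparseOrlicz.
Context {d : measure_display} {X : measurableType d} {R : realType}.
Variables (rho : X -> X -> R) (mu : {measure set X -> \bar R}).
Hypothesis hX : homogeneous_type rho mu.
Variable kappa : R.
Hypothesis kappa1 : 1 <= kappa.
Hypothesis tri : forall x y z, rho x y <= kappa * (rho x z + rho z y).
Variables (Phi : R -> R) (hPhi : young_function Phi).

(** [A `^ s] is at most a constant times the last of the powers of [eps * 2 ^+ k] whose
    quadruple is below [A]. The term with [eps] covers small [A]. *)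
Lemma powR_dyadic_layers (s eps A : R) : 0 < s -> 0 < eps -> 0 <= A ->
  ((A `^ s)%:E <= ((4 * eps) `^ s)%:E +
    \sum_(k <oo) (if (4 * (eps * 2 ^+ k) < A)%R then
       (8 `^ s * (eps * 2 ^+ k) `^ s)%:E else 0))%E.
Proof.
move=> s0 eps0 A0.
set S := (\sum_(k <oo) _)%E.
have u0 k : (0 <= if (4 * (eps * 2 ^+ k) < A)%R then
       (8 `^ s * (eps * 2 ^+ k) `^ s)%:E else 0)%E.
  by case: ifP => // _; rewrite lee_fin mulr_ge0 ?powR_ge0.
have S0 : (0 <= S)%E by exact: nneseries_ge0.
have [Ae|eA] := leP A (4 * eps).
  rewrite -[leLHS]adde0 leeD// lee_fin; apply: ge0_ler_powR => //; rewrite ?nnegrE ?(ltW s0)//.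
  by rewrite mulr_ge0// ltW.
have [n [nA nmin]] : exists n, A <= 4 * (eps * 2 ^+ n) /\
    forall k, (k < n)%N -> ~ (A <= 4 * (eps * 2 ^+ k)).
  apply: ex_least_nat; exists (Num.truncn (A / (4 * eps))).+1.
  rewrite mulrA -ler_pdivrMl ?mulr_gt0// mulrC.
  by rewrite (le_trans (ltW (truncnS_gt _)))// -natrX ler_nat ltnW// ltn_expl.
case: n nA nmin => [|n] nA nmin; first by rewrite expr0 mulr1 leNgt eA in nA.
rewrite -[leLHS]add0e leeD ?lee_fin ?powR_ge0//.
apply: le_trans (nneseries_lim_ge n.+1 _); last by move=> k _ _; exact: u0.
have An : 4 * (eps * 2 ^+ n) < A by rewrite ltNge; apply/negP/nmin.
rewrite big_nat_recr//= An -[leLHS]add0e leeD ?sume_ge0// lee_fin.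
have x0 : 0 <= eps * 2 ^+ n by rewrite mulr_ge0 ?exprn_ge0// ltW.
rewrite -powRM//; apply: ge0_ler_powR; rewrite ?nnegrE ?(ltW s0) ?(mulr_ge0 _ x0)//.
by apply: (le_trans nA); rewrite exprS; lra.
Qed.

(** Carleson embedding for Orlicz averages. Each [A n] stands for an Orlicz average of
    [a] over the n-th ball, and enters only through the consequence of
    [orlicz_pairing] at all levels below it. At the level [la = eps * 2 ^+ k], the
    balls with [4 * la < A n] have a union of measure at most a constant times the
    integral of [theta (a / la)], by the weak-type bound, and the disjoint sets
    [E n] lie in this union; [theta_sum] adds up the levels. *)
Lemma sparse_orlicz (s : R) : 1 < s ->
  (\sum_(j <oo) (2 ^+ j * slope Phi j `^ (1 - s))%:E < +oo)%E ->
  exists2 C : R, 0 <= C &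
  forall (rad : nat -> R) (c : nat -> X) (j : nat -> nat) (F : set nat)
    (E : nat -> set X) (T : set X) (a : X -> R) (A : nat -> R),
  (forall n, 0 < rad n) -> (forall n k, (n <= k)%N -> rad k <= rad n) ->
  measurable T -> (mu T < +oo)%E ->
  (forall n, F n -> measurable (E n)) ->
  (forall n, F n -> E n `<=` qball rho (c n) (rad (j n)) `&` T) ->
  trivIset F E ->
  measurable_fun [set: X] a -> (forall x, 0 <= a x) ->
  (forall n, 0 <= A n) ->
  (forall n la, F n -> 0 < la -> 4 * la < A n ->
     (mu (qball rho (c n) (rad (j n))) <=
      \int[mu]_(x in qball rho (c n) (rad (j n))) theta Phi (a x / la))%E) ->
  (\sum_(n <oo | n \in F) mu (E n) * (A n `^ s)%:E
     <= C%:E * \int[mu]_x (a x `^ s)%:E)%E.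
Proof.
move=> s1 fin.
have s0 : 0 < s by lra.
have [Cw Cw1 hw] := weak_type hX kappa1 tri.
have [Ct Ct0 ht] := theta_sum hPhi s1 fin.
exists (8 `^ s * Cw * Ct); first by rewrite !mulr_ge0 ?powR_ge0 ?(le_trans ler01 Cw1).
move=> rad c j F E T a A rad0 radS mT fT mE ET tE ma a0 A0 hA.
set I := (\int[mu]_x (a x `^ s)%:E)%E.
have I0 : (0 <= I)%E by apply: integral_ge0 => x _; rewrite lee_fin powR_ge0.
have TE : mu T \is a fin_num by rewrite ge0_fin_numE.
have sumE (G : set nat) : G `<=` F ->
    (\sum_(n <oo | n \in G) mu (E n) = mu (\bigcup_(n in G) E n))%E.
  move=> GF; rewrite measure_bigcup//.
  - by move=> n /GF; exact: mE.
  - by move=> n k Gn Gk; apply: tE; exact: GF.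
(* the levels start at eps; the part of A n below them costs a term that vanishes with eps,
   because all the sets E n lie in the set T of finite measure *)
suff key eps : 0 < eps ->
    (\sum_(n <oo | n \in F) mu (E n) * (A n `^ s)%:E <=
     ((4 * eps) `^ s)%:E * mu T + (8 `^ s * Cw * Ct)%:E * I)%E.
  apply/lee_addgt0Pr => e e0.
  pose M := fine (mu T).
  have M0 : 0 <= M by rewrite fine_ge0.
  pose eta := Num.min 1 (e / (M + 1)).
  have eta0 : 0 < eta by rewrite lt_min ltr01/= divr_gt0// ltr_wpDl.
  have eps0 : 0 < eta / 4 by rewrite divr_gt0.
  apply: (le_trans (key _ eps0)).
  have -> : 4 * (eta / 4) = eta by field.
  rewrite addeC leeD2l// -(fineK TE) -/M -EFinM lee_fin.
  apply: (@le_trans _ _ (eta * M)).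
    rewrite ler_wpM2r//; apply: le_trans (ge1r_powR _ (ltW s1)) _ => //.
    by rewrite eta0 ge_min lexx.
  apply: (@le_trans _ _ (e / (M + 1) * M)).
    by rewrite ler_wpM2r// ge_min lexx orbT.
  by rewrite mulrAC ler_pdivrMr ?ltr_wpDl//; nra.
move=> eps0.
pose x k : R := eps * 2 ^+ k.
have x0 k : 0 < x k by rewrite /x mulr_gt0// exprn_gt0.
pose t n k : \bar R := (if (4 * x k < A n)%R then (8 `^ s * x k `^ s)%:E * mu (E n) else 0)%E.
have t0 n k : (0 <= t n k)%E.
  by rewrite /t; case: ifP => // _; rewrite mule_ge0// lee_fin mulr_ge0 ?powR_ge0.
have th0 k y : (0 <= theta Phi (a y / x k))%E by exact: (theta_ge0 hPhi).
have mth k : measurable_fun [set: X] (fun y => theta Phi (a y / x k)).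
  by apply: (measurable_theta hPhi (a := fun y => a y / x k)); apply: measurable_funM.
apply: (@le_trans _ _ (\sum_(n <oo | n \in F) (((4 * eps) `^ s)%:E * mu (E n) + \sum_(k <oo) t n k))%E).
  apply: lee_nneseries => [n _ _|n H]; first by rewrite mule_ge0// lee_fin powR_ge0.
  have := @powR_dyadic_layers s eps (A n) s0 eps0 (A0 n).
  move=> /(lee_wpmul2l (measure_ge0 mu (E n))) /le_trans; apply.
  rewrite ge0_muleDr ?lee_fin ?powR_ge0//; last first.
    by apply: nneseries_ge0 => k _ _; case: ifP => // _; rewrite lee_fin mulr_ge0 ?powR_ge0.
  have En : mu (E n) \is a fin_num.
    rewrite ge0_fin_numE//; apply: le_lt_trans fT; apply: le_measure; rewrite ?inE//.
      by apply: mE; exact: set_mem.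
    by move=> y /(ET _ (set_mem H))[].
  rewrite [X in (X + _)%E]muleC; apply: leeD => //.
  set m := (X in (X * _ <= _)%E); have -> : m = (fine (mu (E n)))%:E by rewrite fineK.
  rewrite -nneseriesZl; last first.
    by move=> k _; case: ifP => // _; rewrite lee_fin mulr_ge0 ?powR_ge0.
  rewrite (fineK En); apply: lee_nneseries => k; rewrite /t -/(x k); case: ifP => _;
    by rewrite ?mule0 ?mule_ge0 ?lee_fin ?mulr_ge0 ?powR_ge0// muleC.
rewrite nneseriesD//; last 2 first.
- by move=> n _ _; rewrite mule_ge0// lee_fin powR_ge0.
- by move=> n _ _; exact: nneseries_ge0.
apply: leeD.
  rewrite nneseriesZl// sumE//; apply: lee_wpmul2l; first by rewrite lee_fin powR_ge0.
  apply: le_measure; rewrite ?inE//; first exact: bigcup_measurable.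
  by move=> y [n Fn /(ET _ Fn)[]].
rewrite nneseries_interchange//.
apply: (@le_trans _ _ (\sum_(k <oo) (8 `^ s * Cw)%:E * ((x k `^ s)%:E * \int[mu]_y theta Phi (a y / x k)))%E).
  apply: lee_nneseries => [k _ _|k _]; first by exact: nneseries_ge0.
  pose G := [set n | F n /\ 4 * x k < A n].
  have -> : (\sum_(n <oo | n \in F) t n k = (8 `^ s * x k `^ s)%:E * \sum_(n <oo | n \in G) mu (E n))%E.
    rewrite -nneseriesZl// [LHS]eseries_mkcond [RHS]eseries_mkcond.
    apply: eq_eseriesr => n _; rewrite /t.
    have [nF|nF] := boolP (n \in F); have [nA|nA] := boolP (4 * x k < A n).
    - by rewrite mem_set//; split => //; exact: set_mem.
    - by rewrite memNset// => -[_]; rewrite (negPf nA).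
    - by rewrite memNset// => -[/mem_set]; rewrite (negPf nF).
    - by rewrite memNset// => -[/mem_set]; rewrite (negPf nF).
  rewrite sumE; last by move=> n [].
  have mG : measurable (\bigcup_(n in G) qball rho (c n) (rad (j n))).
    by apply: bigcup_measurable => n _; exact: (measurable_qball hX).
  have := hw rad c j G (fun y => theta Phi (a y / x k)) rad0 radS (mth k) (th0 k).
  move=> /(_ (fun n Gn => hA n (x k) Gn.1 (x0 k) Gn.2)) h.
  rewrite [leRHS](_ : _ = (8 `^ s * x k `^ s)%:E * (Cw%:E * \int[mu]_y theta Phi (a y / x k)))%E; last first.
    by rewrite !muleA -!EFinM mulrAC.
  apply: lee_wpmul2l; first by rewrite lee_fin mulr_ge0 ?powR_ge0.
  apply: le_trans h; apply: le_measure; rewrite ?inE//.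
    by apply: bigcup_measurable => n [Fn _]; exact: mE.
  by move=> y [n Gn /(ET _ Gn.1)[By _]]; exists n.
rewrite nneseriesZl; last by move=> k _; rewrite mule_ge0 ?lee_fin ?powR_ge0 ?integral_ge0.
rewrite [(_ * Ct)%:E]EFinM -muleA.
apply: lee_wpmul2l; first by rewrite lee_fin mulr_ge0 ?powR_ge0 ?(le_trans ler01 Cw1).
rewrite (eq_eseriesr (g := fun k => (\int[mu]_y ((x k `^ s)%:E * theta Phi (a y / x k)))%E)); last first.
  by move=> k _; rewrite ge0_integralZl_EFin// powR_ge0.
have mzt k : measurable_fun [set: X] (fun y => (x k `^ s)%:E * theta Phi (a y / x k))%E.
  exact: measurable_funeM.
have zt0 k y : (0 <= (x k `^ s)%:E * theta Phi (a y / x k))%E.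
  by rewrite mule_ge0 ?lee_fin ?powR_ge0.
rewrite -integral_nneseries//.
have mas : measurable_fun [set: X] (fun y => (a y `^ s)%:E).
  by apply/measurable_EFinP; exact: (measurableT_comp (measurable_powR s) ma).
rewrite /I -ge0_integralZl_EFin//; last by move=> y _; rewrite lee_fin powR_ge0.
apply: le_lower_integral => y _; first exact: nneseries_ge0.
by rewrite -EFinM; exact: ht.
Qed.

End SparseOrlicz.

(** * Averages over balls and the stopping construction *)

Section DisjointCountable.
Context {d : measure_display} {X : measurableType d} {R : realType}.
Variable mu : {measure set X -> \bar R}.

(** Only finitely many of the sets can have measure at least [1 / k]. *)
Lemma countable_disjoint_pos (I : choiceType) (D : set I) (B : I -> set X) (T : set X) :
  measurable T -> (mu T < +oo)%E -> (forall i, D i -> measurable (B i)) ->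
  (forall i, D i -> B i `<=` T) -> trivIset D B -> (forall i, D i -> (0 < mu (B i))%E) ->
  countable D.
Proof.
move=> mT fT mB BT tB B0.
pose M := fine (mu T).
have ME : mu T = M%:E by rewrite /M fineK// ge0_fin_numE.
pose Dk k := [set i | D i /\ ((k.+1%:R^-1)%:E <= mu (B i))%E].
have DE : D = \bigcup_k Dk k.
  apply/seteqP; split=> [i Di|i [k _ []]//].
  have := B0 i Di; case mi : (mu (B i)) => [r||]//; last first.
    by move=> _; exists 0%N => //; split => //; rewrite mi leey.
  rewrite lte_fin => r0; exists (Num.truncn r^-1) => //; split => //.
  rewrite mi lee_fin -[leRHS]invrK lef_pV2 ?posrE ?invr_gt0// ltW//.
  exact: truncnS_gt.
rewrite DE; apply: bigcup_countable => // k _; apply: finite_set_countable.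
apply: contrapT => inf.
have [G GD cG] := infinite_set_fset (k.+1 * (Num.truncn M).+1) inf.
suff : (#|` G| < k.+1 * (Num.truncn M).+1)%N by rewrite ltnNge cG.
have tG : trivIset [set` G] B.
  by move=> i l /GD[Di _] /GD[Dl _]; exact: tB.
have : (mu (\bigcup_(i in [set` G]) B i) <= mu T)%E.
  apply: le_measure; [apply: mem_set|exact: mem_set|].
    by apply: fin_bigcup_measurable; [exact: finite_fset|move=> i /GD[Di _]; exact: mB].
  by move=> x [i /GD[Di _]]; exact: BT.
rewrite bigcup_fset measure_fbigsetU//; last by move=> i /GD[Di _]; exact: mB.
have : (\sum_(i <- G) (k.+1%:R^-1)%:E <= \sum_(i <- G) mu (B i))%E.
  by rewrite big_seq [leRHS]big_seq; apply: lee_sum => i /GD[].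
move=> h1 h2; have := le_trans h1 h2.
rewrite sumEFin ME lee_fin big_const_seq count_predT iter_addr_0 => h.
rewrite -(ltr_nat R) natrM -ltr_pdivrMl// mulr_natr in h *.
by rewrite (le_lt_trans h)// truncnS_gt.
Qed.
End DisjointCountable.

Section Averages.
Context {d : measure_display} {X : measurableType d} {R : realType}.
Variables (rho : X -> X -> R) (mu : {measure set X -> \bar R}).
Hypothesis hX : homogeneous_type rho mu.

Definition bounded_nonneg (f : X -> R) : Prop :=
  [/\ measurable_fun [set: X] f, (forall x, 0 <= f x) & exists N, forall x, f x <= N].

(** Averages are real numbers; this is harmless because they are only taken of
    bounded functions over balls. *)
Definition ballint (f : X -> R) x r : R := fine (\int[mu]_(y in qball rho x r) (f y)%:E)%E.

Definition ballavg (f : X -> R) x r : R := ballint f x r / vol rho mu x r.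

Lemma bounded_ballint f x r : bounded_nonneg f ->
  (\int[mu]_(y in qball rho x r) (f y)%:E = (ballint f x r)%:E)%E.
Proof.
move=> [mf f0 [N fN]]; rewrite /ballint fineK// ge0_fin_numE; last first.
  by apply: integral_ge0 => y _; rewrite lee_fin.
have mB := measurable_qball hX x r.
apply: (@le_lt_trans _ _ (\int[mu]_(y in qball rho x r) N%:E)%E).
  by apply: le_lower_integral => y _; rewrite lee_fin.
by rewrite integral_cst// (mu_qballE hX) -EFinM ltry.
Qed.

Lemma ballint_ge0 f x r : bounded_nonneg f -> 0 <= ballint f x r.
Proof. by move=> [_ f0 _]; rewrite fine_ge0// integral_ge0// => y _; rewrite lee_fin. Qed.

Lemma ballint_le f x y r s : bounded_nonneg f ->
  qball rho x r `<=` qball rho y s -> ballint f x r <= ballint f y s.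
Proof.
move=> bf sub; rewrite -lee_fin -!bounded_ballint//; have [mf f0 _] := bf.
apply: ge0_subset_integral => //; try exact: (measurable_qball hX).
  by apply: measurable_funTS; exact/measurable_EFinP.
by move=> z _; rewrite lee_fin.
Qed.

Lemma ballavg_ge0 f x r : 0 < r -> bounded_nonneg f -> 0 <= ballavg f x r.
Proof. by move=> r0 bf; rewrite divr_ge0 ?ballint_ge0// ltW// (vol_gt0 hX). Qed.

Lemma ballavg_le f x y r s M : bounded_nonneg f -> 0 < r -> 0 < s ->
  qball rho x r `<=` qball rho y s -> vol rho mu y s <= M * vol rho mu x r ->
  ballavg f x r <= M * ballavg f y s.
Proof.
move=> bf r0 s0 sub hv; rewrite /ballavg.
have vx := vol_gt0 hX x r0; have vy := vol_gt0 hX y s0.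
rewrite ler_pdivrMr// [leRHS](_ : _ = ballint f y s / vol rho mu y s * (M * vol rho mu x r)); last by ring.
rewrite (le_trans (ballint_le bf sub))// mulrAC ler_pdivlMr//.
by rewrite ler_wpM2l// ballint_ge0.
Qed.

Variables (m : nat).

Definition prodavg (f : 'I_m -> X -> R) x r : R := \prod_(i < m) ballavg (f i) x r.

Lemma prodavg_ge0 f x r : 0 < r -> (forall i, bounded_nonneg (f i)) -> 0 <= prodavg f x r.
Proof. by move=> r0 bf; apply: prodr_ge0 => i _; exact: ballavg_ge0. Qed.

Lemma prodavg_le f x y r s M : (forall i, bounded_nonneg (f i)) -> 0 < r -> 0 < s ->
  qball rho x r `<=` qball rho y s -> vol rho mu y s <= M * vol rho mu x r ->
  prodavg f x r <= M ^+ m * prodavg f y s.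
Proof.
move=> bf r0 s0 sub hv; rewrite /prodavg -[m in M ^+ m]card_ord -prodr_const -big_split/=.
by apply: ler_prod => i _; rewrite ballavg_ge0//= ballavg_le.
Qed.

(** If a product of averages grows by the factor [alpha ^ m], one of the
    averages grows by the factor [alpha]. *)
Lemma prodavg_pigeonhole f x y r s alpha : (forall i, bounded_nonneg (f i)) ->
  0 < r -> 0 < s -> 0 <= alpha ->
  alpha ^+ m * prodavg f y s < prodavg f x r ->
  exists i, alpha * ballavg (f i) y s < ballavg (f i) x r.
Proof.
move=> bf r0 s0 a0; apply: contraPP => /forallNP h.
apply/negP; rewrite -leNgt /prodavg -[m in alpha ^+ m]card_ord -prodr_const -big_split/=.
apply: ler_prod => i _; rewrite ballavg_ge0//= leNgt; exact/negP/h.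
Qed.

End Averages.

(** Bernoulli's inequality. *)
Lemma expr_unbounded {R : realType} (b M : R) : 1 < b -> exists n, M < b ^+ n.
Proof.
move=> b1; have b10 : 0 < b - 1 by rewrite subr_gt0.
exists (Num.truncn (M / (b - 1))).+1; set n := _.+1.
have : M / (b - 1) < n%:R by exact: truncnS_gt.
rewrite ltr_pdivrMr// => /lt_le_trans; apply.
elim: n => [|n IH]; first by rewrite mul0r exprn_ge0// (le_trans ler01)// ltW.
rewrite exprS -natr1 mulrDl mul1r; apply: (le_trans (lerD IH (lexx _))).
have h : 1 <= b ^+ n by rewrite exprn_ege1// ltW.
have : 0 <= (b - 1) * (b ^+ n - 1) by rewrite mulr_ge0 ?subr_ge0// ltW.
by rewrite mulrBl !mulrBr; lra.
Qed.

Section Stopping.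
Context {d : measure_display} {X : measurableType d} {R : realType}.
Variables (rho : X -> X -> R) (mu : {measure set X -> \bar R}).
Hypothesis hX : homogeneous_type rho mu.
Variable kappa : R.
Hypothesis kappa1 : 1 <= kappa.
Hypothesis tri : forall x y z, rho x y <= kappa * (rho x z + rho z y).
Variable b : R.
Hypothesis b1 : 1 < b.
Variable m : nat.
Hypothesis m0 : (0 < m)%N.

Definition grid (R0 : R) (j : nat) : R := R0 / b ^+ j.

Lemma grid_gt0 R0 j : 0 < R0 -> 0 < grid R0 j.
Proof. by move=> h; rewrite divr_gt0// exprn_gt0// (lt_trans ltr01). Qed.

Lemma grid_le R0 j k : 0 < R0 -> (j <= k)%N -> grid R0 k <= grid R0 j.
Proof.
move=> h jk; have b0 : 0 < b by rewrite (lt_trans ltr01).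
by rewrite ler_pM2l// lef_pV2 ?posrE ?exprn_gt0// ler_weXn2l// ltW.
Qed.

Lemma gridD R0 j k : grid R0 j = b ^+ k * grid R0 (j + k).
Proof.
have b0 : b != 0 by rewrite gt_eqF// (lt_trans ltr01).
by rewrite /grid exprD; field; rewrite !expf_neq0.
Qed.

Lemma grid0 R0 : grid R0 0 = R0.
Proof. by rewrite /grid expr0 divr1. Qed.

(** The dilation that swallows a meeting ball of no larger radius, and the one
    that swallows the ball on which all the averages live. *)
Definition inner_dil : R := kappa * (1 + 2 * kappa).
Definition outer_dil : R := kappa * (1 + kappa * (1 + inner_dil)).

Let k0 : 0 < kappa. Proof. exact: lt_le_trans kappa1. Qed.

Lemma inner_dil_ge3 : 3 <= inner_dil.
Proof. by rewrite /inner_dil -[leLHS]mul1r ler_pM//; have := kappa1; lra. Qed.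

Lemma inner_le_outer : inner_dil <= outer_dil.
Proof.
have E3 := inner_dil_ge3; rewrite /outer_dil.
have h : 1 + inner_dil <= kappa * (1 + inner_dil) by rewrite ler_peMl//; lra.
have h2 : 1 + kappa * (1 + inner_dil) <= outer_dil by rewrite ler_peMl//; lra.
by rewrite /outer_dil in h2; lra.
Qed.

Let E := inner_dil.
Let E2 := outer_dil.

(** The levels are [lamb l = lamb 0 * A ^+ l], with [lamb 0] the product of averages
    over a ball containing the whole configuration. At a point [x] and a level [l], the
    stopping index is the first scale at which the product of averages around [x]
    exceeds [lamb l]; at level 0 it is the top scale. The stopped balls of one level
    cover the places where the product is that large, and Vitali's lemma selects
    disjoint ones among them.

    The family is sparse. If a ball of a higher level meets a given one, it is not
    larger, and on it some [f i] has an average at least [alpha] times its average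
    over the dilated given ball, by pigeonhole over the m factors. The weak-type bound
    then leaves at most half of the given ball covered by higher levels, and [Es n] is
    the remaining part. *)
Theorem stopping_family : exists2 C0 : R, 1 <= C0 &
  forall (f : 'I_m -> X -> R) (o : X) (R0 : R), 0 < R0 ->
  (forall i, bounded_nonneg (f i)) ->
  exists (F : set nat) (c : nat -> X) (j : nat -> nat) (lam : nat -> R)
    (Es : nat -> set X),
  [/\ forall n, F n -> [/\ qball rho o R0 (c n), 0 <= lam n &
        lam n <= C0 * prodavg rho mu f (c n) (E2 * grid R0 (j n))],
    forall n, F n -> measurable (Es n) /\ Es n `<=` qball rho (c n) (grid R0 (j n)),
    trivIset F Es,
    forall n, F n ->
      ((vol rho mu (c n) (E2 * grid R0 (j n)))%:E <= C0%:E * mu (Es n))%E &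
    forall x k, qball rho o R0 x -> exists n, [/\ F n, (j n <= k)%N,
      qball rho x (grid R0 k) `<=` qball rho (c n) (E2 * grid R0 (j n)) &
      prodavg rho mu f x (grid R0 k) <= C0 * lam n]].
Proof.
have E3 : 3 <= E := inner_dil_ge3.
have E1 : 1 <= E by lra.
have E12 : E <= E2 := inner_le_outer.
have E0 : 0 < E by exact: lt_le_trans E1.
have E20 : 0 < E2 by exact: lt_le_trans E12.
have E21 : 1 <= E2 by exact: le_trans E12.
have b0 : 0 < b by rewrite (lt_trans ltr01).
(* s scales of the grid absorb the inner dilation *)
have [s /ltW bs] := expr_unbounded E b1.
have bs1 : 1 <= b ^+ s by exact: le_trans bs.
pose Dm := E2 * b ^+ s.
have Dm0 : 0 <= Dm by rewrite mulr_ge0// ltW// exprn_gt0.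
have [M M1 hM] := vol_engulf hX kappa1 tri Dm0.
have M0 : 0 < M by exact: lt_le_trans M1.
have [Cw Cw1 hw] := weak_type hX kappa1 tri.
(* alpha makes the balls of higher levels cover at most half of a ball: m for the number of
   functions, Cw for the weak-type bound, M for the dilation, 2 for the half *)
pose alpha := 2 * m%:R * Cw * M.
have alpha2 : 2 <= alpha.
  have m1 : 1 <= m%:R :> R by rewrite ler1n.
  rewrite /alpha -!mulrA ler_peMr// mulr_ege1// mulr_ege1//.
have alpha0 : 0 < alpha by exact: lt_le_trans alpha2.
pose A := (M * alpha) ^+ m.
have Ma1 : 1 <= M * alpha by rewrite mulr_ege1// (le_trans _ alpha2)// ler1n.
have A1 : 1 < A.
  rewrite /A exprn_egt1// ?lt0n_neq0//.
  by apply: (@lt_le_trans _ _ alpha); [lra|rewrite ler_peMl// ltW].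
have AE : A = M ^+ m * alpha ^+ m by exact: exprMn.
have MmA : M ^+ m <= A.
  rewrite /A exprMn ler_peMr ?exprn_ge0 ?(ltW M0)// exprn_ege1//.
  by rewrite (le_trans _ alpha2)// ler1n.
have MA2 : 2 * M <= A.
  apply: (@le_trans _ _ (M * alpha)); first by rewrite mulrC ler_wpM2l// ltW.
  by rewrite /A -[X in X <= _]expr1 ler_weXn2l.
exists A; first exact: ltW.
move=> f o R0 R00 bf.
have r0 j : 0 < grid R0 j by exact: grid_gt0.
have Er0 j : 0 < E * grid R0 j by rewrite mulr_gt0.
have E2r0 j : 0 < E2 * grid R0 j by rewrite mulr_gt0.
have rER j : grid R0 j <= E * R0.
  apply: (@le_trans _ _ R0); first by rewrite -[leRHS](grid0 R0) grid_le.
  by rewrite ler_peMl// ltW.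
pose R' := kappa * (1 + E) * R0.
have R'0 : 0 < R' by rewrite !mulr_gt0// addr_gt0.
have R'E2 : R' <= E2 * R0.
  rewrite ler_pM2r// /E2 /outer_dil -/E ler_pM2l//.
  by have := kappa1; nra.
have R0R' : R0 <= R'.
  rewrite ler_peMl ?(ltW R00)// mulr_ege1// lerDl ltW//.
pose G := prodavg rho mu f.
pose B (xj : X * nat) := qball rho xj.1 (grid R0 xj.2).
(* every ball of the construction lies in the ball of radius R' *)
have subT x r : qball rho o R0 x -> r <= E * R0 -> qball rho x r `<=` qball rho o R'.
  rewrite /qball/= => ox rE w /= xw; apply: (le_lt_trans (tri o w x)).
  by rewrite /R' -mulrA ltr_pM2l//; lra.
have Tsub x : qball rho o R0 x -> qball rho o R' `<=` qball rho x (E2 * R0).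
  rewrite /qball/= => ox w /= ow; apply: (le_lt_trans (tri x w o)).
  rewrite (qm_sym (ht_quasi_metric hX)) in ox.
  by rewrite /E2 /outer_dil -/E -mulrA ltr_pM2l// mulrDl mul1r -/R' ltrD.
have oT x : qball rho o R0 x -> qball rho o R' x by apply: qball_mono.
pose lamb l : R := G o R' * A ^+ l.
have G0 x r : 0 < r -> 0 <= G x r by move=> ?; exact: (prodavg_ge0 hX).
have lamb0 l : 0 <= lamb l by rewrite mulr_ge0 ?G0// exprn_ge0// ltW// (lt_trans ltr01).
have lambS l : lamb l.+1 = A * lamb l by rewrite /lamb exprS; ring.
have lamb_le l l' : (l <= l')%N -> lamb l <= lamb l'.
  by move=> ll; rewrite ler_wpM2l ?G0// ler_weXn2l// ltW.
(* large balls are comparable to the top ball *)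
have top x j r : qball rho o R0 x -> (j <= s)%N -> grid R0 j <= r -> r <= E * R0 ->
    G x r <= M ^+ m * lamb 0%N.
  move=> ox js jr rE; have rr : 0 < r by exact: lt_le_trans jr.
  rewrite /lamb expr0 mulr1; apply: (prodavg_le hX) => //; first exact: subT.
  apply: (@hM _ _ _ _ x) => //; [|exact: (qball_center hX)|exact: oT].
  rewrite (le_trans R'E2)// /Dm -mulrA ler_pM2l//.
  have -> : R0 = b ^+ j * grid R0 j by rewrite -[in LHS](grid0 R0) (gridD R0 0 j).
  by rewrite ler_pM ?exprn_ge0 ?(ltW b0) ?(ltW (r0 _))// ler_weXn2l// ltW.
pose stop l (xj : X * nat) := if l is 0%N then xj.2 = 0%N else
  lamb l < G xj.1 (grid R0 xj.2) /\ forall i, (i < xj.2)%N -> G xj.1 (grid R0 i) <= lamb l.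
pose Sl l := [set xj | qball rho o R0 xj.1 /\ stop l xj].
have Bne xj : B xj !=set0 by exists xj.1; exact: (qball_center hX).
have /choice[D hD] : forall l, exists D : set (X * nat), [/\ D `<=` Sl l, trivIset D B &
    forall i, Sl l i -> exists k, [/\ D k, (k.2 <= i.2)%N & B i `&` B k !=set0]].
  by move=> l; apply: vitali_selection => i _; exact: Bne.
(* averages over the selected balls are controlled by their level *)
have P2 l x j : qball rho o R0 x -> stop l (x, j) -> G x (E * grid R0 j) <= M ^+ m * lamb l.
  move=> ox st; have [js|js] := ltnP j s.
    apply: (@le_trans _ _ (M ^+ m * lamb 0%N)); last first.
      by rewrite ler_wpM2l ?exprn_ge0 ?(ltW M0)// lamb_le.
    apply: (top x j) => //; first exact: ltnW.
      by rewrite ler_peMl// ltW.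
    by rewrite ler_pM2l// -[leRHS](grid0 R0) grid_le.
  case: l st => [/= j00|l [_ st]].
    by apply: (top x j) => //; rewrite j00 ?grid0// ler_peMl// ltW.
  have s0 : (0 < s)%N.
    by rewrite lt0n; apply/eqP => s00; move: bs; rewrite s00 expr0; lra.
  have jsj : (j - s < j)%N by rewrite ltn_subrL s0 (leq_trans s0).
  have hr : grid R0 (j - s) = b ^+ s * grid R0 j by rewrite (gridD _ (j - s) s) subnK.
  apply: (@le_trans _ _ (M ^+ m * G x (grid R0 (j - s)))); last first.
    by rewrite ler_wpM2l ?exprn_ge0 ?(ltW M0)//; exact: st.
  apply: (prodavg_le hX) => //.
    by apply: qball_mono; rewrite hr ler_pM2r.
  apply: (@hM _ _ _ _ x) => //; try exact: (qball_center hX).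
  rewrite hr /Dm [leRHS](_ : _ = E2 * E * (b ^+ s * grid R0 j)); last by ring.
  have h1 : 0 <= b ^+ s * grid R0 j by rewrite mulr_ge0 ?exprn_ge0 ?(ltW b0) ?(ltW (r0 _)).
  have h2 : 1 <= E2 * E by rewrite mulr_ege1.
  by rewrite ler_peMl.
(* a selected ball of a higher level that meets one of a lower level is not larger *)
have finer l l' x x' j j' z : qball rho o R0 x -> qball rho o R0 x' ->
    stop l (x, j) -> stop l' (x', j') -> (l < l')%N ->
    qball rho x (grid R0 j) z -> qball rho x' (grid R0 j') z -> (j <= j')%N.
  move=> ox ox' st; case: l' => // l' [/= stl' _] ll' xz x'z; rewrite leqNgt; apply/negP => jj'.
  have big : M ^+ m * lamb l < G x' (grid R0 j').
    apply: le_lt_trans stl'; apply: (@le_trans _ _ (lamb l.+1)); last exact: lamb_le.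
    by rewrite lambS ler_wpM2r.
  have xz' : qball rho x (grid R0 j') z by apply: qball_mono xz; rewrite grid_le// ltnW.
  have [js|js] := leqP s j'; last first.
    suff : G x' (grid R0 j') <= M ^+ m * lamb l by rewrite leNgt big.
    apply: (@le_trans _ _ (M ^+ m * lamb 0%N)); last first.
      by rewrite ler_wpM2l ?exprn_ge0 ?(ltW M0)// lamb_le.
    apply: (top x' j') => //; first exact: ltnW.
  case: l st ll' big => [/= j00|l [_ st]] ll' big; first by rewrite j00 in jj'.
  have hr : grid R0 (j' - s) = b ^+ s * grid R0 j' by rewrite (gridD _ (j' - s) s) subnK.
  have := st (j' - s)%N (leq_ltn_trans (leq_subr _ _) jj').
  apply/negP; rewrite -ltNge -(ltr_pM2l (exprn_gt0 m M0)).
  apply: (lt_le_trans big); apply: (prodavg_le hX) => //.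
    have := engulf hX kappa1 tri ler01 _ xz' x'z; rewrite mul1r mulr1 lexx.
    move=> /(_ isT) h; apply: (subset_trans h); apply: qball_mono.
    by rewrite hr ler_pM2r.
  apply: (@hM _ _ _ _ z) => //.
    rewrite hr /Dm -mulrA ler_peMl// mulr_ge0 ?exprn_ge0 ?(ltW b0) ?(ltW (r0 _))//.
  by apply: qball_mono xz'; rewrite grid_le// leq_subr.
pose DD := [set t : nat * (X * nat) | D t.1 t.2].
have DS t : DD t -> Sl t.1 t.2 by move=> Dt; have [+ _ _] := hD t.1; exact.
have DT t : DD t -> qball rho o R0 t.2.1 by move=> /DS[].
have Dst t : DD t -> stop t.1 (t.2.1, t.2.2).
  by move=> /DS[_]; case: t => l [x j].
have BT t : DD t -> B t.2 `<=` qball rho o R'.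
  move=> Dt; apply: subT; first exact: DT.
  exact: rER.
have Ddisj t t' : DD t -> DD t' -> t.1 = t'.1 -> B t.2 `&` B t'.2 !=set0 -> t = t'.
  case: t => l p; case: t' => l' p' /= Dt Dt' ll BB; rewrite -ll in Dt' *.
  by have [_ tD _] := hD l; rewrite (tD p p').
have mB t : measurable (B t) by exact: (measurable_qball hX).
have cD : countable DD.
  rewrite (_ : DD = \bigcup_l [set t | DD t /\ t.1 = l]); last first.
    by apply/seteqP; split=> [t Dt|t [l _ []]//]; exists t.1.
  apply: bigcup_countable => // l _.
  apply: (@countable_disjoint_pos _ _ _ mu _ _ (fun t => B t.2) (qball rho o R')) => //.
  - exact: (measurable_qball hX).
  - by rewrite (mu_qballE hX) ltry.
  - by move=> t [+ _]; exact: BT.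
  - by move=> t t' [Dt tl] [Dt' tl'] BB; apply: Ddisj => //; rewrite tl tl'.
  - by move=> t _; rewrite /B (mu_qballE hX) lte_fin (vol_gt0 hX).
have /countable_injP[ph injph] := cD.
pose F := ph @` DD.
have /choice[g hg] : forall n, exists t, F n -> DD t /\ ph t = n.
  move=> n; have [[t Dt tn]|nF] := pselect (F n); first by exists t.
  by exists (0%N, (o, 0%N)).
have gD n : F n -> DD (g n) by move=> /hg[].
have gn n : F n -> ph (g n) = n by move=> /hg[].
pose c n := (g n).2.1.
pose j n := (g n).2.2.
pose lv n := (g n).1.
pose U n := \bigcup_(n' in [set n' | F n' /\ (lv n < lv n')%N]) B (g n').2.
pose Es n := B (g n).2 `\` U n.
have mU n : measurable (U n) by apply: bigcup_measurable => n' _.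
have mEs n : measurable (Es n) by exact: measurableD.
exists F, c, j, (fun n => lamb (lv n)), Es; split.
- move=> n Fn; have Dn := gD n Fn; split => //; first exact: DT.
  apply: (@le_trans _ _ (M ^+ m * G (c n) (E2 * grid R0 (j n)))); last first.
    by rewrite ler_wpM2r// G0.
  have := Dst _ Dn; rewrite -/(lv n) -/(c n) -/(j n).
  case: (lv n) => [/= j00|l [/= /ltW st _]].
    rewrite j00 grid0 /lamb expr0 mulr1; apply: (prodavg_le hX) => //; first by rewrite mulr_gt0.
      exact/Tsub/DT.
    apply: (@hM _ _ _ _ (c n)) => //; last by apply: (qball_center hX); rewrite mulr_gt0.
      apply: (@le_trans _ _ (E2 * R')); first by rewrite ler_pM2l.
      by rewrite ler_pM2r// /Dm ler_peMr// ltW.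
    exact/oT/DT.
  apply: (le_trans st); apply: (prodavg_le hX) => //.
    by apply: qball_mono; rewrite ler_peMl// ltW.
  apply: (@hM _ _ _ _ (c n)) => //; try exact: (qball_center hX).
  by rewrite ler_pM2r// /Dm ler_peMr// ltW.
- by move=> n Fn; split => // y [].
- move=> n n' Fn Fn' [y [[By Uy] [By' Uy']]].
  have [ll|ll|ll] := ltngtP (lv n) (lv n').
  + by exfalso; apply: Uy; exists n'.
  + by exfalso; apply: Uy'; exists n.
  + rewrite -(gn n Fn) -(gn n' Fn'); congr ph; apply: Ddisj => //; try exact: gD.
    by exists y.
- move=> n Fn.
  have on : qball rho o R0 (c n) by exact/DT/gD.
  have mBn : measurable (B (g n).2) by [].
  (* the part of the ball covered by higher levels has at most half its mass *)
  have half : (mu (B (g n).2 `&` U n) <= (vol rho mu (c n) (grid R0 (j n)) / 2)%:E)%E.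
    pose V := vol rho mu (c n) (E * grid R0 (j n)).
    have V0 : 0 < V by exact: (vol_gt0 hX).
    pose av i := ballavg rho mu (f i) (c n) (E * grid R0 (j n)).
    have av0 i : 0 <= av i by exact: (ballavg_ge0 hX).
    have aav i : 0 <= (alpha * av i)^-1 by rewrite invr_ge0 mulr_ge0// ltW.
    pose Q := qball rho (c n) (E * grid R0 (j n)).
    have mQ : measurable Q by exact: (measurable_qball hX).
    have mf i : measurable_fun [set: X] (fun y => (f i y)%:E).
      by apply/measurable_EFinP; have [] := bf i.
    have f0 i y : (0 <= (f i y)%:E)%E by rewrite lee_fin; have [_ + _] := bf i.
    pose hi i y := ((alpha * av i)^-1%:E * ((fun y => (f i y)%:E) \_ Q) y)%E.
    have hi0 i y : (0 <= hi i y)%E.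
      by rewrite mule_ge0// ?lee_fin// /patch; case: ifP.
    have mhi i : measurable_fun [set: X] (hi i).
      apply: measurable_funeM; apply/(measurable_restrictT _ mQ).
      exact: measurable_funTS.
    (* the function of the weak-type bound: its average is at least 1 on each ball of a higher level *)
    pose h y := (\sum_(i < m) hi i y)%E.
    have h0 y : (0 <= h y)%E by exact: sume_ge0.
    have mh : measurable_fun [set: X] h by exact: emeasurable_sum.
    pose N := [set n' | [/\ F n', (lv n < lv n')%N & B (g n).2 `&` B (g n').2 !=set0]].
    have hN n' : N n' -> (mu (qball rho (c n') (grid R0 (j n'))) <=
        \int[mu]_(y in qball rho (c n') (grid R0 (j n'))) h y)%E.
      move=> [Fn' ll [z [Bz Bz']]].
      have jj : (j n <= j n')%N.
        exact: (@finer _ _ _ _ _ _ z (DT _ (gD _ Fn)) (DT _ (gD _ Fn'))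
          (Dst _ (gD _ Fn)) (Dst _ (gD _ Fn')) ll).
      have subQ : qball rho (c n') (grid R0 (j n')) `<=` Q.
        have := engulf hX kappa1 tri ler01 _ Bz Bz'; rewrite mul1r mulr1 /=.
        by move=> /(_ (grid_le R00 jj)).
      have : lamb (lv n') < G (c n') (grid R0 (j n')).
        have := Dst _ (gD _ Fn'); rewrite -/(lv n') -/(c n') -/(j n').
        by case: (lv n') ll => //= l _ [].
      move=> Gn'.
      have : alpha ^+ m * G (c n) (E * grid R0 (j n)) < G (c n') (grid R0 (j n')).
        apply: le_lt_trans Gn'; apply: (@le_trans _ _ (lamb (lv n).+1)); last exact: lamb_le.
        rewrite lambS AE -[leRHS]mulrA [leRHS]mulrCA.
        rewrite ler_wpM2l ?exprn_ge0 ?(ltW alpha0)//.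
        by apply: P2; [exact: on|exact: Dst (gD _ Fn)].
      move=> /(prodavg_pigeonhole hX bf (r0 _) (Er0 _) (ltW alpha0))[i hi'].
      rewrite -/(av i) in hi'.
      have vn' := vol_gt0 hX (c n') (r0 (j n')).
      have avi : 0 < av i.
        rewrite lt_neqAle av0 andbT eq_sym; apply/negP => /eqP av00.
        have := ballint_le hX (bf i) subQ.
        have -> : ballint rho mu (f i) (c n) (E * grid R0 (j n)) = av i * V.
          by rewrite /av /ballavg divfK// gt_eqF.
        rewrite av00 mul0r => b00; move: hi'; rewrite av00 mulr0 /ballavg.
        by rewrite ltNge pmulr_lle0 ?invr_gt0// b00.
      apply: (@le_trans _ _ (\int[mu]_(y in qball rho (c n') (grid R0 (j n'))) hi i y)%E); last first.
        apply: le_lower_integral => // y _.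
        by rewrite /h (bigD1 i)//= leeDl// sume_ge0.
      rewrite /hi ge0_integralZl_EFin//; first last.
      + by apply: measurable_funTS; apply/(measurable_restrictT _ mQ); exact: measurable_funTS.
      + by move=> y _; rewrite /patch; case: ifP.
      + exact: (measurable_qball hX).
      rewrite (eq_integral (fun y => (f i y)%:E)); last first.
        by move=> y /set_mem/subQ Qy; rewrite patchT//; exact: mem_set.
      rewrite (bounded_ballint hX)// (mu_qballE hX) -EFinM lee_fin.
      have h2 : alpha * av i * vol rho mu (c n') (grid R0 (j n')) <=
          ballint rho mu (f i) (c n') (grid R0 (j n')).
        by rewrite -ler_pdivlMr//; exact: ltW.
      have aa : 0 < alpha * av i by rewrite mulr_gt0.
      by rewrite ler_pdivlMl.
    have := hw (grid R0) c j N h r0 (fun j k => @grid_le R0 j k R00) mh h0 hN.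
    move=> /le_trans h1.
    apply: (@le_trans _ _ (mu (\bigcup_(n' in N) B (g n').2))).
      apply: le_measure; [apply: mem_set|apply: mem_set|].
      - exact: measurableI.
      - exact: bigcup_measurable.
      - by move=> y [By [n' [Fn' ll] By']]; exists n' => //; split => //; exists y.
    apply: h1.
    have inth i : (\int[mu]_y hi i y <= (V / alpha)%:E)%E.
      rewrite /hi ge0_integralZl_EFin//; first last.
      + by apply/(measurable_restrictT _ mQ); exact: measurable_funTS.
      + by move=> y _; rewrite /patch; case: ifP.
      rewrite -integral_mkcond (bounded_ballint hX)// -EFinM lee_fin.
      have -> : ballint rho mu (f i) (c n) (E * grid R0 (j n)) = av i * V.
        by rewrite /av /ballavg divfK// gt_eqF.
      have [->|avn] := eqVneq (av i) 0; first by rewrite mul0r mulr0 divr_ge0// ltW.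
      by rewrite le_eqVlt; apply/orP; left; apply/eqP; field; rewrite avn gt_eqF.
    rewrite /h ge0_integral_sum//.
    apply: (@le_trans _ _ (Cw%:E * \sum_(i < m) (V / alpha)%:E)%E).
      apply: lee_wpmul2l; first by rewrite lee_fin (le_trans _ Cw1).
      exact: lee_sum.
    rewrite sumEFin sumr_const card_ord -EFinM lee_fin -[X in Cw * X]mulr_natr.
    have VM : V <= M * vol rho mu (c n) (grid R0 (j n)).
      apply: (@hM _ _ _ _ (c n)) => //; try exact: (qball_center hX).
      by rewrite ler_pM2r// /Dm (le_trans E12)// ler_peMr// ltW.
    have Cw0 : 0 < Cw by exact: lt_le_trans Cw1.
    have mR0 : 0 < m%:R :> R by rewrite ltr0n.
    have -> : Cw * (V / alpha * m%:R) = V / M / 2.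
      by rewrite /alpha; field; rewrite !gt_eqF.
    by rewrite ler_pM2r ?invr_gt0// ler_pdivrMr// mulrC.
  have vE : ((vol rho mu (c n) (grid R0 (j n)) / 2)%:E <= mu (Es n))%E.
    have BE : mu (B (g n).2) = (vol rho mu (c n) (grid R0 (j n)))%:E := mu_qballE hX _ _.
    have DI : (mu (B (g n).2) = mu (Es n) + mu (B (g n).2 `&` U n))%E := measureDI mu mBn (mU n).
    have EB : (mu (Es n) <= mu (B (g n).2))%E.
      by apply: le_measure; [exact: mem_set|exact: mem_set|move=> y []].
    rewrite BE in EB DI.
    have Efin : mu (Es n) \is a fin_num by rewrite ge0_fin_numE// (le_lt_trans EB)// ltry.
    have Ifin : mu (B (g n).2 `&` U n) \is a fin_num.
      by rewrite ge0_fin_numE// (le_lt_trans half)// ltry.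
    move: half DI; rewrite -(fineK Efin) -(fineK Ifin) -EFinD !lee_fin => hh [] eq.
    by move: hh eq; lra.
  apply: le_trans (lee_wpmul2l _ vE); last by rewrite lee_fin ltW// (lt_trans ltr01).
  rewrite -EFinM lee_fin.
  apply: (@le_trans _ _ (M * vol rho mu (c n) (grid R0 (j n)))).
    apply: (@hM _ _ _ _ (c n)) => //; try exact: (qball_center hX).
    by rewrite ler_pM2r// /Dm ler_peMr// ltW.
  by have := ler_wpM2r (ltW (vol_gt0 hX (c n) (r0 (j n)))) MA2; lra.
move=> x k ox.
have [l [J [stl Jk Gl]]] : exists l J, [/\ stop l (x, J), (J <= k)%N & G x (grid R0 k) <= A * lamb l].
  have [Gle|Ggt] := leP (G x (grid R0 k)) (lamb 0%N).
    exists 0%N, 0%N; split => //; apply: (le_trans Gle).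
    by rewrite ler_peMl// ltW.
  have GT0 : 0 < G o R'.
    rewrite lt_neqAle G0// andbT eq_sym; apply/negP => /eqP GT.
    pose Q := vol rho mu o R' / vol rho mu x (grid R0 k).
    have : G x (grid R0 k) <= Q ^+ m * G o R'.
      apply: (prodavg_le hX) => //; first exact: subT.
      by rewrite /Q divfK// gt_eqF// (vol_gt0 hX).
    by rewrite GT mulr0 leNgt (le_lt_trans _ Ggt).
  (* the level is the power of A that brackets the product of averages *)
  have [l [ll lmin]] : exists l, G x (grid R0 k) <= lamb l.+1 /\
      forall i, (i < l)%N -> ~ (G x (grid R0 k) <= lamb i.+1).
    apply: ex_least_nat.
    pose w := G x (grid R0 k) / G o R'.
    have [n wn] := expr_unbounded w A1; exists n.
    rewrite /lamb mulrC -ler_pdivrMr// -/w (le_trans (ltW wn))//.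
    by rewrite ler_weXn2l// ltW.
  have lG : lamb l < G x (grid R0 k).
    case: l ll lmin => [//|l] ll lmin; rewrite ltNge; apply/negP; exact: lmin.
  case: l ll lmin lG => [|l] ll lmin lG.
    by exists 0%N, 0%N; split => //; rewrite -lambS.
  have [J [JG Jmin]] : exists J, lamb l.+1 < G x (grid R0 J) /\
      forall i, (i < J)%N -> ~ (lamb l.+1 < G x (grid R0 i)).
    by apply: ex_least_nat; exists k.
  exists l.+1, J; split => //; last by rewrite -lambS.
    by split => //= i iJ; rewrite leNgt; apply/negP; exact: Jmin.
  by rewrite leqNgt; apply/negP => kJ; exact: (Jmin k).
have [D1 _ D3] := hD l.
have [[y i] [Dy iJ [z [Bz Byz]]]] := D3 (x, J) (conj ox stl).
have Ft : F (ph (l, (y, i))) by exists (l, (y, i)).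
have gt : g (ph (l, (y, i))) = (l, (y, i)).
  by apply: injph; [exact/mem_set/gD|exact: mem_set|exact: gn].
exists (ph (l, (y, i))); rewrite /j /c /lv gt; split => //=.
- exact: leq_trans Jk.
- apply: (subset_trans (qball_mono (grid_le R00 Jk))).
  have := engulf hX kappa1 tri ler01 _ Byz Bz; rewrite mul1r mulr1 /=.
  move=> /(_ (grid_le R00 iJ)) h; apply: (subset_trans h); apply: qball_mono.
  by rewrite ler_pM2r.
Qed.

End Stopping.

(** * Domination by a sparse sum *)

Lemma geometric_tail {R : realType} (q : R) (j : nat) : 0 <= q -> q < 1 ->
  (\sum_(k <oo) (if (j <= k)%N then q ^+ (k - j) else 0)%:E <= ((1 - q)^-1)%:E)%E.
Proof.
move=> q0 q1; have d0 : 0 < 1 - q by rewrite subr_gt0.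
apply: nneseries_le_bound => [n|n]; first by case: ifP => // _; rewrite lee_fin exprn_ge0.
rewrite sumEFin lee_fin -[leRHS]mul1r ler_pdivlMr//.
have -> : (\sum_(0 <= k < n) (if (j <= k)%N then q ^+ (k - j) else 0)) * (1 - q)
    = 1 - q ^+ (n - j).
  elim: n => [|n IH]; first by rewrite big_nil mul0r sub0n expr0 subrr.
  rewrite big_nat_recr//= mulrDl IH; case: ifPn => [jn|].
    by rewrite subSn// exprS; ring.
  rewrite -ltnNge => nj; rewrite mul0r addr0.
  by have /eqP-> : (n - j == 0)%N; [rewrite subn_eq0 ltnW|have /eqP-> : (n.+1 - j == 0)%N; [rewrite subn_eq0|]].
by rewrite gerBl exprn_ge0.
Qed.

Section SparseDomination.
Context {d : measure_display} {X : measurableType d} {R : realType}.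
Variables (rho : X -> X -> R) (mu : {measure set X -> \bar R}).
Hypothesis hX : homogeneous_type rho mu.
Variables (kappa b : R).
Hypotheses (kappa1 : 1 <= kappa) (b1 : 1 < b).
Variables (m : nat) (eps CL : R).
Hypothesis (eps0 : 0 < eps) (CL0 : 0 <= CL).

Let E2 := outer_dil kappa.

(** Every scale [k] at [x] is charged to a stopping ball that contains the ball of
    scale [k] and bounds its product of averages. The decay of [Lam] makes the sum
    over the scales charged to the same stopping ball geometric, with ratio
    [b^-1 `^ eps]. *)
Lemma sparse_domination (C0 : R) : 0 <= C0 -> exists2 C : R, 0 <= C &
  forall (f : 'I_m -> X -> R) (R0 : R) (Lam : X -> R -> R) (F : set nat)
    (c : nat -> X) (j : nat -> nat) (lam : nat -> R) (x : X),
  0 < R0 -> (forall i, bounded_nonneg (f i)) ->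
  (forall y r, 0 < r -> 0 <= Lam y r) ->
  (forall y y' r r', 0 < r' -> r' <= r -> r <= E2 * R0 ->
     qball rho y' r' `<=` qball rho y r -> Lam y' r' <= CL * (r' / r) `^ eps * Lam y r) ->
  (forall n, F n -> 0 <= lam n) ->
  (forall k, exists n, [/\ F n, (j n <= k)%N,
      qball rho x (grid b R0 k) `<=` qball rho (c n) (E2 * grid b R0 (j n)) &
      prodavg rho mu f x (grid b R0 k) <= C0 * lam n]) ->
  (\sum_(k <oo) (Lam x (grid b R0 k) * prodavg rho mu f x (grid b R0 k))%:E <=
   C%:E * \sum_(n <oo | n \in F) (lam n * Lam (c n) (E2 * grid b R0 (j n)) *
      \1_(qball rho (c n) (E2 * grid b R0 (j n))) x)%:E)%E.
Proof.
move=> C00.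
have b0 : 0 < b by rewrite (lt_trans ltr01).
have E21 : 1 <= E2.
  by rewrite (le_trans _ (inner_le_outer kappa1))// (le_trans _ (inner_dil_ge3 kappa1))//; lra.
have E20 : 0 < E2 by rewrite (lt_le_trans _ E21).
pose q := b^-1 `^ eps.
have q0 : 0 <= q by exact: powR_ge0.
have q1 : q < 1.
  have := @gt0_ltr_powR R eps eps0 b^-1 1; rewrite powR1 !nnegrE invr_ge0 ler01 (ltW b0).
  by move=> /(_ isT isT); apply; rewrite invf_lt1.
exists (C0 * CL * (1 - q)^-1); first by rewrite !mulr_ge0// invr_ge0 subr_ge0 ltW.
move=> f R0 Lam F c j lam x R00 bf Lam0 hLam lam0 hx.
have g0 k : 0 < grid b R0 k by exact: grid_gt0.
have Eg0 k : 0 < E2 * grid b R0 k by rewrite mulr_gt0.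
pose t n : R := lam n * Lam (c n) (E2 * grid b R0 (j n)) *
      \1_(qball rho (c n) (E2 * grid b R0 (j n))) x.
have t0 n : n \in F -> 0 <= t n.
  by move=> /set_mem Fn; rewrite !mulr_ge0// ?lam0// Lam0.
pose w n k : \bar R := (if n \in F then (C0 * CL * t n)%:E * (if (j n <= k)%N then q ^+ (k - j n) else 0)%:E else 0)%E.
have w0 n k : (0 <= w n k)%E.
  rewrite /w; case: ifPn => // nF; apply: mule_ge0; rewrite lee_fin.
    exact: (mulr_ge0 (mulr_ge0 C00 CL0) (t0 n nF)).
  by case: ifP => // _; rewrite exprn_ge0.
apply: (@le_trans _ _ (\sum_(k <oo) \sum_(n <oo) w n k)%E).
  apply: lee_nneseries => [k _ _|k _].
    by rewrite lee_fin mulr_ge0// ?Lam0// (prodavg_ge0 hX).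
  have [n [Fn jk sub Gn]] := hx k.
  apply: (@le_trans _ _ (w n k)); last first.
    apply: le_trans (nneseries_lim_ge n.+1 _); last by move=> i _ _; exact: w0.
    by rewrite big_nat_recr//= -[leLHS]add0e leeD// sume_ge0.
  rewrite /w mem_set// jk -EFinM lee_fin /t indicE mem_set ?mulr1; last first.
    by apply: sub; exact: (qball_center hX).
  have Gx : 0 <= prodavg rho mu f x (grid b R0 k) by rewrite (prodavg_ge0 hX).
  have gk : grid b R0 k <= E2 * grid b R0 (j n).
    by rewrite (le_trans (grid_le b1 R00 jk))// ler_peMl// ltW.
  have hL := hLam (c n) x (E2 * grid b R0 (j n)) (grid b R0 k) (g0 k) gk.
  have {hL}hL : Lam x (grid b R0 k) <= CL * q ^+ (k - j n) * Lam (c n) (E2 * grid b R0 (j n)).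
    apply: (le_trans (hL _ sub)).
      by rewrite ler_pM2l// -[leRHS](grid0 b R0) grid_le.
    rewrite ler_wpM2r ?Lam0// ler_wpM2l//.
    rewrite /q -powR_mulrn ?powR_ge0// powRAC powR_mulrn ?invr_ge0 ?(ltW b0)//.
    have h1 : 0 <= grid b R0 k / (E2 * grid b R0 (j n)).
      exact: (divr_ge0 (ltW (g0 _)) (ltW (Eg0 _))).
    have h2 : 0 <= b^-1 ^+ (k - j n) by rewrite exprn_ge0// invr_ge0 ltW.
    apply: ge0_ler_powR; rewrite ?nnegrE ?h1 ?h2 ?(ltW eps0)//.
    rewrite ler_pdivrMr// (gridD b1 R0 (j n) (k - j n)) subnKC//.
    rewrite exprVn mulrCA mulKf ?expf_neq0 ?gt_eqF//.
    by rewrite ler_peMl// ltW.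
  apply: (le_trans (ler_pM (Lam0 _ _ (g0 k)) Gx hL Gn)).
  by rewrite le_eqVlt; apply/orP; left; apply/eqP; ring.
rewrite nneseries_interchange//.
rewrite -nneseriesZl; last by move=> n nF; rewrite lee_fin t0.
rewrite [leRHS]eseries_mkcond.
apply: lee_nneseries => [n _ _|n _]; first exact: nneseries_ge0.
rewrite /w; case: ifPn => nF; last by rewrite eseries0.
rewrite nneseriesZl; last by move=> k _; case: ifP => // _; rewrite lee_fin exprn_ge0.
have := @geometric_tail R q (j n) q0 q1.
move=> /(lee_wpmul2l (_ : 0 <= (C0 * CL * t n)%:E)%E) h.
apply: (le_trans (h _)); first by rewrite lee_fin; exact: (mulr_ge0 (mulr_ge0 C00 CL0) (t0 n nF)).
rewrite -!EFinM lee_fin.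
by rewrite mulrAC.
Qed.

End SparseDomination.

(** * Orlicz norms on balls *)

Section OrliczNorms.
Context {d : measure_display} {X : measurableType d} {R : realType}.
Variables (rho : X -> X -> R) (mu : {measure set X -> \bar R}).
Hypothesis hX : homogeneous_type rho mu.

Lemma averageE (x : X) (r : R) (g : X -> \bar R) : 0 < r ->
  average rho mu x r g = ((vol rho mu x r)^-1%:E * \int[mu]_(y in qball rho x r) g y)%E.
Proof.
move=> r0; rewrite /average (mu_qballE hX) inver gt_eqF//; exact: (vol_gt0 hX).
Qed.

Lemma average_le1 (x : X) (r : R) (g : X -> \bar R) : 0 < r ->
  (average rho mu x r g <= 1)%E = (\int[mu]_(y in qball rho x r) g y <= mu (qball rho x r))%E.
Proof.
move=> r0; have V0 := vol_gt0 hX x r0.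
rewrite averageE// (mu_qballE hX) -(@lee_pmul2l _ (vol rho mu x r)%:E) ?lte_fin//.
by rewrite muleA -EFinM divff ?gt_eqF// mul1e mule1.
Qed.

Variables (Phi : R -> R) (hPhi : young_function Phi).

(** The condition under the infimum in the Orlicz norm of a nonnegative [w], with the
    average multiplied out. *)
Definition orlicz_adm (w : X -> \bar R) x r (lam : R) : Prop := 0 < lam /\
  (\int[mu]_(y in qball rho x r) young_ext Phi (w y * (lam^-1)%:E) <= mu (qball rho x r))%E.

Lemma orlicz_normE (w : X -> \bar R) x r : 0 < r -> (forall y, 0 <= w y)%E ->
  orlicz_norm rho mu Phi x r w = ereal_inf [set lam%:E | lam in orlicz_adm w x r].
Proof.
move=> r0 w0; rewrite /orlicz_norm; congr (ereal_inf (_ @` _)).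
have eqI lam : (\int[mu]_(y in qball rho x r) young_ext Phi (`|w y| * (lam^-1)%:E) =
    \int[mu]_(y in qball rho x r) young_ext Phi (w y * (lam^-1)%:E))%E.
  by apply: eq_integral => y _; rewrite gee0_abs.
by apply/seteqP; split=> lam /= [l0]; rewrite average_le1// eqI.
Qed.

Lemma young_ext_le (s t : \bar R) : (0 <= s)%E -> (s <= t)%E ->
  (young_ext Phi s <= young_ext Phi t)%E.
Proof.
case: s t => [s||] [t||]//=; rewrite ?leey ?lee_fin//.
exact: young_increasing.
Qed.

Lemma orlicz_adm_le (w : X -> \bar R) x r lam lam' : (forall y, 0 <= w y)%E ->
  orlicz_adm w x r lam -> lam <= lam' -> orlicz_adm w x r lam'.
Proof.
move=> w0 [l0 hl] ll'; have l'0 : 0 < lam' by exact: lt_le_trans ll'.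
split => //; apply: le_trans hl; apply: le_lower_integral => y _.
  by apply: (young_ext_ge0 hPhi); rewrite mule_ge0// lee_fin invr_ge0 ltW.
apply: young_ext_le; first by rewrite mule_ge0// lee_fin invr_ge0 ltW.
by apply: lee_wpmul2l => //; rewrite lee_fin lef_pV2.
Qed.

Lemma orlicz_norm_ge0 w x r : (0 <= orlicz_norm rho mu Phi x r w)%E.
Proof. by apply: le_ereal_inf_tmp => _ [lam [l0 _] <-]; rewrite lee_fin ltW. Qed.

Lemma orlicz_norm_lt (w : X -> \bar R) x r (t : R) : 0 < r -> (forall y, 0 <= w y)%E ->
  (orlicz_norm rho mu Phi x r w < t%:E)%E -> orlicz_adm w x r t.
Proof.
move=> r0 w0; rewrite orlicz_normE// => /ereal_inf_lt[_ [lam al <-]].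
by rewrite lte_fin => /ltW; exact: orlicz_adm_le.
Qed.

(** The hypothesis of [sparse_orlicz] on one ball: up to constants, [A] is at most
    the norm of [a] over the ball for the conjugate of [Phi]. *)
Definition carleson (a : X -> R) x r (A : R) : Prop := 0 <= A /\
  forall la, 0 < la -> 4 * la < A ->
    (mu (qball rho x r) <= \int[mu]_(y in qball rho x r) theta Phi (a y / la))%E.

Lemma carleson0 a x r : carleson a x r 0.
Proof. by split => // la l0; rewrite ltNge mulr_ge0// ltW. Qed.

(** Hoelder's inequality on a ball: an average of [a * w], divided by an admissible
    constant for [w], is bounded by the conjugate average of [a]. *)
Lemma carleson_pairing (w : X -> \bar R) (a : X -> R) (F : X -> \bar R) x r lam (I : R) :
  0 < r -> measurable_fun [set: X] w -> (forall y, 0 <= w y)%E ->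
  measurable_fun [set: X] a -> (forall y, 0 <= a y) ->
  (forall y, 0 <= F y)%E -> (forall y, w y = +oo \/ F y <= (a y)%:E * w y)%E ->
  orlicz_adm w x r lam -> (\int[mu]_(y in qball rho x r) F y = I%:E)%E ->
  carleson a x r (I / (lam * vol rho mu x r)).
Proof.
move=> r0 mw w0 ma a0 F0 Fw [l0 hl] IE.
have V0 := vol_gt0 hX x r0; set V := vol rho mu x r in V0 *.
have I0 : 0 <= I by rewrite -lee_fin -IE integral_ge0.
have lV0 : 0 < lam * V by rewrite mulr_gt0.
split; first by rewrite divr_ge0// ltW.
move=> la la0 h; rewrite leNgt; apply/negP => Jlt.
have := @orlicz_pairing _ _ _ mu Phi hPhi (qball rho x r) w F a lam la (measurable_qball hX x r).
rewrite {1}(mu_qballE hX) ltry => /(_ isT mw w0 ma a0 F0 Fw l0 la0 hl).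
rewrite IE; move: Jlt; rewrite (mu_qballE hX) -/V.
set J := (\int[mu]_(y in _) _)%E => Jlt.
have J0 : (0 <= J)%E by apply: integral_ge0 => y _; exact: (theta_ge0 hPhi).
have Jf : J \is a fin_num by rewrite ge0_fin_numE// (lt_trans Jlt)// ltry.
case: J J0 Jf Jlt => [jj||]//= _ _; rewrite lte_fin => jV.
rewrite [X in (_ * X)%E](_ : _ = (2 * V + 2 * jj)%:E)// -EFinM lee_fin.
apply/negP; rewrite -ltNge.
rewrite ltr_pdivlMr// in h; apply: le_lt_trans h.
have -> : 4 * la * (lam * V) = lam * la * (2 * V + 2 * V) by ring.
by rewrite ler_pM2l ?mulr_gt0//; lra.
Qed.

(** [theta] vanishes up to 1, so at a level above the bound of [g] the conjugate term in
    [orlicz_pairing] disappears. *)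
Lemma orlicz_bounded_int (w : X -> \bar R) (g : X -> R) (F : X -> \bar R) x r lam N :
  0 < r -> measurable_fun [set: X] w -> (forall y, 0 <= w y)%E ->
  measurable_fun [set: X] g -> (forall y, 0 <= g y) -> (forall y, g y <= N) -> 0 < N ->
  (forall y, 0 <= F y)%E -> (forall y, w y = +oo \/ F y <= (g y)%:E * w y)%E ->
  orlicz_adm w x r lam ->
  (\int[mu]_(y in qball rho x r) F y <= (lam * N * 2 * vol rho mu x r)%:E)%E.
Proof.
move=> r0 mw w0 mg g0 gN N0 F0 Fw [l0 hl].
have := @orlicz_pairing _ _ _ mu Phi hPhi (qball rho x r) w F g lam N (measurable_qball hX x r).
rewrite {1}(mu_qballE hX) ltry => /(_ isT mw w0 mg g0 F0 Fw l0 N0 hl).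
have -> : (\int[mu]_(y in qball rho x r) theta Phi (g y / N) = 0)%E.
  by apply: integral0_eq => y _; rewrite (theta_le1 hPhi)// ler_pdivrMr// mul1r.
rewrite (mu_qballE hX) mule0 [X in (_ * X)%E](_ : _ = (2 * vol rho mu x r)%:E).
  by rewrite -EFinM mulrA.
by rewrite adde0.
Qed.

Lemma measurable_inv_weight (v : X -> R) : weight v ->
  measurable_fun [set: X] (fun y => ((v y)%:E)^-1)%E.
Proof.
move=> [mv v0].
rewrite (_ : (fun y => _) = (fun y => if v y == 0 then +oo%E else (v y `^ (-1))%:E)).
  apply: measurable_fun_ifT => //; first exact: measurable_fun_eqr.
  by apply/measurable_EFinP; exact: (measurableT_comp (measurable_powR (-1)) mv).
by apply/funext => y; rewrite inver; case: eqP => // _; rewrite powR_inv1.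
Qed.

(** The norm vanishes only for functions that are null on the ball, and [1 / v] is
    nowhere zero: on the set where [v <= n + 1], the integral of 1 is at most any
    multiple of the norm. Without positivity a product of norms could vanish while
    another factor is infinite. *)
Lemma orlicz_norm_gt0 (v : X -> R) x r : 0 < r -> weight v ->
  (0 < orlicz_norm rho mu Phi x r (fun y => ((v y)%:E)^-1))%E.
Proof.
move=> r0 hv; have [mv v0] := hv; rewrite ltNge; apply/negP => le0.
have w0 y : (0 <= ((v y)%:E)^-1)%E by rewrite inve_ge0 lee_fin.
have mw := measurable_inv_weight hv.
have adm t : 0 < t -> orlicz_adm (fun y => ((v y)%:E)^-1)%E x r t.
  by move=> t0; apply: orlicz_norm_lt => //; apply: le_lt_trans le0 _; rewrite lte_fin.
pose S (n : nat) := [set y | v y <= n.+1%:R].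
have mS n : measurable (S n).
  rewrite (_ : S n = v @^-1` `]-oo, n.+1%:R]); last first.
    by apply/seteqP; split => y /=; rewrite in_itv.
  by rewrite -[X in measurable X]setTI; apply: mv.
have mBx := measurable_qball hX x r.
have V0 := vol_gt0 hX x r0.
have S0 n : mu (qball rho x r `&` S n) = 0%E.
  apply/eqP; rewrite eq_le measure_ge0 andbT.
  apply/lee_addgt0Pr => e e0; rewrite add0e.
  pose t := e / (n.+1%:R * 2 * vol rho mu x r).
  have t0 : 0 < t by rewrite divr_gt0// !mulr_gt0.
  have := @orlicz_bounded_int (fun y => ((v y)%:E)^-1)%E (fun y => v y * \1_(S n) y)
    (fun y => (\1_(S n) y)%:E) x r t n.+1%:R r0 mw w0.
  have -> : t * n.+1%:R * 2 * vol rho mu x r = e.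
    rewrite /t -!mulrA mulVf ?mulr1// gt_eqF// !mulr_gt0//.
  rewrite integral_indic// setIC; apply => //.
  - by apply: measurable_funM.
  - by move=> y; rewrite mulr_ge0.
  - move=> y; rewrite indicE; case: (boolP (y \in S n)) => [/set_mem|_]; first by rewrite mulr1.
    by rewrite mulr0.
  - move=> y; have [vy|vy] := eqVneq (v y) 0; first by left; rewrite vy inve0.
    right; rewrite inver (negPf vy) -EFinM lee_fin mulrAC divff// mul1r.
    exact: lexx.
  - exact: adm.
have : (mu (qball rho x r) <= \sum_(n <oo) mu (qball rho x r `&` S n))%E.
  apply: measure_sigma_subadditive => //; first by move=> n; exact: measurableI.
  move=> y By; exists (Num.truncn (v y)) => //; split => //=.
  exact/ltW/truncnS_gt.
by rewrite eseries0 => [|n _ _]; rewrite ?S0// (mu_qballE hX) lee_fin leNgt V0.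
Qed.

End OrliczNorms.

(** * The bump condition on one ball *)

Lemma prode_gt0 {R : realType} (I : Type) (s : seq I) (f : I -> \bar R) :
  (forall i, (0 < f i)%E) -> (0 < \prod_(i <- s) f i)%E.
Proof.
by move=> f0; elim/big_ind: _ => [|x y|i _]; [exact: lte01|exact: mule_gt0|exact: f0].
Qed.

Lemma prode_lty {R : realType} (m : nat) (f : 'I_m -> \bar R) :
  (forall i, (0 < f i)%E) -> (\prod_(i < m) f i < +oo)%E -> forall i, (f i < +oo)%E.
Proof.
move=> f0 fin i; rewrite ltey; apply/negP => /eqP fi.
move: fin; rewrite (bigD1 i)//= fi gt0_mulye ?ltxx//.
rewrite big_mkcond/=; apply: prode_gt0 => k; case: ifP => // _; exact: lte01.
Qed.

Section BallEstimates.
Context {d : measure_display} {X : measurableType d} {R : realType}.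
Variables (rho : X -> X -> R) (mu : {measure set X -> \bar R}).
Hypothesis hX : homogeneous_type rho mu.
Variables (m : nat) (Phi : 'I_m -> R -> R) (v : 'I_m -> X -> R) (u : X -> R).
Hypothesis hPhi : forall i, young_function (Phi i).
Hypothesis hv : forall i, weight (v i).
Hypothesis hu : weight u.

Let w i (y : X) : \bar R := ((v i y)%:E)^-1%E.

Let w0 i y : (0 <= w i y)%E.
Proof. by rewrite inve_ge0 lee_fin; have [_] := hv i. Qed.

Let mw i : measurable_fun [set: X] (w i).
Proof. exact: measurable_inv_weight. Qed.

(** When [N0], the norm of the left weight, is positive, finiteness of the product
    forces all the norms to be finite, since the others are positive. The factor 2 per
    norm pays for replacing an infimum by an admissible number. *)
Lemma bump_admissible x r (P e bnd : R) (N0 : \bar R) : 0 < r -> 0 < P -> (0 <= N0)%E ->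
  (P%:E * (mu (qball rho x r) `^ e) * N0 *
    \prod_(i < m) orlicz_norm rho mu (Phi i) x r (w i) <= bnd%:E)%E ->
  N0 = 0%E \/ exists n0 lam, [/\ N0 = n0%:E, 0 < n0,
     forall i, orlicz_adm rho mu (Phi i) (w i) x r (lam i) &
     P * vol rho mu x r `^ e * n0 * \prod_(i < m) lam i <= 2 ^+ m * bnd].
Proof.
move=> r0 P0 N00; have V0 := vol_gt0 hX x r0.
rewrite (mu_qballE hX) poweR_EFin -EFinM => h.
have [->|Nn0] := eqVneq N0 0%E; [by left|right].
have Np : (0 < N0)%E by rewrite lt_neqAle N00 andbT eq_sym.
have c0 : 0 < P * vol rho mu x r `^ e by rewrite mulr_gt0// powR_gt0.
pose N i := orlicz_norm rho mu (Phi i) x r (w i).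
have Ni i : (0 < N i)%E by exact: (orlicz_norm_gt0 hX (hPhi i)).
have Pi0 : (0 < \prod_(i < m) N i)%E by exact: prode_gt0.
have cN0 : (0 < (P * vol rho mu x r `^ e)%:E * N0)%E by rewrite mule_gt0// lte_fin.
have Pify : (\prod_(i < m) N i < +oo)%E.
  rewrite ltey; apply/negP => /eqP Py; move: h; rewrite Py gt0_muley//.
have Ny : (N0 < +oo)%E.
  rewrite ltey; apply/negP => /eqP Py; move: h; rewrite Py gt0_muley ?lte_fin// gt0_mulye//.
have Nify := prode_lty Ni Pify.
have NE i : N i = (fine (N i))%:E by rewrite fineK// ge0_fin_numE// ltW.
have n0 i : 0 < fine (N i) by rewrite -lte_fin -NE.
exists (fine N0), (fun i => 2 * fine (N i)); split.
- by rewrite fineK// ge0_fin_numE.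
- by rewrite fine_gt0// Np Ny.
- move=> i; apply: (orlicz_norm_lt hX (hPhi i) r0 (w0 i)).
  by rewrite -/(N i) NE lte_fin; have := n0 i; lra.
rewrite big_split/= prodr_const card_ord mulrCA ler_wpM2l ?exprn_ge0//.
have NE0 : N0 = (fine N0)%:E by rewrite fineK// ge0_fin_numE.
rewrite -lee_fin; apply: le_trans h.
rewrite [X in (_ <= _ * X * _)%E]NE0 (eq_bigr (fun i => (fine (N i))%:E)); last by move=> i _; exact: NE.
by rewrite prodEFin -!EFinM.
Qed.

Lemma ball_carleson (f : 'I_m -> X -> R) x r (lam : 'I_m -> R) i : 0 < r ->
  bounded_nonneg (f i) -> orlicz_adm rho mu (Phi i) (w i) x r (lam i) ->
  carleson rho mu (Phi i) (fun y => f i y * v i y) x r (ballavg rho mu (f i) x r / lam i).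
Proof.
move=> r0 bf al; have [mf f0 _] := bf; have [mv v0] := hv i.
rewrite /ballavg -mulrA -invfM [vol _ _ _ _ * _]mulrC.
apply: (carleson_pairing hX (hPhi i) (w := w i) (F := fun y => (f i y)%:E)) => //.
- exact: measurable_funM.
- by move=> y; rewrite mulr_ge0.
- move=> y; have [vy|vy] := eqVneq (v i y) 0; first by left; rewrite /w vy inve0.
  by right; rewrite /w inver (negPf vy) -EFinM lee_fin mulfK.
- exact: (bounded_ballint hX).
Qed.

(** The bump condition trades the weights for the conjugate averages of [f i * v i] on
    one ball. The left weight enters through the average of its power [q]; when that
    average vanishes, so does the left-hand side. *)
Lemma ball_estimate_le1 (q P e bnd : R) x r (f : 'I_m -> X -> R) :
  0 < q -> 0 < r -> 0 <= P -> 0 <= bnd -> (forall i, bounded_nonneg (f i)) ->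
  (P%:E * (mu (qball rho x r) `^ e) *
     ((average rho mu x r (fun y => (u y `^ q)%:E)) `^ q^-1) *
    \prod_(i < m) orlicz_norm rho mu (Phi i) x r (w i) <= bnd%:E)%E ->
  exists A : 'I_m -> R,
    (forall i, carleson rho mu (Phi i) (fun y => f i y * v i y) x r (A i)) /\
    (((P * vol rho mu x r ^+ m * prodavg rho mu f x r) `^ q)%:E *
       \int[mu]_(y in qball rho x r) (u y `^ q)%:E <=
     ((2 ^+ m * bnd * vol rho mu x r `^ (m%:R - e + q^-1) * \prod_(i < m) A i) `^ q)%:E)%E.
Proof.
move=> q0 r0 P0 bnd0 bf h; have V0 := vol_gt0 hX x r0; set V := vol rho mu x r in V0 *.
set J := (\int[mu]_(y in _) _)%E.
have J0 : (0 <= J)%E by apply: integral_ge0 => y _; rewrite lee_fin powR_ge0.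
have triv : (((P * V ^+ m * prodavg rho mu f x r) `^ q)%:E * J = 0)%E ->
  exists A : 'I_m -> R,
    (forall i, carleson rho mu (Phi i) (fun y => f i y * v i y) x r (A i)) /\
    (((P * V ^+ m * prodavg rho mu f x r) `^ q)%:E * J <=
     ((2 ^+ m * bnd * V `^ (m%:R - e + q^-1) * \prod_(i < m) A i) `^ q)%:E)%E.
  move=> ->; exists (fun=> 0); split; first by move=> i; exact: carleson0.
  by rewrite lee_fin powR_ge0.
have [P00|Pn0] := eqVneq P 0.
  by apply: triv; rewrite P00 !mul0r powR0 ?gt_eqF// mul0e.
have {Pn0}Pp : 0 < P by rewrite lt_neqAle P0 andbT eq_sym.
move: h; rewrite (averageE hX)// -/V -/J => h.
have a0 : (0 <= (V^-1)%:E * J)%E by rewrite mule_ge0// lee_fin invr_ge0 ltW.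
have [N00|[n0 [lam [NE n00 al hl]]]] := bump_admissible r0 Pp (poweR_ge0 _ _) h.
  apply: triv; have := poweR_eq0_eq0 a0 N00 => /eqP.
  rewrite mule_eq0 => /orP[/eqP[/eqP]|/eqP->]; last by rewrite mule0.
  by rewrite invr_eq0 gt_eqF.
have JE : J = (V * n0 `^ q)%:E.
  have : ((V^-1)%:E * J = (n0 `^ q)%:E)%E.
    rewrite -poweR_EFin -NE -poweRrM mulVf ?gt_eqF// poweRe1//.
  move=> /(congr1 (fun z => V%:E * z)%E).
  by rewrite muleA -EFinM divff ?gt_eqF// mul1e => ->; rewrite -EFinM.
exists (fun i => ballavg rho mu (f i) x r / lam i); split.
  by move=> i; exact: ball_carleson.
have l0 i : 0 < lam i by have [] := al i.
have A0 i : 0 <= ballavg rho mu (f i) x r / lam i.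
  by rewrite divr_ge0 ?(ballavg_ge0 hX)// ltW.
set Pi := \prod_(i < m) (_ / _).
have Pi0 : 0 <= Pi by apply: prodr_ge0 => i _.
have -> : prodavg rho mu f x r = \prod_(i < m) lam i * Pi.
  rewrite /prodavg /Pi -big_split/=; apply: eq_bigr => i _.
  by rewrite mulrC divfK// gt_eqF.
have L0 : 0 <= \prod_(i < m) lam i by apply: prodr_ge0 => i _; exact: ltW.
have VqE : V = (V `^ q^-1) `^ q by rewrite -powRrM mulVf ?gt_eqF// powRr1// ltW.
rewrite JE -EFinM lee_fin {2}VqE.
rewrite -powRM ?powR_ge0 ?(ltW n00)// -powRM; last 2 first.
- by rewrite mulr_ge0 ?mulr_ge0 ?exprn_ge0 ?(ltW V0).
- by rewrite mulr_ge0 ?powR_ge0 ?(ltW n00).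
apply: ge0_ler_powR; rewrite ?nnegrE ?(ltW q0)//.
- by rewrite mulr_ge0 ?mulr_ge0 ?mulr_ge0 ?exprn_ge0 ?powR_ge0 ?(ltW V0) ?(ltW n00).
- by rewrite mulr_ge0 ?mulr_ge0 ?exprn_ge0 ?powR_ge0.
have VE : V ^+ m * V `^ q^-1 = V `^ e * V `^ (m%:R - e + q^-1).
  rewrite -powR_mulrn ?(ltW V0)// -!powRD ?(gt_eqF V0) ?implybT//; congr powR; ring.
rewrite [leLHS](_ : _ = (P * V `^ e * n0 * \prod_(i < m) lam i) * (V `^ (m%:R - e + q^-1) * Pi)).
  by rewrite -[leRHS]mulrA ler_wpM2r// mulr_ge0// powR_ge0.
transitivity (V ^+ m * V `^ q^-1 * (P * (\prod_(i < m) lam i * Pi) * n0)); first by ring.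
by rewrite VE; ring.
Qed.

Variables (Psi : R -> R).
Hypothesis hPsi : young_function Psi.

(** For [q > 1] the left weight is paired with a dual function [g], and a conjugate
    average [B] of [g] for [Psi] appears as well. *)
Lemma ball_estimate_gt1 (P e bnd : R) x r (f : 'I_m -> X -> R) (g : X -> R) :
  0 < r -> 0 <= P -> 0 <= bnd -> (forall i, bounded_nonneg (f i)) -> bounded_nonneg g ->
  (P%:E * (mu (qball rho x r) `^ e) * orlicz_norm rho mu Psi x r (EFin \o u) *
    \prod_(i < m) orlicz_norm rho mu (Phi i) x r (w i) <= bnd%:E)%E ->
  exists (A : 'I_m -> R) (B : R),
    [/\ forall i, carleson rho mu (Phi i) (fun y => f i y * v i y) x r (A i),
        carleson rho mu Psi g x r B &
    ((P * vol rho mu x r ^+ m * prodavg rho mu f x r)%:E *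
       \int[mu]_(y in qball rho x r) (u y * g y)%:E <=
     (2 ^+ m.+1 * bnd * vol rho mu x r `^ (m%:R - e + 1) * \prod_(i < m) A i * B)%:E)%E].
Proof.
move=> r0 P0 bnd0 bf bg h; have V0 := vol_gt0 hX x r0; set V := vol rho mu x r in V0 *.
have [mu_ u0] := hu; have [mg g0 [Ng hNg]] := bg.
set J := (\int[mu]_(y in _) _)%E.
have J0 : (0 <= J)%E by apply: integral_ge0 => y _; rewrite lee_fin mulr_ge0.
have meu : measurable_fun [set: X] (EFin \o u) by exact/measurable_EFinP.
have eu0 y : (0 <= (EFin \o u) y)%E by rewrite lee_fin.
have ugw y : (EFin \o u) y = +oo%E \/ ((u y * g y)%:E <= (g y)%:E * (EFin \o u) y)%E.
  by right; rewrite -EFinM mulrC.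
have ug0 y : (0 <= (u y * g y)%:E)%E by rewrite lee_fin mulr_ge0.
pose N := Num.max Ng 1.
have N0 : 0 < N by rewrite lt_max ltr01 orbT.
have gN y : g y <= N by rewrite le_max hNg.
have Jle lam : orlicz_adm rho mu Psi (EFin \o u) x r lam -> (J <= (lam * N * 2 * V)%:E)%E.
  by move=> al; apply: (orlicz_bounded_int hX hPsi r0 meu eu0 mg g0 gN N0 ug0 ugw al).
have triv : ((P * V ^+ m * prodavg rho mu f x r)%:E * J = 0)%E ->
  exists (A : 'I_m -> R) (B : R),
    [/\ forall i, carleson rho mu (Phi i) (fun y => f i y * v i y) x r (A i),
        carleson rho mu Psi g x r B &
    ((P * V ^+ m * prodavg rho mu f x r)%:E * J <=
     (2 ^+ m.+1 * bnd * V `^ (m%:R - e + 1) * \prod_(i < m) A i * B)%:E)%E].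
  move=> ->; exists (fun=> 0), 0; split; [|exact: carleson0|].
    by move=> i; exact: carleson0.
  by rewrite mulr0.
have [P00|Pn0] := eqVneq P 0; first by apply: triv; rewrite P00 !mul0r mul0e.
have {Pn0}Pp : 0 < P by rewrite lt_neqAle P0 andbT eq_sym.
have [N00|[n0 [lam [NE n00 al hl]]]] := bump_admissible r0 Pp (orlicz_norm_ge0 rho mu Psi _ _ _) h.
  apply: triv; suff -> : J = 0%E by rewrite mule0.
  apply/eqP; rewrite eq_le J0 andbT; apply/lee_addgt0Pr => t t0; rewrite add0e.
  have k0 : 0 < N * 2 * V by rewrite !mulr_gt0.
  have := Jle (t / (N * 2 * V)); rewrite -!mulrA [N * (2 * V)]mulrA mulVf ?gt_eqF// mulr1; apply.
  apply: (orlicz_norm_lt hX hPsi) => //.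
  by rewrite N00 lte_fin divr_gt0.
pose lu := 2 * n0.
have alu : orlicz_adm rho mu Psi (EFin \o u) x r lu.
  apply: (orlicz_norm_lt hX hPsi) => //.
  by rewrite NE lte_fin /lu; lra.
have lu0 : 0 < lu by have [] := alu.
have JE : J = (fine J)%:E by rewrite fineK// ge0_fin_numE// (le_lt_trans (Jle _ alu))// ltry.
exists (fun i => ballavg rho mu (f i) x r / lam i), (fine J / (lu * V)); split.
- by move=> i; exact: ball_carleson.
- by apply: (carleson_pairing hX hPsi (w := EFin \o u) (F := fun y => (u y * g y)%:E)).
have l0 i : 0 < lam i by have [] := al i.
have A0 i : 0 <= ballavg rho mu (f i) x r / lam i.
  by rewrite divr_ge0 ?(ballavg_ge0 hX)// ltW.
set Pi := \prod_(i < m) (_ / _).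
have Pi0 : 0 <= Pi by apply: prodr_ge0 => i _.
have -> : prodavg rho mu f x r = \prod_(i < m) lam i * Pi.
  rewrite /prodavg /Pi -big_split/=; apply: eq_bigr => i _.
  by rewrite mulrC divfK// gt_eqF.
rewrite JE -EFinM lee_fin.
set B := _ / (lu * V).
have luV : 0 < lu * V by exact: mulr_gt0.
have B0 : 0 <= B := divr_ge0 (fine_ge0 J0) (ltW luV).
have -> : fine J = lu * V * B by rewrite [RHS]mulrC divfK// gt_eqF.
have VE : V ^+ m * V = V `^ e * V `^ (m%:R - e + 1).
  rewrite -powR_mulrn ?(ltW V0)// -{2}(powRr1 (ltW V0)) -!powRD ?(gt_eqF V0) ?implybT//; congr powR; ring.
rewrite [leLHS](_ : _ = 2 * (P * V `^ e * n0 * \prod_(i < m) lam i) * (V `^ (m%:R - e + 1) * Pi * B)).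
  rewrite [leRHS](_ : _ = 2 * (2 ^+ m * bnd) * (V `^ (m%:R - e + 1) * Pi * B)).
    apply: ler_wpM2r; last by rewrite ler_pM2l.
    exact: (mulr_ge0 (mulr_ge0 (powR_ge0 _ _) Pi0) B0).
  by rewrite exprS !mulrA.
transitivity (V ^+ m * V * (P * (\prod_(i < m) lam i * Pi) * lu * B)); first by ring.
by rewrite VE /lu; ring.
Qed.

End BallEstimates.

(** * Series of powers and duality *)

Section Series.
Context {R : realType}.

Lemma le_poweR (q : R) (x y : \bar R) : 0 <= q -> (0 <= x)%E -> (x <= y)%E ->
  (x `^ q <= y `^ q)%E.
Proof.
move=> q0 x0 xy; apply: gt0_ler_poweR => //; rewrite in_itv/= leey andbT//.
exact: le_trans xy.
Qed.

(** Each term is bounded by the whole sum. *)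
Lemma lp_le_lq (P : pred nat) (x : nat -> R) (p q K : R) : 0 < p -> p <= q -> 0 <= K ->
  (forall n, P n -> 0 <= x n) -> (\sum_(n <oo | P n) (x n `^ p)%:E <= K%:E)%E ->
  (\sum_(n <oo | P n) (x n `^ q)%:E <= (K `^ ((q - p) / p) * K)%:E)%E.
Proof.
move=> p0 pq K0 x0 hs; have q0 : 0 < q by exact: lt_le_trans pq.
have xK n : P n -> x n `^ p <= K.
  move=> Pn; rewrite -lee_fin; apply: le_trans hs.
  rewrite (nneseriesD1 (n := n))//; last by move=> k _; rewrite lee_fin powR_ge0.
  by rewrite leeDl// nneseries_ge0// => k _ _; rewrite lee_fin powR_ge0.
apply: (@le_trans _ _ (\sum_(n <oo | P n) ((K `^ ((q - p) / p))%:E * (x n `^ p)%:E))%E).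
  apply: lee_nneseries => [n _ _|n Pn]; first by rewrite lee_fin powR_ge0.
  rewrite -EFinM lee_fin -{1}(subrK p q) powRD ?subrK ?(gt_eqF q0)//.
  rewrite ler_wpM2r ?powR_ge0//.
  have -> : x n `^ (q - p) = (x n `^ p) `^ ((q - p) / p).
    by rewrite -powRrM mulrC divfK// gt_eqF.
  by apply: ge0_ler_powR; rewrite ?nnegrE ?powR_ge0 ?xK ?divr_ge0 ?subr_ge0 ?(ltW p0).
rewrite nneseriesZl; last by move=> k _; rewrite lee_fin powR_ge0.
by rewrite EFinM; apply: lee_wpmul2l => //; rewrite lee_fin powR_ge0.
Qed.

Lemma powR_subadd (q x y : R) : 0 < q -> q <= 1 -> 0 <= x -> 0 <= y ->
  (x + y) `^ q <= x `^ q + y `^ q.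
Proof.
move=> q0 q1 x0 y0.
have [xy0|xyn] := eqVneq (x + y) 0.
  by rewrite xy0 powR0 ?gt_eqF// addr_ge0 ?powR_ge0.
have s0 : 0 < x + y by rewrite lt_neqAle eq_sym xyn addr_ge0.
have h z : 0 <= z -> z <= x + y -> z / (x + y) * (x + y) `^ q <= z `^ q.
  move=> z0 zs; have [->|zn] := eqVneq z 0; first by rewrite !mul0r powR_ge0.
  rewrite -[in leRHS](divfK xyn z) powRM ?divr_ge0 ?(ltW s0)//.
  rewrite ler_wpM2r ?powR_ge0// ger1_powR//.
  have zp : 0 < z by rewrite lt_neqAle z0 eq_sym zn.
  by rewrite divr_gt0//= ler_pdivrMr// mul1r.
have := lerD (h x x0 _) (h y y0 _); rewrite -mulrDl -mulrDl divff// mul1r; apply.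
  by rewrite lerDl.
by rewrite lerDr.
Qed.

(** Subadditivity of [t `^ q], used instead of duality when [q <= 1]. *)
Lemma series_poweR_le (P : pred nat) (a : nat -> R) (q : R) : 0 < q -> q <= 1 ->
  (forall n, P n -> 0 <= a n) ->
  ((\sum_(n <oo | P n) (a n)%:E) `^ q <= \sum_(n <oo | P n) (a n `^ q)%:E)%E.
Proof.
move=> q0 q1 aP; pose a' n := if P n then a n else 0.
have a0 n : 0 <= a' n by rewrite /a'; case: ifP => // /aP.
rewrite [X in (X `^ _)%E]eseries_mkcond [leRHS]eseries_mkcond.
rewrite [X in (X `^ _)%E](eq_eseriesr (g := fun n => (a' n)%:E)); last first.
  by move=> n _; rewrite /a'; case: ifP.
rewrite [leRHS](eq_eseriesr (g := fun n => (a' n `^ q)%:E)); last first.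
  by move=> n _; rewrite /a'; case: ifP => // _; rewrite powR0 ?gt_eqF.
set S := (X in (_ <= X)%E).
have S0 : (0 <= S)%E by apply: nneseries_ge0 => n _ _; rewrite lee_fin powR_ge0.
have SE : S = ((S `^ q^-1) `^ q)%E by rewrite -poweRrM mulVf ?gt_eqF// poweRe1.
rewrite SE.
apply: le_poweR; first exact: ltW.
  by apply: nneseries_ge0 => n _ _; rewrite lee_fin a0.
apply: nneseries_le_bound => [n|n]; first by rewrite lee_fin a0.
have fin : ((\sum_(0 <= k < n) a' k) `^ q <= \sum_(0 <= k < n) a' k `^ q).
  elim: n => [|n IH]; first by rewrite !big_nil powR0// gt_eqF.
  rewrite !big_nat_recr //=.
  apply: le_trans (powR_subadd q0 q1 _ (a0 n)) _; first exact: sumr_ge0.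
  by rewrite lerD2r.
have finS : ((\sum_(0 <= k < n) a' k `^ q)%:E <= S)%E.
  by rewrite -sumEFin; apply: nneseries_lim_ge => k _ _; rewrite lee_fin powR_ge0.
rewrite sumEFin.
have s0 : 0 <= \sum_(0 <= k < n) a' k by exact: sumr_ge0.
rewrite [leLHS](_ : _ = (((\sum_(0 <= k < n) a' k) `^ q)%:E `^ q^-1)%E); last first.
  by rewrite poweR_EFin -powRrM divff ?gt_eqF// powRr1.
apply: le_poweR; rewrite ?lee_fin ?powR_ge0 ?invr_ge0 ?(ltW q0)//.
by apply: le_trans finS; rewrite lee_fin.
Qed.

End Series.

Section Duality.
Context {d : measure_display} {X : measurableType d} {R : realType}.
Variable (mu : {measure set X -> \bar R}).

Lemma limn_einf_le_bound (u : (\bar R)^nat) (C : \bar R) :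
  (forall n, (u n <= C)%E) -> (limn_einf u <= C)%E.
Proof.
move=> uC; rewrite limn_einf_lim; apply: lime_le; first exact: is_cvg_einfs.
apply: nearW => n; apply: (le_trans _ (uC n)); apply: ereal_inf_lbound.
by exists n => /=.
Qed.

(** Duality between [L^q] and its conjugate. The test function is the normalized
    [hn n `^ (q - 1)] for the truncation [hn n] of [h], whose norm is known to be finite;
    it is bounded, as the averages over balls require. *)
Lemma duality_bound (h : X -> \bar R) (T : set X) (q C : R) : 1 < q -> 0 <= C ->
  measurable T -> (mu T < +oo)%E -> measurable_fun [set: X] h -> (forall x, 0 <= h x)%E ->
  (forall g, bounded_nonneg g -> (\int[mu]_x (g x `^ conj_exp q)%:E <= 1)%E ->
     (\int[mu]_(x in T) (h x * (g x)%:E) <= C%:E)%E) ->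
  (\int[mu]_(x in T) (h x `^ q) <= (C `^ q)%:E)%E.
Proof.
move=> q1 C0 mT fT mh h0 hg; have q0 : 0 < q by lra.
pose hn (n : nat) x : R := fine (mine (h x) n%:R%:E).
have hnE n x : (hn n x)%:E = mine (h x) n%:R%:E.
  rewrite /hn fineK// ge0_fin_numE; last by rewrite le_min h0 lee_fin/=.
  by apply: (@le_lt_trans _ _ n%:R%:E); [rewrite ge_min lexx orbT|exact: ltry].
have hn0 n x : 0 <= hn n x by rewrite -lee_fin hnE le_min h0 lee_fin/=.
have hnN n x : hn n x <= n%:R by rewrite -lee_fin hnE ge_min lexx orbT.
have hnh n x : ((hn n x)%:E <= h x)%E by rewrite hnE ge_min lexx.
have mhn n : measurable_fun [set: X] (hn n).
  apply/measurable_EFinP; rewrite (_ : EFin \o hn n = fun x => mine (h x) n%:R%:E).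
    exact: measurable_mine.
  by apply/funext => x; exact: hnE.
have mhnq n r : measurable_fun [set: X] (fun x => (hn n x `^ r)%:E).
  by apply/measurable_EFinP; exact: (measurableT_comp (measurable_powR r) (mhn n)).
have key n : (\int[mu]_(x in T) (hn n x `^ q)%:E <= (C `^ q)%:E)%E.
  set I := (\int[mu]_(x in T) _)%E.
  have I0 : (0 <= I)%E by apply: integral_ge0 => x _; rewrite lee_fin powR_ge0.
  have Ify : (I < +oo)%E.
    apply: (@le_lt_trans _ _ (\int[mu]_(x in T) (n%:R `^ q)%:E)%E).
      apply: le_lower_integral => x _; rewrite lee_fin ?powR_ge0//.
      by apply: ge0_ler_powR; rewrite ?nnegrE ?(ltW q0) ?hn0 ?hnN.
    by rewrite integral_cst// lte_mul_pinfty// lee_fin powR_ge0.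
  have IE : I = (fine I)%:E by rewrite fineK// ge0_fin_numE.
  have [->|In0] := eqVneq I 0%E; first by rewrite lee_fin powR_ge0.
  set i := fine I in IE.
  have Ip : (0 < I)%E by rewrite lt_neqAle eq_sym In0 I0.
  have i0 : 0 < i by rewrite /i fine_gt0// Ip Ify.
  have q'E : (conj_exp q)^-1 = 1 - q^-1.
    by rewrite /conj_exp; field; rewrite gt_eqF//= subr_eq0 gt_eqF.
  have q'0 : conj_exp q != 0 by rewrite gt_eqF// divr_gt0// subr_gt0.
  pose k := i `^ (- (conj_exp q)^-1).
  have kpos : 0 < k by exact: powR_gt0.
  pose g x := k * (hn n x `^ (q - 1) * \1_T x).
  have g0 x : 0 <= g x by rewrite !mulr_ge0 ?powR_ge0 ?(ltW kpos).
  have bg : bounded_nonneg g.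
    split => //.
      apply: measurable_funM => //; apply: measurable_funM => //.
      exact: (measurableT_comp (measurable_powR _) (mhn n)).
    exists (k * n%:R `^ (q - 1)) => x; rewrite ler_pM2l//.
    rewrite -[leRHS]mulr1; apply: ler_pM; rewrite ?powR_ge0//.
    by apply: ge0_ler_powR; rewrite ?nnegrE ?subr_ge0 ?(ltW q1) ?hn0 ?hnN.
  have gT x : x \in T -> g x = k * hn n x `^ (q - 1).
    by move=> xT; rewrite /g indicE xT mulr1.
  have gint : (\int[mu]_x (g x `^ conj_exp q)%:E = 1)%E.
    rewrite (_ : (\int[mu]_x _)%E = (\int[mu]_(x in T) ((i^-1)%:E * (hn n x `^ q)%:E))%E).
      rewrite ge0_integralZl_EFin//; last 3 first.
      - by move=> x _; rewrite lee_fin powR_ge0.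
      - by apply: measurable_funTS; exact: mhnq.
      - by rewrite invr_ge0 ltW.
      by rewrite -/I IE -EFinM mulVf ?gt_eqF.
    rewrite [RHS]integral_mkcond; apply: eq_integral => x _.
    rewrite /patch; case: ifPn => xT; last first.
      by rewrite /g indicE (negPf xT) !mulr0 powR0.
    rewrite gT// powRM ?powR_ge0 ?(ltW kpos)// -powRrM mulrC.
    rewrite (_ : (q - 1) * conj_exp q = q); last first.
      by rewrite /conj_exp mulrC divfK// subr_eq0 gt_eqF.
    rewrite mulrC -EFinM; congr (_ * _)%:E.
    by rewrite /k -powRrM mulNr mulVf// powR_inv1// ltW.
  have := hg g bg; rewrite gint lexx => /(_ isT) hC.
  have : ((i `^ q^-1)%:E <= C%:E)%E.
    apply: le_trans hC.
    apply: (@le_trans _ _ (\int[mu]_(x in T) (k%:E * (hn n x `^ q)%:E))%E).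
      rewrite ge0_integralZl_EFin//; last 3 first.
      - by move=> x _; rewrite lee_fin powR_ge0.
      - by apply: measurable_funTS; exact: mhnq.
      - exact: ltW.
      rewrite -/I IE -EFinM lee_fin /k -[X in _ * X](powRr1 (ltW i0)) -powRD; last first.
        by rewrite (gt_eqF i0) implybT.
      by rewrite q'E (_ : _ + 1 = q^-1)//; ring.
    apply: le_lower_integral => x xT.
      by rewrite mule_ge0 ?lee_fin ?powR_ge0// ltW.
    rewrite (gT x (mem_set xT)) [(k * _)%:E]EFinM muleCA; apply: lee_wpmul2l; first by rewrite lee_fin ltW.
    have [hx0|hxn] := eqVneq (hn n x) 0.
      by rewrite hx0 powR0 ?gt_eqF// mule_ge0// lee_fin powR_ge0.
    rewrite (@powR_pred R (hn n x) q) ?lt_neqAle ?hn0 1?eq_sym ?hxn//.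
    by rewrite mulrC EFinM; apply: lee_wpmul2r => //; rewrite lee_fin powR_ge0.
  rewrite lee_fin => iC; rewrite IE lee_fin.
  have -> : i = (i `^ q^-1) `^ q by rewrite -powRrM mulVf ?gt_eqF// powRr1// ltW.
  by apply: ge0_ler_powR; rewrite ?nnegrE ?powR_ge0 ?(ltW q0).
apply: (@le_trans _ _ (limn_einf (fun n => \int[mu]_(x in T) (hn n x `^ q)%:E)%E)); last first.
  by apply: limn_einf_le_bound.
rewrite [leLHS]integral_mkcond.
under [X in limn_einf X]eq_fun do rewrite integral_mkcond.
apply: lower_fatou.
- by move=> x; rewrite /patch; case: ifP => // _; exact: poweR_ge0.
- by move=> n x; rewrite /patch; case: ifP => // _; rewrite lee_fin powR_ge0.
- by move=> n; apply/(measurable_restrictT _ mT); apply: measurable_funTS; exact: mhnq.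
move=> x c; rewrite /patch; case: ifPn => xT; last by move=> c0; exists 0%N => N _; exact: ltW.
have := h0 x; case hx : (h x) => [r||]//=; rewrite ?lee_fin => r0.
  move=> cr; exists (Num.truncn r).+1 => N rN.
  apply: ltW; apply: (lt_le_trans cr); rewrite lee_fin /hn hx -EFin_min/=.
  rewrite (min_idPl _)// (le_trans (ltW (truncnS_gt r)))// ler_nat.
  exact: leq_trans rN.
move=> _; exists (Num.truncn c).+1 => N cN.
have N1 : 1 <= N%:R :> R by rewrite ler1n (leq_trans _ cN).
rewrite /hn hx lee_fin min_r ?leey//=.
apply: (@le_trans _ _ N%:R); last by rewrite le1r_powR// ltW.
by rewrite (le_trans (ltW (truncnS_gt c)))// ler_nat.
Qed.

End Duality.

(** * Sums over sparse families *)

Lemma powR_sumr {R : realType} (m : nat) (M : R) (a : 'I_m -> R) : 0 < M ->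
  \prod_(i < m) M `^ a i = M `^ (\sum_(i < m) a i).
Proof.
move=> M0; apply: (big_ind2 (fun x y => x = M `^ y)) => //.
  by rewrite powRr0.
by move=> x y x' y' -> ->; rewrite powRD// (gt_eqF M0) implybT.
Qed.

(** Each [A i] is at most [M `^ (p i)^-1] with [M] the sum on the right, and the
    exponents [(p i)^-1] add up to [pbar^-1]. *)
Lemma prod_powR_le_sum {R : realType} (m : nat) (p A : 'I_m -> R) (pbar : R) :
  (0 < m)%N -> 0 < pbar -> (forall i, 1 < p i) -> pbar^-1 = \sum_(i < m) (p i)^-1 ->
  (forall i, 0 <= A i) ->
  (\prod_(i < m) A i) `^ pbar <= \sum_(i < m) A i `^ p i.
Proof.
move=> m0 pb0 hp hpb A0; set M := \sum_(i < m) _.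
have p0 i : 0 < p i by rewrite (lt_trans ltr01).
have M0 : 0 <= M by apply: sumr_ge0 => i _; exact: powR_ge0.
have AM i : A i <= M `^ (p i)^-1.
  have -> : A i = (A i `^ p i) `^ (p i)^-1 by rewrite -powRrM divff ?gt_eqF// powRr1.
  apply: ge0_ler_powR; rewrite ?nnegrE ?powR_ge0 ?invr_ge0 ?(ltW (p0 i))//.
  by rewrite /M (bigD1 i)//= lerDl sumr_ge0// => k _; exact: powR_ge0.
have P0 : 0 <= \prod_(i < m) A i by apply: prodr_ge0.
have [M00|Mn0] := eqVneq M 0.
  have -> : \prod_(i < m) A i = 0.
    rewrite (bigD1 (Ordinal m0))//=.
    have := AM (Ordinal m0); rewrite M00 powR0; last by rewrite invr_neq0// gt_eqF.
    by move=> h; have -> : A (Ordinal m0) = 0; [apply/eqP; rewrite eq_le h A0|rewrite mul0r].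
  by rewrite powR0 ?M00// gt_eqF.
have {Mn0}Mp : 0 < M by rewrite lt_neqAle M0 andbT eq_sym.
have h : \prod_(i < m) A i <= M `^ pbar^-1.
  by rewrite hpb -powR_sumr//; apply: ler_prod => i _; rewrite A0 AM.
have -> : M = (M `^ pbar^-1) `^ pbar by rewrite -powRrM mulVf ?gt_eqF// powRr1.
by apply: ge0_ler_powR; rewrite ?nnegrE ?powR_ge0 ?(ltW pb0).
Qed.

Section SparseVolume.
Context {d : measure_display} {X : measurableType d} {R : realType}.
Variables (rho : X -> X -> R) (mu : {measure set X -> \bar R}).
Hypothesis hX : homogeneous_type rho mu.
Variables (kappa b : R).
Hypothesis kappa1 : 1 <= kappa.
Hypothesis tri : forall x y z, rho x y <= kappa * (rho x z + rho z y).
Hypothesis b1 : 1 < b.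

(** [sparse_orlicz] for the dilated balls of a stopping family, whose volumes are
    comparable to the measures of the disjoint sets [Es n]. *)
Lemma sparse_volume_sum (Phi : R -> R) (s E2 C0 : R) : young_function Phi -> 1 < s ->
  0 < E2 -> 1 <= E2 -> 0 <= C0 ->
  (\sum_(j <oo) (2 ^+ j * slope Phi j `^ (1 - s))%:E < +oo)%E ->
  exists2 C : R, 0 <= C &
  forall (o : X) (R0 : R) (F : set nat) (c : nat -> X) (j : nat -> nat)
    (Es : nat -> set X) (a : X -> R) (A : nat -> R),
  0 < R0 -> (forall n, F n -> qball rho o R0 (c n)) ->
  (forall n, F n -> measurable (Es n) /\ Es n `<=` qball rho (c n) (grid b R0 (j n))) ->
  trivIset F Es ->
  (forall n, F n -> ((vol rho mu (c n) (E2 * grid b R0 (j n)))%:E <= C0%:E * mu (Es n))%E) ->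
  measurable_fun [set: X] a -> (forall x, 0 <= a x) ->
  (\int[mu]_x (a x `^ s)%:E <= 1)%E -> (forall n, 0 <= A n) ->
  (forall n, F n -> carleson rho mu Phi a (c n) (E2 * grid b R0 (j n)) (A n)) ->
  (\sum_(n <oo | n \in F) (vol rho mu (c n) (E2 * grid b R0 (j n)) * A n `^ s)%:E <= C%:E)%E.
Proof.
move=> hPhi s1 E20 E21 C00 tl.
have [C hC0 hC] := sparse_orlicz hX kappa1 tri hPhi s1 tl.
exists (C0 * C); first exact: mulr_ge0.
move=> o R0 F c j Es a A R00 oc hE tE hV ma a0 na A0 hA.
have g0 k : 0 < grid b R0 k by exact: grid_gt0.
pose T := qball rho o (kappa * (R0 + R0)).
have := hC (fun k => E2 * grid b R0 k) c j F Es T a A.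
have rad0 n : 0 < E2 * grid b R0 n by rewrite mulr_gt0.
have radS n k : (n <= k)%N -> E2 * grid b R0 k <= E2 * grid b R0 n.
  by move=> nk; rewrite ler_pM2l// grid_le.
have fT : (mu T < +oo)%E by rewrite (mu_qballE hX) ltry.
have ET n : F n -> Es n `<=` qball rho (c n) (E2 * grid b R0 (j n)) `&` T.
  move=> Fn y /(hE n Fn).2 By; split.
    by move: By; apply: qball_mono; rewrite ler_peMl// ltW.
  rewrite /T /qball/=; apply: (le_lt_trans (tri o y (c n))).
  have k0 : 0 < kappa by exact: lt_le_trans kappa1.
  rewrite ltr_pM2l// ltrD//; first exact: oc.
  apply: (lt_le_trans By); rewrite -[leRHS](grid0 b R0); exact: grid_le.
move=> /(_ rad0 radS (measurable_qball hX _ _) fT (fun n Fn => (hE n Fn).1) ET tE ma a0 A0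
  (fun n la Fn => (hA n Fn).2 la)) h.
apply: (@le_trans _ _ (C0%:E * \sum_(n <oo | n \in F) mu (Es n) * (A n `^ s)%:E)%E).
  rewrite -nneseriesZl; last by move=> n _; rewrite mule_ge0// lee_fin powR_ge0.
  apply: lee_nneseries => [n _ nF|n nF].
    by rewrite lee_fin mulr_ge0 ?powR_ge0// ltW// (vol_gt0 hX).
  rewrite EFinM muleA; apply: lee_wpmul2r; first by rewrite lee_fin powR_ge0.
  exact/hV/set_mem.
rewrite EFinM; apply: lee_wpmul2l; first by rewrite lee_fin.
apply: (le_trans h); rewrite -[leRHS]mule1; apply: lee_wpmul2l => //.
Qed.

End SparseVolume.

Section SparseMajorant.
Context {d : measure_display} {X : measurableType d} {R : realType}.
Variables (rho : X -> X -> R) (mu : {measure set X -> \bar R}).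
Hypothesis hX : homogeneous_type rho mu.
Variables (kappa b : R).
Hypothesis kappa1 : 1 <= kappa.
Hypothesis tri : forall x y z, rho x y <= kappa * (rho x z + rho z y).
Hypothesis b1 : 1 < b.
Variables (m : nat) (m0 : (0 < m)%N).
Variables (eps CL : R).
Hypotheses (eps0 : 0 < eps) (CL0 : 0 <= CL).

Let E2 := outer_dil kappa.

Lemma outer_dil_ge1 : 1 <= E2.
Proof.
by have := inner_le_outer kappa1; have := inner_dil_ge3 kappa1; rewrite /E2; lra.
Qed.

Lemma dil_grid_gt0 R0 n : 0 < R0 -> 0 < E2 * grid b R0 n.
Proof. by move=> R00; rewrite mulr_gt0 ?grid_gt0// (lt_le_trans _ outer_dil_ge1). Qed.

(** What the estimates for the stopping balls keep of their construction: disjoint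
    parts [Es n] that carry a fixed fraction of the volume of the dilated balls. *)
Definition sparse_family (C0 : R) (o : X) (R0 : R) (F : set nat) (c : nat -> X)
    (j : nat -> nat) (Es : nat -> set X) : Prop :=
  [/\ forall n, F n -> qball rho o R0 (c n),
    forall n, F n -> measurable (Es n) /\ Es n `<=` qball rho (c n) (grid b R0 (j n)),
    trivIset F Es &
    forall n, F n -> ((vol rho mu (c n) (E2 * grid b R0 (j n)))%:E <= C0%:E * mu (Es n))%E].

(** The sum over all scales at [x], which depends on [x] through the balls centred at
    [x], is replaced by a sum of constants over a fixed countable family of balls. *)
Lemma sparse_majorant : exists2 C : R, 1 <= C &
  forall (f : 'I_m -> X -> R) (o : X) (R0 : R) (Lam : X -> R -> R), 0 < R0 ->
  (forall i, bounded_nonneg (f i)) ->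
  (forall y r, 0 < r -> 0 <= Lam y r) ->
  (forall y y' r r', 0 < r' -> r' <= r -> r <= E2 * R0 ->
     qball rho y' r' `<=` qball rho y r -> Lam y' r' <= CL * (r' / r) `^ eps * Lam y r) ->
  exists (F : set nat) (c : nat -> X) (j : nat -> nat) (Es : nat -> set X) (t : nat -> R),
  [/\ sparse_family C o R0 F c j Es,
     forall n, 0 <= t n,
     forall n, F n -> t n <= C * (Lam (c n) (E2 * grid b R0 (j n)) *
       prodavg rho mu f (c n) (E2 * grid b R0 (j n))) &
     forall x, qball rho o R0 x ->
      (\sum_(k <oo) (Lam x (grid b R0 k) * prodavg rho mu f x (grid b R0 k))%:E <=
       \sum_(n <oo | n \in F) (t n * \1_(qball rho (c n) (E2 * grid b R0 (j n))) x)%:E)%E].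
Proof.
have [C0 C01 hstop] := stopping_family hX kappa1 tri b1 m0.
have C00 : 0 <= C0 by rewrite (le_trans ler01).
have [C1 C10 hdom] := @sparse_domination _ _ _ _ _ hX _ _ kappa1 b1 m _ _ eps0 CL0 C0 C00.
exists (C0 + C1 * C0); first by rewrite (le_trans C01)// lerDl mulr_ge0.
move=> f o R0 Lam R00 bf Lam0 hLam.
have [F [c [j [lam [Es [hlam hE tE hV hcov]]]]]] := hstop f o R0 R00 bf.
have lam0 n : F n -> 0 <= lam n by move=> /hlam[].
have L0 n : 0 <= Lam (c n) (E2 * grid b R0 (j n)) by rewrite Lam0// dil_grid_gt0.
exists F, c, j, Es, (fun n => if n \in F then C1 * (lam n * Lam (c n) (E2 * grid b R0 (j n))) else 0).
split.
- split => //; first by move=> n /hlam[].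
  move=> n Fn; apply: (le_trans (hV n Fn)); apply: lee_wpmul2r => //.
  by rewrite lee_fin lerDl mulr_ge0.
- by move=> n; case: ifPn => // /set_mem Fn; rewrite !mulr_ge0// lam0.
- move=> n Fn; rewrite mem_set//.
  have [_ _ hl] := hlam n Fn.
  set L := Lam _ _ in L0 *; set G := prodavg _ _ _ _ _ in hl *.
  have G0 : 0 <= G by rewrite (prodavg_ge0 hX)// dil_grid_gt0.
  have L0n : 0 <= L := L0 n.
  apply: (@le_trans _ _ (C1 * (C0 * G * L))).
    by rewrite ler_wpM2l// ler_wpM2r.
  rewrite [leRHS](_ : _ = C0 * (L * G) + C1 * (C0 * G * L)); last by ring.
  by rewrite lerDr !mulr_ge0.
- move=> x ox; apply: (le_trans (hdom f R0 Lam F c j lam x R00 bf Lam0 hLam lam0 _)).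
    by move=> k; exact: hcov.
  rewrite -nneseriesZl; last first.
    by move=> n /set_mem Fn; rewrite lee_fin !mulr_ge0 ?lam0// L0.
  apply: lee_nneseries => [n _ /set_mem Fn|n nF].
    by rewrite mule_ge0// lee_fin !mulr_ge0 ?lam0// L0.
  by rewrite nF -EFinM lee_fin !mulrA.
Qed.

Lemma measurable_sparse_sum (F : set nat) (c : nat -> X) (r t : nat -> R) :
  (forall n, 0 <= t n) ->
  measurable_fun [set: X] (fun x => \sum_(n <oo | n \in F) (t n * \1_(qball rho (c n) (r n)) x)%:E)%E.
Proof.
move=> t0; apply: (@ge0_emeasurable_sum _ _ _ _
  (fun n x => (t n * \1_(qball rho (c n) (r n)) x)%:E) (fun n => n \in F)).
  by move=> n x _ _; rewrite lee_fin mulr_ge0.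
move=> n _; apply/measurable_EFinP; apply: measurable_funM => //.
by apply: measurable_indic; exact: (measurable_qball hX).
Qed.

Lemma integral_sparse_sum (F : set nat) (c : nat -> X) (r t : nat -> R) (g : X -> R) :
  (forall n, 0 <= t n) -> measurable_fun [set: X] g -> (forall x, 0 <= g x) ->
  (\int[mu]_x ((\sum_(n <oo | n \in F) (t n * \1_(qball rho (c n) (r n)) x)%:E) * (g x)%:E) =
   \sum_(n <oo | n \in F) ((t n)%:E * \int[mu]_(x in qball rho (c n) (r n)) (g x)%:E))%E.
Proof.
move=> t0 mg g0.
pose B n := qball rho (c n) (r n).
have mB n : measurable (B n) by exact: (measurable_qball hX).
have meg : measurable_fun [set: X] (fun x => (g x)%:E) by exact/measurable_EFinP.
have mr n : measurable_fun [set: X] ((fun x => (g x)%:E) \_ (B n)).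
  by apply/(measurable_restrictT _ (mB n)); exact: measurable_funTS.
have r0 n x : (0 <= ((fun x => (g x)%:E) \_ (B n)) x)%E.
  by rewrite /patch; case: ifP => // _; rewrite lee_fin.
pose h n x := (if n \in F then (t n)%:E * ((fun x => (g x)%:E) \_ (B n)) x else 0)%E.
transitivity (\int[mu]_x \sum_(n <oo) h n x)%E.
  apply: eq_integral => x _; rewrite muleC -nneseriesZl; last first.
    by move=> n _; rewrite lee_fin mulr_ge0.
  rewrite eseries_mkcond; apply: eq_eseriesr => n _; rewrite /h; case: ifP => // _.
  rewrite /patch indicE; case: ifP => _ /=; last by rewrite mulr0 !mule0.
  by rewrite mulr1 muleC.
rewrite integral_nneseries//; first last.
- by move=> n x _; rewrite /h; case: ifP => // _; rewrite mule_ge0// lee_fin.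
- by move=> n; rewrite /h; case: (n \in F) => //; exact: measurable_funeM.
rewrite [RHS]eseries_mkcond; apply: eq_eseriesr => n _; rewrite /h; case: ifP => _; last first.
  by rewrite integral0.
by rewrite ge0_integralZl_EFin// -integral_mkcond.
Qed.

End SparseMajorant.

(** * Weighted inequality for the sum over scales *)

Section DyadicBound.
Context {d : measure_display} {X : measurableType d} {R : realType}.
Variables (rho : X -> X -> R) (mu : {measure set X -> \bar R}).
Hypothesis hX : homogeneous_type rho mu.
Variables (kappa b : R).
Hypothesis kappa1 : 1 <= kappa.
Hypothesis tri : forall x y z, rho x y <= kappa * (rho x z + rho z y).
Hypothesis b1 : 1 < b.
Variables (m : nat) (p : 'I_m -> R) (pbar q : R).
Hypotheses (m0 : (0 < m)%N) (hp : forall i, 1 < p i)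
  (hpbar : pbar^-1 = \sum_(i < m) (p i)^-1) (pbar0 : 0 < pbar) (pq : pbar <= q).
Variables (Phi : 'I_m -> R -> R) (Psi : R -> R) (v : 'I_m -> X -> R) (u : X -> R).
Hypotheses (hPhi : forall i, young_function (Phi i)) (hPsi : 1 < q -> young_function Psi).
Hypotheses (hv : forall i, weight (v i)) (hu : weight u).
Hypothesis tailPhi : forall i,
  (\sum_(j <oo) (2 ^+ j * slope (Phi i) j `^ (1 - p i))%:E < +oo)%E.
Hypothesis tailPsi : 1 < q ->
  (\sum_(j <oo) (2 ^+ j * slope Psi j `^ (1 - conj_exp q))%:E < +oo)%E.
Variables (eps CL bnd : R).
Hypotheses (eps0 : 0 < eps) (CL0 : 0 <= CL) (bnd0 : 0 <= bnd).

Let E2 := outer_dil kappa.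
Let e : R := q^-1 + \sum_(i < m) (conj_exp (p i))^-1.
Let q0 : 0 < q. Proof. exact: lt_le_trans pq. Qed.

Lemma exponentE : m%:R - e + q^-1 = pbar^-1.
Proof.
have -> : e = q^-1 + (m%:R - pbar^-1).
  rewrite /e hpbar; congr (_ + _).
  rewrite (eq_bigr (fun i => 1 - (p i)^-1)); last first.
    move=> i _; have := hp i => pi1; rewrite /conj_exp.
    by field; rewrite gt_eqF//= ?subr_eq0 ?gt_eqF// (lt_trans ltr01).
  by rewrite sumrB sumr_const card_ord.
ring.
Qed.

Lemma exponentE1 : m%:R - e + 1 = pbar^-1 + (1 - q^-1).
Proof. by rewrite -exponentE; ring. Qed.

Let E21 : 1 <= E2. Proof. exact: outer_dil_ge1. Qed.
Let E20 : 0 < E2. Proof. exact: lt_le_trans E21. Qed.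

(** With [n]-th term [V `^ pbar^-1 * \prod_i A n i], the inequality between [l^pbar]
    and [l^q] norms reduces to the exponent [pbar <= q]; there the product is
    bounded by the sum of the [A n i `^ p i], and each of the m sums by
    [sparse_volume_sum]. *)
Lemma sparse_lq_sum (C0 : R) : 0 <= C0 -> exists2 C : R, 0 <= C &
  forall (o : X) (R0 : R) (f : 'I_m -> X -> R) (F : set nat) (c : nat -> X)
    (j : nat -> nat) (Es : nat -> set X) (A : nat -> 'I_m -> R),
  0 < R0 -> (forall i, bounded_nonneg (f i)) ->
  (forall i, (\int[mu]_x ((f i x * v i x) `^ p i)%:E <= 1)%E) ->
  sparse_family rho mu kappa b C0 o R0 F c j Es ->
  (forall n i, 0 <= A n i) ->
  (forall n, F n -> forall i, carleson rho mu (Phi i) (fun y => f i y * v i y) (c n)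
        (E2 * grid b R0 (j n)) (A n i)) ->
  (\sum_(n <oo | n \in F) ((vol rho mu (c n) (E2 * grid b R0 (j n)) `^ pbar^-1 *
        \prod_(i < m) A n i) `^ q)%:E <= C%:E)%E.
Proof.
move=> C00.
have /choice[Ci hCi] : forall i, exists C : R, 0 <= C /\ _ :=
  fun i => let: ex_intro2 C C0 H := sparse_volume_sum hX kappa1 tri b1 (hPhi i) (hp i)
    E20 E21 C00 (tailPhi i) in ex_intro _ C (conj C0 H).
pose K := \sum_(i < m) Ci i.
have K0 : 0 <= K by rewrite sumr_ge0// => i _; case: (hCi i).
exists (K `^ ((q - pbar) / pbar) * K); first by rewrite mulr_ge0// powR_ge0.
move=> o R0 f F c j Es A R00 bf nf [oc hE tE hV] A0 hA.
have V0 n : 0 < vol rho mu (c n) (E2 * grid b R0 (j n)).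
  by apply: (vol_gt0 hX); exact: dil_grid_gt0.
apply: lp_le_lq => //.
  by move=> n _; rewrite mulr_ge0 ?powR_ge0// prodr_ge0.
apply: (@le_trans _ _ (\sum_(n <oo | n \in F) \sum_(i < m)
   (vol rho mu (c n) (E2 * grid b R0 (j n)) * A n i `^ p i)%:E)%E).
  apply: lee_nneseries => [n _ _|n _]; first by rewrite lee_fin powR_ge0.
  rewrite sumEFin lee_fin -mulr_sumr powRM ?powR_ge0 ?prodr_ge0//.
  rewrite -powRrM mulVf ?gt_eqF// powRr1 ?(ltW (V0 n))// ler_pM2l//.
  exact: prod_powR_le_sum.
rewrite eseries_mkcond (eq_eseriesr (g := fun n => (\sum_(i < m) if n \in F then
   (vol rho mu (c n) (E2 * grid b R0 (j n)) * A n i `^ p i)%:E else 0)%E)); last first.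
  by move=> n _; case: ifP => // _; rewrite big1.
rewrite nneseries_sum; last first.
  by move=> i n _; case: ifP => // _; rewrite lee_fin mulr_ge0 ?powR_ge0// ltW.
rewrite -sumEFin; apply: lee_sum => i _; rewrite -eseries_mkcond.
have [_ /(_ o R0 F c j Es (fun y => f i y * v i y) (fun n => A n i))] := hCi i.
have [mf f0 _] := bf i; have [mv v0] := hv i.
apply => //.
- exact: measurable_funM.
- by move=> y; rewrite mulr_ge0.
- by move=> n Fn; exact: hA.
Qed.

(** The weighted inequality for the sum over scales that dominates the potential, on
    a ball and for normalized bounded functions. The function [H] is the sparse
    majorant; it is measurable, while the sum itself need not be. For [q <= 1] the
    power [q] is distributed over the sparse sum, and each ball is handled by
    [ball_estimate_le1]. The exponents of the volumes combine to [pbar^-1]. *)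
Theorem dyadic_bound_le1 : q <= 1 -> exists2 C : R, 0 <= C &
  forall (Pf : X -> R -> R) (o : X) (R0 : R) (f : 'I_m -> X -> R),
  0 < R0 -> (forall i, bounded_nonneg (f i)) ->
  (forall i, (\int[mu]_x ((f i x * v i x) `^ p i)%:E <= 1)%E) ->
  (forall y r, 0 < r -> 0 <= Pf y r) ->
  (forall y y' r r', 0 < r' -> r' <= r -> r <= E2 * R0 -> qball rho y' r' `<=` qball rho y r ->
     Pf y' r' * vol rho mu y' r' ^+ m <= CL * (r' / r) `^ eps * (Pf y r * vol rho mu y r ^+ m)) ->
  (forall x r, 0 < r -> r <= E2 * R0 -> ((Pf x r)%:E * (mu (qball rho x r) `^ e) *
      ((average rho mu x r (fun y => (u y `^ q)%:E)) `^ q^-1) *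
      \prod_(i < m) orlicz_norm rho mu (Phi i) x r (fun y => ((v i y)%:E)^-1) <= bnd%:E)%E) ->
  exists H : X -> \bar R, [/\ measurable_fun [set: X] H, (forall x, 0 <= H x)%E,
    forall x, qball rho o R0 x ->
      (\sum_(k <oo) (Pf x (grid b R0 k) * vol rho mu x (grid b R0 k) ^+ m *
        prodavg rho mu f x (grid b R0 k))%:E <= H x)%E &
    (\int[mu]_(x in qball rho o R0) ((H x * (u x)%:E) `^ q) <= C%:E)%E].
Proof.
move=> q1.
have [C0 C01 hmaj] := sparse_majorant hX kappa1 tri b1 m0 eps0 CL0.
have C00 : 0 <= C0 by rewrite (le_trans ler01).
have [KX KX0 hKX] := sparse_lq_sum C00.
have [mu_ u0] := hu.
exists ((C0 * (2 ^+ m * bnd)) `^ q * KX); first by rewrite mulr_ge0// powR_ge0.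
move=> Pf o R0 f R00 bf nf Pf0 hdec hbump.
have Lam0 y r : 0 < r -> 0 <= Pf y r * vol rho mu y r ^+ m.
  by move=> r0; rewrite mulr_ge0 ?Pf0// exprn_ge0// ltW// (vol_gt0 hX).
have [F [c [j [Es [t [hsp t0 ht hcov]]]]]] := hmaj f o R0 _ R00 bf Lam0 hdec.
have rad0 n : 0 < E2 * grid b R0 n by exact: dil_grid_gt0.
have radle n : E2 * grid b R0 n <= E2 * R0.
  by rewrite ler_pM2l// -[leRHS](grid0 b R0) grid_le.
pose H x : \bar R := (\sum_(n <oo | n \in F) (t n * \1_(qball rho (c n) (E2 * grid b R0 (j n))) x)%:E)%E.
have mH : measurable_fun [set: X] H by exact: (measurable_sparse_sum hX).
have H0 x : (0 <= H x)%E by apply: nneseries_ge0 => n _ _; rewrite lee_fin mulr_ge0.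
exists H; split => //.
pose V n := vol rho mu (c n) (E2 * grid b R0 (j n)).
have /choice[A hA] : forall n, exists A : 'I_m -> R, (forall i, 0 <= A i) /\ (F n ->
    (forall i, carleson rho mu (Phi i) (fun y => f i y * v i y) (c n) (E2 * grid b R0 (j n)) (A i)) /\
    ((((Pf (c n) (E2 * grid b R0 (j n)) * V n ^+ m *
        prodavg rho mu f (c n) (E2 * grid b R0 (j n))) `^ q)%:E *
      \int[mu]_(y in qball rho (c n) (E2 * grid b R0 (j n))) (u y `^ q)%:E <=
     ((2 ^+ m * bnd * V n `^ (m%:R - e + q^-1) * \prod_(i < m) A i) `^ q)%:E)%E)).
  move=> n; have hb := hbump (c n) _ (rad0 (j n)) (radle (j n)).
  have [A [hA hest]] := ball_estimate_le1 hX hPhi hv q0 (rad0 (j n)) (Pf0 _ _ (rad0 _)) bnd0 bf hb.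
  by exists A; split; [move=> i; have [] := hA i|].
have Xs := hKX o R0 f F c j Es A R00 bf nf hsp (fun n => (hA n).1) (fun n Fn => ((hA n).2 Fn).1).
have muq : measurable_fun [set: X] (fun x => u x `^ q).
  exact: (measurableT_comp (measurable_powR q) mu_).
apply: (@le_trans _ _ (\int[mu]_x ((\sum_(n <oo | n \in F)
    (t n `^ q * \1_(qball rho (c n) (E2 * grid b R0 (j n))) x)%:E) * (u x `^ q)%:E))%E).
  rewrite integral_mkcond; apply: le_lower_integral => x _.
    by rewrite /patch; case: ifP => // _; exact: poweR_ge0.
  have S0 : (0 <= (\sum_(n <oo | n \in F)
      (t n `^ q * \1_(qball rho (c n) (E2 * grid b R0 (j n))) x)%:E))%E.
    by apply: nneseries_ge0 => n _ _; rewrite lee_fin mulr_ge0// powR_ge0.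
  rewrite /patch; case: ifP => [_|_]; last by rewrite mule_ge0// lee_fin powR_ge0.
  rewrite poweRM// ?lee_fin// poweR_EFin.
  apply: lee_wpmul2r; first by rewrite lee_fin powR_ge0.
  apply: (le_trans (series_poweR_le q0 q1 _)).
    by move=> n _; rewrite mulr_ge0.
  apply: lee_nneseries => [n _ _|n _]; first by rewrite lee_fin powR_ge0.
  rewrite lee_fin indicE; case: (boolP (x \in _)) => _ /=; first by rewrite !mulr1.
  by rewrite !mulr0 powR0 ?gt_eqF.
rewrite (integral_sparse_sum hX)//; [|by move=> n; exact: powR_ge0|by move=> x; exact: powR_ge0].
apply: (@le_trans _ _ (\sum_(n <oo | n \in F) (((C0 * (2 ^+ m * bnd)) `^ q)%:E *
   ((V n `^ pbar^-1 * \prod_(i < m) A n i) `^ q)%:E))%E); last first.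
  rewrite nneseriesZl; last by move=> n _; rewrite lee_fin powR_ge0.
  by rewrite EFinM; apply: lee_wpmul2l => //; rewrite lee_fin powR_ge0.
apply: lee_nneseries => [n _ _|n nF].
  rewrite mule_ge0 ?lee_fin ?powR_ge0//.
  by apply: integral_ge0 => x _; rewrite lee_fin powR_ge0.
have Fn := set_mem nF.
have [_ est] := (hA n).2 Fn.
have G0 : 0 <= Pf (c n) (E2 * grid b R0 (j n)) * V n ^+ m *
        prodavg rho mu f (c n) (E2 * grid b R0 (j n)).
  by rewrite mulr_ge0 ?Lam0// (prodavg_ge0 hX).
have A0 : 0 <= \prod_(i < m) A n i by apply: prodr_ge0 => i _; exact: (hA n).1.
apply: (@le_trans _ _ ((C0 `^ q)%:E * (((Pf (c n) (E2 * grid b R0 (j n)) * V n ^+ m *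
        prodavg rho mu f (c n) (E2 * grid b R0 (j n))) `^ q)%:E *
      \int[mu]_(y in qball rho (c n) (E2 * grid b R0 (j n))) (u y `^ q)%:E))%E).
  rewrite muleA -EFinM -powRM//; apply: lee_wpmul2r.
    by apply: integral_ge0 => x _; rewrite lee_fin powR_ge0.
  have CG0 := mulr_ge0 C00 G0.
  rewrite lee_fin; apply: ge0_ler_powR; rewrite ?nnegrE ?(ltW q0)//.
  exact: ht n Fn.
apply: (le_trans (lee_wpmul2l _ est)); first by rewrite lee_fin powR_ge0.
rewrite exponentE -!EFinM lee_fin -!powRM ?mulr_ge0 ?exprn_ge0 ?powR_ge0//.
by rewrite !mulrA.
Qed.

(** For [q > 1] the sparse majorant is tested against [g] in the dual space. The n-th
    term is at most [X * Y], with [X] the product of the conjugate averages of the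
    [f i * v i] and [Y] that of [g], each with its share of the volume; then
    [X * Y <= X `^ q + Y `^ conj_exp q], and both sums are Carleson sums. *)
Theorem dyadic_bound_gt1 : 1 < q -> exists2 C : R, 0 <= C &
  forall (Pf : X -> R -> R) (o : X) (R0 : R) (f : 'I_m -> X -> R),
  0 < R0 -> (forall i, bounded_nonneg (f i)) ->
  (forall i, (\int[mu]_x ((f i x * v i x) `^ p i)%:E <= 1)%E) ->
  (forall y r, 0 < r -> 0 <= Pf y r) ->
  (forall y y' r r', 0 < r' -> r' <= r -> r <= E2 * R0 -> qball rho y' r' `<=` qball rho y r ->
     Pf y' r' * vol rho mu y' r' ^+ m <= CL * (r' / r) `^ eps * (Pf y r * vol rho mu y r ^+ m)) ->
  (forall x r, 0 < r -> r <= E2 * R0 -> ((Pf x r)%:E * (mu (qball rho x r) `^ e) *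
      orlicz_norm rho mu Psi x r (EFin \o u) *
      \prod_(i < m) orlicz_norm rho mu (Phi i) x r (fun y => ((v i y)%:E)^-1) <= bnd%:E)%E) ->
  exists H : X -> \bar R, [/\ measurable_fun [set: X] H, (forall x, 0 <= H x)%E,
    forall x, qball rho o R0 x ->
      (\sum_(k <oo) (Pf x (grid b R0 k) * vol rho mu x (grid b R0 k) ^+ m *
        prodavg rho mu f x (grid b R0 k))%:E <= H x)%E &
    (\int[mu]_(x in qball rho o R0) ((H x * (u x)%:E) `^ q) <= C%:E)%E].
Proof.
move=> q1.
have [C0 C01 hmaj] := sparse_majorant hX kappa1 tri b1 m0 eps0 CL0.
have C00 : 0 <= C0 by rewrite (le_trans ler01).
have [KX KX0 hKX] := sparse_lq_sum C00.
have [mu_ u0] := hu.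
have q'1 : 1 < conj_exp q.
  by rewrite /conj_exp ltr_pdivlMr ?subr_gt0// mul1r gtrBl.
have q'E : (conj_exp q)^-1 = 1 - q^-1.
  by rewrite /conj_exp; field; rewrite gt_eqF//= subr_eq0 gt_eqF.
have q'0 : 0 < conj_exp q by rewrite (lt_trans ltr01).
have [KY KY0 hKY] := sparse_volume_sum hX kappa1 tri b1 (hPsi q1) q'1 E20 E21 C00 (tailPsi q1).
(* KX and KY bound the Carleson sums of the f i and of g *)
pose Cd := C0 * (2 ^+ m.+1 * bnd) * (KX + KY).
have Cd0 : 0 <= Cd by rewrite !mulr_ge0 ?exprn_ge0// addr_ge0.
exists (Cd `^ q); first exact: powR_ge0.
move=> Pf o R0 f R00 bf nf Pf0 hdec hbump.
have Lam0 y r : 0 < r -> 0 <= Pf y r * vol rho mu y r ^+ m.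
  by move=> r0; rewrite mulr_ge0 ?Pf0// exprn_ge0// ltW// (vol_gt0 hX).
have [F [c [j [Es [t [hsp t0 ht hcov]]]]]] := hmaj f o R0 _ R00 bf Lam0 hdec.
have rad0 n : 0 < E2 * grid b R0 n by exact: dil_grid_gt0.
have radle n : E2 * grid b R0 n <= E2 * R0.
  by rewrite ler_pM2l// -[leRHS](grid0 b R0) grid_le.
pose H x : \bar R := (\sum_(n <oo | n \in F) (t n * \1_(qball rho (c n) (E2 * grid b R0 (j n))) x)%:E)%E.
have mH : measurable_fun [set: X] H by exact: (measurable_sparse_sum hX).
have H0 x : (0 <= H x)%E by apply: nneseries_ge0 => n _ _; rewrite lee_fin mulr_ge0.
exists H; split => //.
pose V n := vol rho mu (c n) (E2 * grid b R0 (j n)).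
apply: duality_bound => //.
- exact: (measurable_qball hX).
- by rewrite (mu_qballE hX) ltry.
- by apply: emeasurable_funM => //; exact/measurable_EFinP.
- by move=> x; rewrite mule_ge0// lee_fin.
move=> g bg ng; have [mg g0 _] := bg.
have /choice[AB hAB] : forall n, exists AB : ('I_m -> R) * R, ((forall i, 0 <= AB.1 i) /\ 0 <= AB.2) /\ (F n ->
    [/\ forall i, carleson rho mu (Phi i) (fun y => f i y * v i y) (c n) (E2 * grid b R0 (j n)) (AB.1 i),
        carleson rho mu Psi g (c n) (E2 * grid b R0 (j n)) AB.2 &
    ((Pf (c n) (E2 * grid b R0 (j n)) * V n ^+ m *
        prodavg rho mu f (c n) (E2 * grid b R0 (j n)))%:E *
      \int[mu]_(y in qball rho (c n) (E2 * grid b R0 (j n))) (u y * g y)%:E <=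
     (2 ^+ m.+1 * bnd * V n `^ (m%:R - e + 1) * \prod_(i < m) AB.1 i * AB.2)%:E)%E]).
  move=> n; have hb := hbump (c n) _ (rad0 (j n)) (radle (j n)).
  have [A [B [hA hB hest]]] := ball_estimate_gt1 hX hPhi hv hu (hPsi q1) (rad0 (j n))
    (Pf0 _ _ (rad0 _)) bnd0 bf bg hb.
  by exists (A, B); split; [split; [move=> i; have [] := hA i|have [] := hB]|].
have Xs := hKX o R0 f F c j Es (fun n => (AB n).1) R00 bf nf hsp (fun n => (hAB n).1.1)
  (fun n Fn => let: And3 h _ _ := (hAB n).2 Fn in h).
have Ys : (\sum_(n <oo | n \in F) (V n * (AB n).2 `^ conj_exp q)%:E <= KY%:E)%E.
  have [oc hE tE hV] := hsp.
  apply: (hKY o R0 F c j Es g (fun n => (AB n).2)) => //; first by move=> n; exact: (hAB n).1.2.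
  by move=> n Fn; have [] := (hAB n).2 Fn.
have ug0 x : 0 <= u x * g x by rewrite mulr_ge0.
have V0 n : 0 < V n by apply: (vol_gt0 hX).
apply: (@le_trans _ _ (\int[mu]_x (H x * (u x * g x)%:E))%E).
  rewrite integral_mkcond; apply: le_lower_integral => x _.
    by rewrite /patch; case: ifP => // _; rewrite mule_ge0 ?lee_fin// mule_ge0// lee_fin.
  rewrite /patch; case: ifP => _; first by rewrite EFinM muleA.
  by rewrite mule_ge0// lee_fin.
rewrite (integral_sparse_sum hX)//; last exact: measurable_funM.
pose Z n : \bar R := (((V n `^ pbar^-1 * \prod_(i < m) (AB n).1 i) `^ q)%:E +
   (V n * (AB n).2 `^ conj_exp q)%:E)%E.
apply: (@le_trans _ _ (\sum_(n <oo | n \in F) ((C0 * (2 ^+ m.+1 * bnd))%:E * Z n))%E); last first.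
  rewrite nneseriesZl; last by move=> n _; rewrite adde_ge0 ?lee_fin ?powR_ge0// mulr_ge0 ?powR_ge0// ltW.
  rewrite /Cd [leRHS]EFinM; apply: lee_wpmul2l; first by rewrite lee_fin !mulr_ge0// exprn_ge0.
  rewrite nneseriesD//.
  - by rewrite EFinD; exact: leeD.
  - by move=> n _ _; rewrite lee_fin powR_ge0.
  - by move=> n _ _; rewrite lee_fin mulr_ge0 ?powR_ge0// ltW.
apply: lee_nneseries => [n _ _|n nF].
  by rewrite mule_ge0 ?lee_fin//; apply: integral_ge0 => x _; rewrite lee_fin.
have Fn := set_mem nF.
have [_ _ est] := (hAB n).2 Fn.
have [[A0 B0] _] := hAB n.
have P0 : 0 <= \prod_(i < m) (AB n).1 i by apply: prodr_ge0 => i _; exact: A0.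
apply: (@le_trans _ _ (C0%:E * ((Pf (c n) (E2 * grid b R0 (j n)) * V n ^+ m *
        prodavg rho mu f (c n) (E2 * grid b R0 (j n)))%:E *
      \int[mu]_(y in qball rho (c n) (E2 * grid b R0 (j n))) (u y * g y)%:E))%E).
  rewrite muleA -EFinM; apply: lee_wpmul2r.
    by apply: integral_ge0 => x _; rewrite lee_fin.
  by rewrite lee_fin; exact: ht.
apply: (le_trans (lee_wpmul2l _ est)); first by rewrite lee_fin.
rewrite -EFinM /Z -EFinD -EFinM lee_fin exponentE1 -q'E powRD; last first.
  by rewrite (gt_eqF (V0 n)) implybT.
set Xn := V n `^ pbar^-1 * _; set Pi := \prod_(i < m) _ in P0 *.
pose Yn := V n `^ (conj_exp q)^-1 * (AB n).2.
have X0 : 0 <= V n `^ pbar^-1 * Pi by rewrite mulr_ge0// powR_ge0.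
have Y0 : 0 <= Yn by rewrite mulr_ge0// powR_ge0.
have YE : Yn `^ conj_exp q = V n * (AB n).2 `^ conj_exp q.
  by rewrite powRM ?powR_ge0// -powRrM mulVf ?gt_eqF// powRr1// ltW.
have XY : (V n `^ pbar^-1 * Pi) * Yn <= (V n `^ pbar^-1 * Pi) `^ q + Yn `^ conj_exp q.
  apply: (le_trans (conjugate_powR X0 Y0 q0 q'0 _)); first by rewrite q'E; ring.
  by apply: lerD; rewrite ler_pdivrMr// ler_peMr ?powR_ge0// ltW.
rewrite -YE [leLHS](_ : _ = C0 * (2 ^+ m.+1 * bnd) * ((V n `^ pbar^-1 * Pi) * Yn)).
  by apply: ler_wpM2l => //; rewrite !mulr_ge0// exprn_ge0.
by rewrite /Xn /Yn; ring.
Qed.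

End DyadicBound.

(** * Growth of the kernel *)

Section RhoVec.
Context {d : measure_display} {X : measurableType d} {R : realType}.
Variables (rho : X -> X -> R) (mu : {measure set X -> \bar R}).
Hypothesis hX : homogeneous_type rho mu.
Variable kappa : R.
Hypothesis kappa1 : 1 <= kappa.
Hypothesis tri : forall x y z, rho x y <= kappa * (rho x z + rho z y).
Variable m : nat.
Implicit Types xs ys zs : m.-tuple X.

Let qm := ht_quasi_metric hX.

Lemma rho_vec_sym xs ys : rho_vec rho xs ys = rho_vec rho ys xs.
Proof. by apply: eq_bigr => i _; exact: (qm_sym qm). Qed.

Lemma rho_vec_tri xs ys zs :
  rho_vec rho xs ys <= kappa * (rho_vec rho xs zs + rho_vec rho zs ys).
Proof. by rewrite /rho_vec -big_split/= mulr_sumr; apply: ler_sum => i _; exact: tri. Qed.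

Lemma rho_vec_neq xs ys : 0 < rho_vec rho xs ys -> xs != ys.
Proof.
apply: contraTneq => ->; rewrite -leNgt /rho_vec big1// => i _.
exact: (rho_xx hX).
Qed.

Lemma rho_vec_ball x r xs ys : (forall i, qball rho x r (tnth xs i)) ->
  (forall i, qball rho x r (tnth ys i)) -> rho_vec rho xs ys <= 2 * kappa * m%:R * r.
Proof.
move=> hxs hys; have k0 : 0 < kappa by exact: lt_le_trans kappa1.
have -> : 2 * kappa * m%:R * r = \sum_(i < m) (kappa * (r + r)).
  by rewrite sumr_const card_ord -mulr_natr; ring.
apply: ler_sum => i _; apply: (le_trans (tri _ _ x)).
rewrite ler_pM2l// lerD ?(ltW (hys i))//.
by rewrite (qm_sym qm) ltW// hxs.
Qed.

Lemma tnth_diag x i : tnth (@diag_tuple d X m x) i = x.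
Proof. by rewrite (tnth_nth x) /= nth_nseq ltn_ord. Qed.

Variable K : m.-tuple X -> m.-tuple X -> \bar R.
Hypothesis hgrowth : growth_conditions rho K.

(** All values of the kernel at a given scale are comparable: [ys] cannot be
    close to both ends of a reference pair [xs0, ys0], and the growth conditions
    carry the value through the end that is far. *)
Lemma kernel_compare (c c' : R) : 0 < c -> 0 < c' -> exists2 C : R, 0 < C &
  forall x r xs ys xs0 ys0, 0 < r ->
  (forall i, qball rho x r (tnth xs i)) -> (forall i, qball rho x r (tnth ys i)) ->
  (forall i, qball rho x r (tnth xs0 i)) -> (forall i, qball rho x r (tnth ys0 i)) ->
  c * r <= rho_vec rho xs ys -> c' * r <= rho_vec rho xs0 ys0 ->
  (K xs ys <= C%:E * K xs0 ys0)%E.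
Proof.
move=> c0 c'0; have k0 : 0 < kappa by exact: lt_le_trans kappa1.
pose M := 2 * kappa * m%:R.
have M0 : 0 <= M by rewrite !mulr_ge0// ltW.
pose g := 2 + M / c + M * (2 * kappa) / c'.
have Mc0 : 0 <= M / c by rewrite divr_ge0// ltW.
have Mc'0 : 0 <= M * (2 * kappa) / c' by rewrite divr_ge0 ?mulr_ge0// ltW.
have [C C1 [grow1 grow2]] := hgrowth (c := g) ltac:(rewrite /g; lra).
have C0 : 0 < C by rewrite (lt_trans ltr01).
exists (C * C); first exact: mulr_gt0.
move=> x r xs ys xs0 ys0 r0 bxs bys bxs0 bys0 far far0.
have small (a e : m.-tuple X) : (forall i, qball rho x r (tnth a i)) -> (forall i, qball rho x r (tnth e i)) ->
    forall z w : m.-tuple X, c * r <= rho_vec rho z w -> rho_vec rho a e <= g * rho_vec rho z w.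
  move=> ba be z w zw; apply: (@le_trans _ _ (M * r)); first exact: rho_vec_ball ba be.
  apply: (@le_trans _ _ (M / c * (c * r))); first by rewrite mulrA divfK// gt_eqF.
  apply: ler_pM => //; first by rewrite mulr_ge0// ltW.
  by rewrite /g; lra.
have small' (a e : m.-tuple X) : (forall i, qball rho x r (tnth a i)) -> (forall i, qball rho x r (tnth e i)) ->
    forall z w : m.-tuple X, c' * r / (2 * kappa) <= rho_vec rho z w -> rho_vec rho a e <= g * rho_vec rho z w.
  move=> ba be z w zw; apply: (@le_trans _ _ (M * r)); first exact: rho_vec_ball ba be.
  apply: (@le_trans _ _ (M * (2 * kappa) / c' * (c' * r / (2 * kappa)))).
    by rewrite le_eqVlt; apply/orP; left; apply/eqP; field; rewrite !gt_eqF.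
  apply: ler_pM => //; first by rewrite divr_ge0 ?mulr_ge0// ltW.
  by rewrite /g; lra.
have d0 : 0 < c' * r / (2 * kappa) by rewrite divr_gt0 ?mulr_gt0.
have n0 : xs != ys by apply: rho_vec_neq; apply: lt_le_trans far; rewrite mulr_gt0.
have n00 : xs0 != ys0 by apply: rho_vec_neq; apply: lt_le_trans far0; rewrite mulr_gt0.
have two (A B D : \bar R) : (A <= C%:E * B)%E -> (B <= C%:E * D)%E -> (A <= (C * C)%:E * D)%E.
  move=> AB BD; apply: (le_trans AB); rewrite EFinM -muleA.
  by apply: lee_wpmul2l => //; rewrite lee_fin ltW.
have [A|B] := leP (c' * r / (2 * kappa)) (rho_vec rho ys ys0).
  have ny : ys != ys0 by apply: rho_vec_neq; exact: lt_le_trans A.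
  apply: (two _ (K ys ys0)).
    by apply: grow2 => //; exact: small.
  by apply: grow1 => //; exact: small'.
have {}B : c' * r / (2 * kappa) <= rho_vec rho ys xs0.
  have := le_trans far0 (rho_vec_tri xs0 ys0 ys); rewrite -ler_pdivrMl// => h.
  have e1 : kappa^-1 * (c' * r) = 2 * (c' * r / (2 * kappa)).
    by field; rewrite gt_eqF.
  by rewrite (rho_vec_sym xs0 ys) in h; move: h B; rewrite e1; lra.
have ny : ys != xs0 by apply: rho_vec_neq; exact: lt_le_trans B.
apply: (two _ (K ys xs0)).
  by apply: grow2 => //; exact: small.
by apply: grow2 => //; exact: small'.
Qed.

(** Together with the existence of one admissible pair in the ball, this makes [phi]
    finite and shows that its values for different constants are comparable. *)
Lemma phi_le (c c' : R) : 0 < c -> 0 < c' -> exists2 C : R, 0 < C &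
  forall x r z0 ys0, 0 < r ->
  qball rho x r z0 -> (forall i, qball rho x r (tnth ys0 i)) ->
  c' * r <= rho_vec rho (@diag_tuple d X m z0) ys0 ->
  (phi rho K c x r <= C%:E * K (@diag_tuple d X m z0) ys0)%E /\
  (phi rho K c x r <= C%:E * phi rho K c' x r)%E.
Proof.
move=> c0 c'0; have [C C0 hC] := kernel_compare c0 c'0.
exists C => // x r z0 ys0 r0 bz by0 far0.
have h : (phi rho K c x r <= C%:E * K (@diag_tuple d X m z0) ys0)%E.
  apply: ge_ereal_sup => _ [[z ys]/= [bz' by' far] <-].
  by apply: (hC x r) => // i; rewrite tnth_diag.
split => //; apply: (le_trans h); apply: lee_wpmul2l; first by rewrite lee_fin ltW.
by apply: ereal_sup_ubound; exists (z0, ys0).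
Qed.

End RhoVec.

(** * Capped radii and reverse doubling *)

Lemma powRV {R : realType} (a r : R) : 0 <= a -> a^-1 `^ r = (a `^ r)^-1.
Proof. by move=> a0; rewrite -[a^-1]powR_inv1// -powRrM mulN1r powRN. Qed.

Section Scale.
Context {d : measure_display} {X : measurableType d} {R : realType}.
Variables (rho : X -> X -> R) (mu : {measure set X -> \bar R}).
Hypothesis hX : homogeneous_type rho mu.
Hypothesis hdiam : (0 < qdiam rho)%E.
Variable eta : R.
Hypothesis heta : 1 < eta.

Let qm := ht_quasi_metric hX.
Let eta0 : 0 < eta. Proof. exact: lt_trans heta. Qed.
Let D : \bar R := (eta%:E * qdiam rho)%E.

(** Radii beyond [eta] times the diameter all describe the whole space; capping
    them there keeps the ball and stays in the range where [phi] is defined. *)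
Definition cap (r : R) : R := if (r%:E <= D)%E then r else fine D.

Lemma rho_le_diam x y : ((rho x y)%:E <= qdiam rho)%E.
Proof. by apply: ereal_sup_ubound; exists (x, y). Qed.

Let D0 : (0 < D)%E. Proof. by rewrite /D mule_gt0 ?lte_fin. Qed.

Let capE r : ~~ (r%:E <= D)%E -> D = (fine D)%:E.
Proof.
rewrite -ltNge => lt; rewrite fineK// ge0_fin_numE ?(ltW D0)//.
by rewrite (lt_le_trans lt)// leey.
Qed.

Lemma cap_gt0 r : 0 < r -> 0 < cap r.
Proof.
rewrite /cap; case: ifPn => // h _; apply: fine_gt0.
by rewrite D0 (capE h) ltry.
Qed.

Lemma cap_le r : cap r <= r.
Proof.
rewrite /cap; case: ifPn => // h.
by rewrite -lee_fin -(capE h) ltW// ltNge.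
Qed.

Lemma cap_le_diam r : ((cap r)%:E <= eta%:E * qdiam rho)%E.
Proof. by rewrite /cap -/D; case: ifPn => // h; rewrite -(capE h). Qed.

Lemma qball_cap x r : qball rho x (cap r) = qball rho x r.
Proof.
rewrite /cap; case: ifPn => // h.
apply/seteqP; split => y; rewrite /qball/= => _; last first.
  rewrite -lte_fin -(capE h) (le_lt_trans (rho_le_diam x y))//.
  have hD : qdiam rho \is a fin_num.
    rewrite ge0_fin_numE ?(ltW hdiam)// ltey; apply/eqP => hD.
    by move: h; rewrite /D hD gt0_muley ?lte_fin// leey.
  by rewrite /D -[ltLHS]mul1e lte_pmul2r// ?lte_fin.
have : ((rho x y)%:E < r%:E)%E.
  rewrite (le_lt_trans (rho_le_diam x y))//.
  rewrite -ltNge in h; apply: le_lt_trans h.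
  by rewrite /D -[leLHS]mul1e lee_wpmul2r ?lee_fin ?ltW.
by rewrite lte_fin.
Qed.

(** Capping costs at most the factor by which the radii exceed an uncapped one. *)
Lemma le_cap E r R0 : 1 <= E -> (R0%:E <= eta%:E * qdiam rho)%E -> 0 <= r ->
  r <= E * R0 -> r <= E * cap r.
Proof.
move=> E1 R0D r0 rE; rewrite /cap; case: ifPn => h; first by rewrite ler_peMl.
have R0f : R0 <= fine D by rewrite -lee_fin -(capE h).
by rewrite (le_trans rE)// ler_wpM2l// (le_trans ler01).
Qed.

Lemma rho_lt_cap x y : exists N0 : nat, forall N, (N0 <= N)%N -> rho x y < cap (N.+1%:R).
Proof.
exists (Num.truncn (rho x y)) => N hN.
have : qball rho x (N.+1%:R) y.
  rewrite /qball/=; apply: lt_le_trans (truncnS_gt _) _.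
  by rewrite ler_nat.
by rewrite -qball_cap.
Qed.

Lemma admissible_gt0 c0 : phi_admissible rho mu eta c0 -> 0 < c0.
Proof. by move=> [c [delta []]]. Qed.

(** Comparing a ball with itself shows that the constant in reverse doubling is at
    most 1. *)
Lemma admissible_lt1 (x : X) c0 : phi_admissible rho mu eta c0 -> c0 < 1.
Proof.
move=> [c [delta [cp delta0 hrd c00 c0c]]].
have r0 : 0 < cap 1 by rewrite cap_gt0.
have := hrd x x _ _ r0 r0 (cap_le_diam 1) (cap_le_diam 1) (fun=> id).
rewrite !divff ?gt_eqF//; last exact: (vol_gt0 hX).
rewrite powR1 mulr1 => c1; rewrite ltNge; apply/negP => c01.
move: c0c; rewrite ltNge => /negP; apply; apply: (le_trans c1).
by have := @ge0_ler_powR R delta (ltW delta0) 1 c0; rewrite powR1 !nnegrE; apply; rewrite // ltW.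
Qed.

(** Were the shell between radii [c0 r] and [r] empty, the two balls would have
    the same measure, against reverse doubling. *)
Lemma admissible_shell x r c0 : phi_admissible rho mu eta c0 -> 0 < r ->
  (r%:E <= eta%:E * qdiam rho)%E -> exists2 y, qball rho x r y & c0 * r <= rho x y.
Proof.
move=> ha r0 rD; have c01 := admissible_lt1 x ha.
have [c [delta [cp delta0 hrd c00 c0c]]] := ha.
apply: contrapT => hno.
have cr0 : 0 < c0 * r by rewrite mulr_gt0.
have crr : c0 * r <= r by rewrite ler_piMl ?ltW.
have E : qball rho x (c0 * r) = qball rho x r.
  apply/seteqP; split; first exact: qball_mono.
  move=> y hy; rewrite /qball/= ltNge; apply/negP => hy'; apply: hno.
  by exists y.
have := hrd x x r (c0 * r) r0 cr0 rD.
rewrite E divff; last by rewrite gt_eqF// (vol_gt0 hX).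
have -> : r / (c0 * r) = c0^-1 by field; rewrite !gt_eqF.
move=> /(_ (le_trans _ rD) (fun=> id)); rewrite lee_fin => /(_ crr).
rewrite powRV; last exact: ltW.
rewrite ler_pdivrMr ?powR_gt0// mul1r.
by rewrite leNgt c0c.
Qed.

(** Reverse doubling forces the measures of shrinking balls to zero. The diagonal,
    where the kernel is not controlled, is therefore a null set of [X^m]. *)
Lemma no_atoms x c0 : phi_admissible rho mu eta c0 ->
  measurable [set x] /\ mu [set x] = 0%E.
Proof.
move=> [c [delta [cp delta0 hrd _ _]]].
have mx : measurable [set x].
  rewrite (_ : [set x] = \bigcap_n qball rho x n.+1%:R^-1).
    by apply: bigcapT_measurable => n; exact: (measurable_qball hX).
  apply/seteqP; split => [_ -> n _|y h]; first by apply: (qball_center hX); rewrite invr_gt0.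
  apply/esym; apply: (qm_eq0 qm x y).1; apply/eqP; rewrite eq_le (qm_ge0 qm) andbT leNgt.
  apply/negP => h0; have := h (Num.truncn (rho x y)^-1) I.
  rewrite /qball/= -[X in X < _]invrK ltf_pV2 ?posrE ?invr_gt0// ltNge.
  by rewrite ltW// truncnS_gt.
split => //; apply/eqP; rewrite eq_le measure_ge0 andbT.
apply/lee_addgt0Pr => e e0; rewrite add0e.
pose r0 := cap 1; have r00 : 0 < r0 by rewrite cap_gt0.
pose s := Num.min 1 ((c * e / vol rho mu x r0) `^ delta^-1).
have V0 : 0 < vol rho mu x r0 by exact: (vol_gt0 hX).
have s0 : 0 < s.
  by rewrite /s lt_min ltr01/= powR_gt0// divr_gt0// mulr_gt0.
have s1 : s <= 1 by rewrite /s ge_min lexx.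
have sr : s * r0 <= r0 by rewrite ler_piMl// ltW.
have sr0 : 0 < s * r0 by rewrite mulr_gt0.
have := hrd x x r0 (s * r0) r00 sr0 (cap_le_diam 1).
move=> /(_ (le_trans _ (cap_le_diam 1)) (qball_mono sr)); rewrite lee_fin => /(_ sr).
rewrite -/(vol rho mu x r0) -/(vol rho mu x (s * r0)).
have -> : r0 / (s * r0) = s^-1 by field; rewrite !gt_eqF.
have W0 := vol_gt0 hX x sr0.
rewrite ler_pdivlMr// powRV; last exact: ltW.
move=> h.
apply: (@le_trans _ _ (mu (qball rho x (s * r0)))).
  apply: le_measure; [exact/mem_set|exact/mem_set/(measurable_qball hX)|].
  by move=> _ ->; exact: (qball_center hX).
rewrite (mu_qballE hX) lee_fin.
have sd : s `^ delta <= c * e / vol rho mu x r0.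
  have h0 : 0 <= c * e / vol rho mu x r0 by rewrite ltW// divr_gt0// mulr_gt0.
  rewrite -[leRHS]powRr1// -(mulVf (lt0r_neq0 delta0)) powRrM.
  apply: ge0_ler_powR; rewrite ?nnegrE ?powR_ge0 ?(ltW s0) ?(ltW delta0)//.
  by rewrite /s ge_min lexx orbT.
have sd0 : 0 < s `^ delta by rewrite powR_gt0.
rewrite -(ler_pM2l cp).
move: h; rewrite mulrAC ler_pdivrMr// => /le_trans; apply.
by rewrite mulrC -ler_pdivlMr.
Qed.
End Scale.

(** * The functional of the kernel *)

Section PhiFacts.
Context {d : measure_display} {X : measurableType d} {R : realType}.
Variables (rho : X -> X -> R) (mu : {measure set X -> \bar R}).
Hypothesis hX : homogeneous_type rho mu.
Hypothesis hdiam : (0 < qdiam rho)%E.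
Variable kappa : R.
Hypothesis kappa1 : 1 <= kappa.
Hypothesis tri : forall x y z, rho x y <= kappa * (rho x z + rho z y).
Variables (m : nat) (K : m.-tuple X -> m.-tuple X -> \bar R).
Hypothesis m0 : (0 < m)%N.
Hypotheses (hK : kernel_off_diagonal rho K) (hgrowth : growth_conditions rho K).
Variables (eta c0 : R).
Hypotheses (heta : 1 < eta) (hc0 : phi_admissible rho mu eta c0).

Lemma rho_vec_diag x ys i :
  rho x (tnth ys i) <= rho_vec rho (@diag_tuple d X m x) ys.
Proof.
rewrite /rho_vec (bigD1 i)//= tnth_diag lerDl.
by apply: sumr_ge0 => j _; exact: (qm_ge0 (ht_quasi_metric hX)).
Qed.

(** The tuple is constant, equal to a point in the shell. *)
Lemma admissible_tuple (eta1 c1 : R) x r : phi_admissible rho mu eta1 c1 -> 1 < eta1 ->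
  0 < r -> (r%:E <= eta1%:E * qdiam rho)%E ->
  exists2 ys, (forall i, qball rho x r (tnth ys i)) & c1 * r <= rho_vec rho (@diag_tuple d X m x) ys.
Proof.
move=> ha e1 r0 rD; have [y yr yc] := admissible_shell hX hdiam e1 x ha r0 rD.
exists (@diag_tuple d X m y) => [i|]; first by rewrite tnth_diag.
apply: (le_trans yc).
by have := rho_vec_diag x (@diag_tuple d X m y) (Ordinal m0); rewrite tnth_diag.
Qed.

Lemma phi_ge0_fin x r : 0 < r -> (r%:E <= eta%:E * qdiam rho)%E ->
  (0 <= phi rho K c0 x r)%E /\ phi rho K c0 x r \is a fin_num.
Proof.
move=> r0 rD; have c00 := admissible_gt0 hc0.
have [C C0 hC] := phi_le hX kappa1 tri hgrowth c00 c00.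
have [ys bys far] := admissible_tuple x hc0 heta r0 rD.
have [h _] := hC x r x ys r0 (qball_center hX x r0) bys far.
have p0 : (0 <= phi rho K c0 x r)%E.
  apply: (le_trans (ker_ge0 hK (@diag_tuple d X m x) ys)).
  apply: ereal_sup_ubound; exists (x, ys) => //=; split => //.
  exact: (qball_center hX).
split => //; rewrite ge0_fin_numE// (le_lt_trans h)//.
have /(ker_fin hK) : @diag_tuple d X m x != ys.
  by apply: (rho_vec_neq hX); apply: lt_le_trans far; rewrite mulr_gt0.
by move=> hf; rewrite -(fineK hf) -EFinM ltry.
Qed.

Definition phi_cap x r := fine (phi rho K c0 x (cap rho eta r)).

Lemma phi_capE x r : 0 < r -> phi rho K c0 x (cap rho eta r) = (phi_cap x r)%:E.
Proof.
move=> r0; rewrite /phi_cap fineK//.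
by have [] := phi_ge0_fin x (cap_gt0 hdiam heta r0) (cap_le_diam hdiam heta r).
Qed.

Lemma phi_cap_ge0 x r : 0 < r -> 0 <= phi_cap x r.
Proof.
move=> r0; rewrite -lee_fin -phi_capE//.
by have [] := phi_ge0_fin x (cap_gt0 hdiam heta r0) (cap_le_diam hdiam heta r).
Qed.

(** The decay condition, whose functional may use another constant than [c0],
    transferred to the functional with constant [c0]. *)
Lemma phi_cap_decay (E : R) : 1 <= E -> decay_condition rho mu K ->
  exists eps CL : R, [/\ 0 < eps, 0 <= CL & forall R0, 
   (R0%:E <= eta%:E * qdiam rho)%E ->
   forall y y' r r', 0 < r' -> r' <= r -> r <= E * R0 -> qball rho y' r' `<=` qball rho y r ->
     phi_cap y' r' * vol rho mu y' r' ^+ m <=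
       CL * (r' / r) `^ eps * (phi_cap y r * vol rho mu y r ^+ m)].
Proof.
move=> E1 [eps eps0 hd]; have E0 : 0 < E by exact: lt_le_trans E1.
have eta0 : 0 < eta by exact: lt_trans heta.
have eta2 : 1 < 2 * eta by have := heta; lra.
have [eta1 [c1 [C2 [eta12 ha C20 hdec]]]] := hd _ eta2.
have eta11 : 1 < eta1 by exact: lt_le_trans eta12.
have c00 := admissible_gt0 hc0; have c10 := admissible_gt0 ha.
have [Ca Ca0 hCa] := phi_le hX kappa1 tri hgrowth c00 c10.
have [Cb Cb0 hCb] := phi_le hX kappa1 tri hgrowth c10 c00.
exists eps, (Ca * C2 * E `^ eps * Cb); split => //.
  by rewrite !mulr_ge0 ?powR_ge0// ltW.
move=> R0 R0D y y' r r' r'0 r'r rE sub.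
have r0 : 0 < r by exact: lt_le_trans r'r.
set s := cap rho eta r; set s' := cap rho eta r'.
have s0 : 0 < s by exact: cap_gt0.
have s'0 : 0 < s' by exact: cap_gt0.
have sD : (s%:E <= eta%:E * qdiam rho)%E by exact: cap_le_diam.
have s'D : (s'%:E <= eta%:E * qdiam rho)%E by exact: cap_le_diam.
have lt2 t : (t%:E <= eta%:E * qdiam rho)%E -> (t%:E < (2 * eta)%:E * qdiam rho)%E.
  move: hdiam; case: (qdiam rho) => [D| |]//.
    by rewrite lte_fin -!EFinM !lee_fin lte_fin => D0 /le_lt_trans; apply; rewrite ltr_pM2r//; lra.
  by move=> _ _; rewrite gt0_muley ?lte_fin ?ltry// (lt_trans ltr01).
have le1 t : (t%:E <= eta%:E * qdiam rho)%E -> (t%:E <= eta1%:E * qdiam rho)%E.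
  move=> /lt2/ltW/le_trans; apply; apply: lee_wpmul2r; first exact: ltW.
  by rewrite lee_fin.
have [ya ba fara] := admissible_tuple y' ha eta11 s'0 (le1 _ s'D).
have [yb bb farb] := admissible_tuple y hc0 heta s0 sD.
have [_ h1] := hCa y' s' y' ya s'0 (qball_center hX y' s'0) ba fara.
have [_ h2] := hCb y s y yb s0 (qball_center hX y s0) bb farb.
have h3 := hdec y y' s s' s0 s'0 (lt2 _ sD) (lt2 _ s'D).
rewrite !(qball_cap hdiam heta) in h3; have {}h3 := h3 sub.
rewrite !(mu_qballE hX) in h3.
set V := vol rho mu y r in h3 *; set V' := vol rho mu y' r' in h3 *.
have V0 : 0 <= V by rewrite ltW// (vol_gt0 hX).
have V'0 : 0 <= V' by rewrite ltW// (vol_gt0 hX).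
have Vm0 : (0 <= (V ^+ m)%:E)%E by rewrite lee_fin exprn_ge0.
have V'm0 : (0 <= (V' ^+ m)%:E)%E by rewrite lee_fin exprn_ge0.
have ss : s' / s <= E * (r' / r).
  have := le_cap hdiam heta E1 R0D (ltW r0) rE; rewrite -/s => rs.
  rewrite ler_pdivrMr//; apply: (le_trans (cap_le hdiam heta r')).
  have -> : E * (r' / r) * s = r' * (E * s / r) by ring.
  by rewrite ler_peMr ?(ltW r'0)// ler_pdivlMr// mul1r.
have PE := phi_capE y r0; have P'E := phi_capE y' r'0.
rewrite -/s in PE; rewrite -/s' in P'E.
rewrite PE in h2; rewrite P'E in h1; rewrite -!EFin_expe in h3.
have P0 := phi_cap_ge0 y r0.
rewrite -lee_fin EFinM.
apply: (le_trans (lee_wpmul2r V'm0 h1)); rewrite -muleA.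
have Ca0' : (0 <= Ca%:E)%E by rewrite lee_fin ltW.
apply: (le_trans (lee_wpmul2l Ca0' h3)).
have cs0 : (0 <= (C2 * (s' / s) `^ eps)%:E)%E by rewrite lee_fin mulr_ge0 ?powR_ge0// ltW.
apply: (le_trans (lee_wpmul2l Ca0' (lee_wpmul2l cs0 (lee_wpmul2r Vm0 h2)))).
rewrite -!EFinM lee_fin.
have pw : (s' / s) `^ eps <= E `^ eps * (r' / r) `^ eps.
  have rr0 : 0 <= r' / r by rewrite divr_ge0// ltW.
  have ss0 : 0 <= s' / s by rewrite divr_ge0// ltW.
  rewrite -powRM ?(ltW E0)//; apply: ge0_ler_powR; rewrite ?nnegrE ?(ltW eps0)//.
  by rewrite mulr_ge0 ?(ltW E0).
rewrite [leLHS](_ : _ = (Ca * C2 * Cb * (phi_cap y r * V ^+ m)) * (s' / s) `^ eps); last by ring.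
rewrite [leRHS](_ : _ = (Ca * C2 * Cb * (phi_cap y r * V ^+ m)) * (E `^ eps * (r' / r) `^ eps)); last by ring.
apply: ler_wpM2l => //.
apply: mulr_ge0; last by rewrite mulr_ge0// exprn_ge0.
by rewrite !mulr_ge0// ltW.
Qed.

End PhiFacts.

(** * The potential and the sum over scales *)

Section PotentialBound.
Context {d : measure_display} {X : measurableType d} {R : realType}.
Variables (rho : X -> X -> R) (mu : {measure set X -> \bar R}).
Hypothesis hX : homogeneous_type rho mu.
Hypothesis hdiam : (0 < qdiam rho)%E.
Variable kappa : R.
Hypothesis kappa1 : 1 <= kappa.
Hypothesis tri : forall x y z, rho x y <= kappa * (rho x z + rho z y).
Variables (m : nat) (K : m.-tuple X -> m.-tuple X -> \bar R).
Hypothesis m0 : (0 < m)%N.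
Hypotheses (hK : kernel_off_diagonal rho K) (hgrowth : growth_conditions rho K).
Variables (eta c0 : R).
Hypotheses (heta : 1 < eta) (hc0 : phi_admissible rho mu eta c0).

Let qm := ht_quasi_metric hX.
Let c00 : 0 < c0. Proof. exact: admissible_gt0 hc0. Qed.
Let Pf := phi_cap rho K eta c0.
Let diag x : m.-tuple X := @diag_tuple d X m x.

(** With ratio [c0^-1] between consecutive radii, the least ball of the grid
    that contains all the [ys] makes the pair [(x, ys)] admissible in the
    supremum defining [phi]. *)
Lemma kernel_le_phi x ys R0 : ys != diag x -> (R0%:E <= eta%:E * qdiam rho)%E ->
  (forall i, rho x (tnth ys i) < R0) ->
  exists k, (forall i, qball rho x (grid c0^-1 R0 k) (tnth ys i)) /\
    (K (diag x) ys <= (Pf x (grid c0^-1 R0 k))%:E)%E.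
Proof.
move=> nd R0D hR; have c01 := admissible_lt1 hX hdiam heta x hc0.
have b1 : 1 < c0^-1 by rewrite invf_gt1.
have R00 : 0 < R0 by apply: le_lt_trans (hR (Ordinal m0)); exact: (qm_ge0 qm).
have [i0 hi0] : exists i, 0 < rho x (tnth ys i).
  apply: contrapT => h; move/eqP: nd; apply; apply: eq_from_tnth => i.
  rewrite tnth_diag; apply/esym/(qm_eq0 qm x _).1/eqP.
  by rewrite eq_le (qm_ge0 qm) andbT leNgt; apply/negP => hi; apply: h; exists i.
pose bad k := exists i, grid c0^-1 R0 k <= rho x (tnth ys i).
have [|[|k] [[i hi] hk]] := @ex_least_nat bad.
- have [n hn] := expr_unbounded (R0 / rho x (tnth ys i0)) b1.
  exists n, i0; rewrite /grid ler_pdivrMr ?exprn_gt0 ?invr_gt0// mulrC -ler_pdivrMr//.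
  exact: ltW.
- by move: hi; rewrite grid0 leNgt hR.
exists k; set r := grid c0^-1 R0 k.
have r0 : 0 < r by exact: grid_gt0.
have bys i' : qball rho x r (tnth ys i').
  by rewrite /qball/= ltNge; apply/negP => h; apply: (hk k) => //; exists i'.
split => //.
have rD : (r%:E <= eta%:E * qdiam rho)%E.
  apply: le_trans R0D; rewrite lee_fin.
  by rewrite -[leRHS](grid0 c0^-1 R0); exact: grid_le.
rewrite -(phi_capE hX hdiam kappa1 tri m0 hK hgrowth heta hc0)// /cap rD.
apply: ereal_sup_ubound; exists (x, ys) => //=; split => //.
  exact: (qball_center hX).
apply: le_trans (rho_vec_diag hX x ys i); apply: le_trans hi.
rewrite /r (gridD b1 R0 k 1) addn1 expr1 mulrA divff ?gt_eqF// mul1r.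
exact: lexx.
Qed.

Lemma measurable_tuple_prod (F : 'I_m -> X -> \bar R) :
  (forall i, measurable_fun [set: X] (F i)) ->
  measurable_fun [set: m.-tuple X] (fun ys => \prod_(i < m) F i (tnth ys i))%E.
Proof.
move=> mF; apply: emeasurable_prod => i.
by apply: measurableT_comp => //; exact: measurable_tnth.
Qed.

(** The integrand is compared with the sum over the grid of [Pf] times the
    indicator of the m-fold power of the ball, plus an infinite mass on the
    diagonal, where the kernel is uncontrolled; that mass is not seen because
    points are null. *)
Lemma potential_le_liminf (f : 'I_m -> X -> R) (fN : nat -> 'I_m -> X -> R) x :
  (forall N i, bounded_nonneg (fN N i)) ->
  (forall i y, exists N0, forall N, (N0 <= N)%N -> `|f i y| <= fN N i y) ->
  (`|potential mu K f x| <= limn_einf (fun N =>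
     \sum_(k <oo) (Pf x (grid c0^-1 (cap rho eta N.+1%:R) k) *
        vol rho mu x (grid c0^-1 (cap rho eta N.+1%:R) k) ^+ m *
        prodavg rho mu (fN N) x (grid c0^-1 (cap rho eta N.+1%:R) k))%:E))%E.
Proof.
move=> bfN hfN; have c01 := admissible_lt1 hX hdiam heta x hc0.
have b1 : 1 < c0^-1 by rewrite invf_gt1.
have [mx mux] := no_atoms hX hdiam heta x hc0.
have sf : sigma_finite [set: X] mu by apply: (qball_sigma_finite hX); exists x.
have [nu [nuE hnu]] := power_measureP sf m.
rewrite /potential -nuE.
pose r N k := grid c0^-1 (cap rho eta N.+1%:R) k.
have RN0 N : 0 < cap rho eta N.+1%:R by exact: (cap_gt0 hdiam heta).
have r0 N k : 0 < r N k by exact: (grid_gt0 b1).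
pose h N k i y : \bar R := (fN N i y * \1_(qball rho x (r N k)) y)%:E.
pose w (i : 'I_m) y : \bar R := (\1_[set x] y)%:E.
have mh N k i : measurable_fun [set: X] (h N k i).
  apply/measurable_EFinP; apply: measurable_funM; first by have [] := bfN N i.
  exact/measurable_indic/(measurable_qball hX).
have h0 N k i y : (0 <= h N k i y)%E.
  by rewrite lee_fin mulr_ge0//; have [_ +] := bfN N i.
have mw i : measurable_fun [set: X] (w i).
  by apply/measurable_EFinP; exact: measurable_indic.
have w0 (i : 'I_m) y : (0 <= w i y)%E by rewrite lee_fin.
pose term N k ys := ((Pf x (r N k))%:E * \prod_(i < m) h N k i (tnth ys i))%E.
have P0 N k : (0 <= (Pf x (r N k))%:E)%E.
  rewrite lee_fin; exact: (phi_cap_ge0 hX hdiam kappa1 tri m0 hK hgrowth heta hc0).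
have term0 N k ys : (0 <= term N k ys)%E.
  by rewrite mule_ge0//; apply: prode_ge0.
have mterm N k : measurable_fun [set: m.-tuple X] (term N k).
  by apply: emeasurable_funM => //; exact: (measurable_tuple_prod (mh N k)).
pose g N ys := (\sum_(k <oo) term N k ys + +oo * \prod_(i < m) w i (tnth ys i))%E.
have s0 N ys : (0 <= \sum_(k <oo) term N k ys)%E by exact: nneseries_ge0.
have d0 ys : (0 <= +oo * \prod_(i < m) w i (tnth ys i))%E.
  by rewrite mule_ge0//; exact: prode_ge0.
have ms N : measurable_fun [set: m.-tuple X] (fun ys => \sum_(k <oo) term N k ys)%E.
  by apply: ge0_emeasurable_sum => //.
have md : measurable_fun [set: m.-tuple X] (fun ys => +oo * \prod_(i < m) w i (tnth ys i))%E.
  by apply: emeasurable_funM => //; exact: measurable_tuple_prod.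
pose G ys := ((\prod_(i < m) f i (tnth ys i))%:E * K (diag x) ys)%E.
apply: (@le_trans _ _ (\int[nu]_ys `|G ys|)%E).
  exact: abse_integral_le.
rewrite [leRHS](_ : _ = limn_einf (fun N => \int[nu]_ys g N ys)%E); last first.
  congr (limn_einf _); apply/funext => N; rewrite /g ge0_integralD//.
  rewrite [X in (_ + X)%E](_ : _ = 0%E); last first.
    rewrite ge0_integralZl//; first last.
    - by move=> ys _; exact: prode_ge0.
    - exact: measurable_tuple_prod.
    rewrite hnu// (bigD1 (Ordinal m0))//= /w integral_indic// setIT mux mul0e mule0//.
  rewrite adde0 integral_nneseries//; apply: eq_eseriesr => k _.
  rewrite /term ge0_integralZl_EFin//; first last.
  - by rewrite -lee_fin.
  - exact: measurable_tuple_prod.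
  - by move=> ys _; exact: prode_ge0.
  rewrite hnu// -mulrA EFinM; congr (_ * _)%E.
  have -> : vol rho mu x (r N k) ^+ m * prodavg rho mu (fN N) x (r N k) =
      \prod_(i < m) ballint rho mu (fN N i) x (r N k).
    rewrite /prodavg -[m in _ ^+ m]card_ord -prodr_const -big_split/=.
    apply: eq_bigr => i _; rewrite /ballavg mulrC divfK// gt_eqF//.
    exact: (vol_gt0 hX).
  rewrite -prodEFin; apply: eq_bigr => i _; rewrite -bounded_ballint//.
  rewrite [LHS]integral_mkcond.
  apply: eq_integral => y _.
  by rewrite /h /patch indicE; case: ifP => _; rewrite ?mulr1 ?mulr0.
apply: lower_fatou.
- by move=> ys; exact: abse_ge0.
- by move=> N ys; rewrite adde_ge0.
- by move=> N; exact: emeasurable_funD.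
move=> ys c hc; have [E|nd] := eqVneq ys (diag x).
  exists 0%N => N _; rewrite /g E big1 => [|i _]; last first.
    by rewrite /w tnth_diag indicE mem_set.
  rewrite mule1 addeC addye ?leey//.
  by apply/eqP => h'; have := s0 N (diag x); rewrite h'.
have /choice[Na hNa] : forall i, exists N0, forall N, (N0 <= N)%N -> `|f i (tnth ys i)| <= fN N i (tnth ys i).
  by move=> i; exact: hfN.
have /choice[Nb hNb] := fun i => rho_lt_cap hdiam heta x (tnth ys i).
exists (\max_(i < m) maxn (Na i) (Nb i)) => N hN.
have hle i : (Na i <= N)%N /\ (Nb i <= N)%N.
  have := leq_trans (leq_bigmax i) hN; rewrite geq_max => /andP[]; by split.
have [k [bk Kk]] := @kernel_le_phi x ys (cap rho eta N.+1%:R) nd (cap_le_diam hdiam heta _)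
  (fun i => hNb i N (hle i).2).
apply: (le_trans (ltW hc)); rewrite /g; apply: (@le_trans _ _ (term N k ys)).
  rewrite /G abseM muleC (gee0_abs (ker_ge0 hK _ _)) /term.
  apply: lee_pmul => //; first exact: (ker_ge0 hK).
  rewrite abse_EFin normr_prod prodEFin lee_fin; apply: ler_prod => i _.
  by rewrite normr_ge0/= indicE mem_set// mulr1 hNa// (hle i).1.
apply: (@le_trans _ _ (\sum_(k <oo) term N k ys)%E); last by rewrite leeDl.
by rewrite (nneseriesD1 (n := k))// leeDl// nneseries_ge0.
Qed.

End PotentialBound.

(** * The weighted inequality for the potential *)

Lemma ereal_sup_lty_bound {R : realType} (T : Type) (A : set T) (F : T -> \bar R) :
  (ereal_sup [set F z | z in A] < +oo)%E ->
  exists2 M : R, 0 <= M & forall z, A z -> (F z <= M%:E)%E.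
Proof.
move=> h; have ub z : A z -> (F z <= ereal_sup [set F z | z in A])%E.
  by move=> Az; apply: ereal_sup_ubound; exists z.
move: h ub; case: ereal_sup => [M| |]// _ ub.
- exists (Num.max M 0); first by rewrite le_max lexx orbT.
  by move=> z /ub/le_trans; apply; rewrite lee_fin le_max lexx.
- by exists 0 => // z /ub/le_trans; apply; rewrite leNye.
Qed.

Section Scaling.
Context {d : measure_display} {X : measurableType d} {R : realType}.
Variables (rho : X -> X -> R) (mu : {measure set X -> \bar R}).
Hypothesis hX : homogeneous_type rho mu.

Lemma bounded_nonnegZ (t : R) (f : X -> R) : 0 <= t -> bounded_nonneg f ->
  bounded_nonneg (fun y => t * f y).
Proof.
move=> t0 [mf f0 [N fN]]; split.
- exact: measurable_funM.
- by move=> y; rewrite mulr_ge0.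
- by exists (t * N) => y; rewrite ler_wpM2l.
Qed.

Lemma prodavgZ (m : nat) (t : 'I_m -> R) (f : 'I_m -> X -> R) x r :
  (forall i, 0 <= t i) -> (forall i, bounded_nonneg (f i)) ->
  prodavg rho mu (fun i y => t i * f i y) x r = (\prod_(i < m) t i) * prodavg rho mu f x r.
Proof.
move=> t0 bf; rewrite /prodavg -big_split/=; apply: eq_bigr => i _.
rewrite /ballavg mulrA; congr (_ / _); apply: EFin_inj.
rewrite -(bounded_ballint hX)//; last exact: bounded_nonnegZ.
have [mf f0 _] := bf i.
under eq_integral do rewrite EFinM.
rewrite ge0_integralZl_EFin//.
- by rewrite (bounded_ballint hX).
- exact: (measurable_qball hX).
- by move=> y _; rewrite lee_fin.
- by apply: measurable_funTS; exact/measurable_EFinP.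
Qed.

(** The truncations of [f / t] make all averages finite and increase to [f / t]. *)
Lemma truncation_bounded (f : X -> R) (t N : R) : 0 < t -> 0 <= N -> measurable_fun [set: X] f ->
  bounded_nonneg (fun y => Num.min (`|f y| / t) N).
Proof.
move=> t0 N0 mf; split.
- apply: measurable_minr => //; apply: measurable_funM => //.
  exact: measurableT_comp.
- by move=> y; rewrite le_min N0 andbT divr_ge0// ltW.
- by exists N => y; rewrite ge_min lexx orbT.
Qed.

End Scaling.

Section PotentialInequality.
Context {R : realType} {m : nat} {d : measure_display} {X : measurableType d}.
Variables (p : 'I_m -> R) (pbar q : R).
Hypotheses (hm : (0 < m)%N) (hp : forall i, 1 < p i)
  (hpbar : pbar^-1 = \sum_(i < m) (p i)^-1) (pbar0 : 0 < pbar) (hpq : pbar <= q).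
Variables (rho : X -> X -> R) (mu : {measure set X -> \bar R}).
Hypotheses (hX : homogeneous_type rho mu) (hdiam : (0 < qdiam rho)%E).
Variable K : m.-tuple X -> m.-tuple X -> \bar R.
Hypotheses (hK : kernel_off_diagonal rho K) (hgrowth : growth_conditions rho K)
  (hdecay : decay_condition rho mu K).
Variables (eta c0 : R).
Hypotheses (heta : 1 < eta) (hc0 : phi_admissible rho mu eta c0).
Variables (Phi : 'I_m -> R -> R) (Psi : R -> R).
Hypotheses (hPhi : forall i, young_function (Phi i)) (hPsi : 1 < q -> young_function Psi).
Variable c : R.
Hypotheses (c_gt0 : 0 < c)
  (tailPhi : forall i, (tail_integral (Phi i) (conj_exp (p i)) (p i - 1) c < +oo)%E)
  (tailPsi : 1 < q -> (tail_integral Psi q (conj_exp q - 1) c < +oo)%E).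
Variables (u : X -> R) (v : 'I_m -> X -> R).
Hypotheses (hu : weight u) (hv : forall i, weight (v i)).
Let e : R := q^-1 + \sum_(i < m) (conj_exp (p i))^-1.
Hypothesis hgt1 : 1 < q ->
    (ereal_sup [set (phi rho K c0 B.1 B.2
        * mu (qball rho B.1 B.2) `^ e
        * orlicz_norm rho mu Psi B.1 B.2 (EFin \o u)
        * \prod_(i < m)
            orlicz_norm rho mu (Phi i) B.1 B.2 (fun y => ((v i y)%:E)^-1))%E
      | B in phi_balls rho eta]
     < +oo)%E.
Hypothesis hle1 : q <= 1 ->
    (ereal_sup [set (phi rho K c0 B.1 B.2
        * mu (qball rho B.1 B.2) `^ e
        * (average rho mu B.1 B.2 (fun y => (u y `^ q)%:E)) `^ q^-1
        * \prod_(i < m)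
            orlicz_norm rho mu (Phi i) B.1 B.2 (fun y => ((v i y)%:E)^-1))%E
      | B in phi_balls rho eta]
     < +oo)%E.

Let q0 : 0 < q. Proof. exact: lt_le_trans hpq. Qed.
Let Pf := phi_cap rho K eta c0.

Lemma average_cap x r : average rho mu x (cap rho eta r) = average rho mu x r.
Proof. by rewrite /average (qball_cap hdiam heta). Qed.

Lemma orlicz_norm_cap psi x r f :
  orlicz_norm rho mu psi x (cap rho eta r) f = orlicz_norm rho mu psi x r f.
Proof. by rewrite /orlicz_norm average_cap. Qed.

(** The bump hypothesis is only assumed on balls where [phi] is defined; capping the
    radii makes it available on the dilated balls, which may be larger. *)
Lemma normalized_bound : exists2 C : R, 0 <= C & forall (o : X) (R0 : R) (f : 'I_m -> X -> R),
  0 < R0 -> (R0%:E <= eta%:E * qdiam rho)%E -> (forall i, bounded_nonneg (f i)) ->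
  (forall i, (\int[mu]_x ((f i x * v i x) `^ p i)%:E <= 1)%E) ->
  exists H : X -> \bar R, [/\ measurable_fun [set: X] H, (forall x, 0 <= H x)%E,
    forall x, qball rho o R0 x ->
      (\sum_(k <oo) (Pf x (grid c0^-1 R0 k) * vol rho mu x (grid c0^-1 R0 k) ^+ m *
        prodavg rho mu f x (grid c0^-1 R0 k))%:E <= H x)%E &
    (\int[mu]_(x in qball rho o R0) ((H x * (u x)%:E) `^ q) <= C%:E)%E].
Proof.
have [kappa kappa1 tri] := qm_triangle (ht_quasi_metric hX).
have x0 : X by move: hdiam => /ereal_sup_gt/cid2[? /cid2[[]]].
have c00 := admissible_gt0 hc0.
have b1 : 1 < c0^-1 by rewrite invf_gt1//; exact: (admissible_lt1 hX hdiam heta x0 hc0).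
have tPhi i := tail_slope_sum (hPhi i) (hp i) c_gt0 (tailPhi i).
have tPsi : 1 < q -> (\sum_(j <oo) (2 ^+ j * slope Psi j `^ (1 - conj_exp q))%:E < +oo)%E.
  move=> q1; apply: (tail_slope_sum (hPsi q1) _ c_gt0).
    by rewrite /conj_exp ltr_pdivlMr ?subr_gt0// mul1r gtrBl.
  by rewrite conj_expK//; exact: tailPsi.
have E1 := outer_dil_ge1 kappa1.
have [eps [CL [eps0 CL0 hdec]]] :=
  phi_cap_decay hX hdiam kappa1 tri hm hK hgrowth heta hc0 E1 hdecay.
have Pf0 y r : 0 < r -> 0 <= Pf y r.
  exact: (phi_cap_ge0 hX hdiam kappa1 tri hm hK hgrowth heta hc0).
have PfE x r : 0 < r -> phi rho K c0 x (cap rho eta r) = (Pf x r)%:E.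
  exact: (phi_capE hX hdiam kappa1 tri hm hK hgrowth heta hc0).
have ballD x r : 0 < r -> phi_balls rho eta (x, cap rho eta r).
  by move=> r0; split; [exact: cap_gt0|exact: cap_le_diam].
have [q1|q1] := leP q 1.
- have [bnd bnd0 hb] := ereal_sup_lty_bound (hle1 q1).
  have [C C0 hC] := dyadic_bound_le1 hX kappa1 tri b1 hm hp hpbar pbar0 hpq hPhi hv hu tPhi
    eps0 CL0 bnd0 q1.
  exists C => // o R0 f R00 R0D bf nf; apply: hC => //; first exact: hdec.
  move=> x r r0 _; have /= := hb _ (ballD x r r0).
  rewrite (qball_cap hdiam heta).
  rewrite average_cap.
  rewrite (PfE x r r0).
  under eq_bigr do rewrite orlicz_norm_cap.
  exact: id.
- have [bnd bnd0 hb] := ereal_sup_lty_bound (hgt1 q1).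
  have [C C0 hC] := dyadic_bound_gt1 hX kappa1 tri b1 hm hp hpbar pbar0 hpq hPhi hPsi hv hu tPhi
    tPsi eps0 CL0 bnd0 q1.
  exists C => // o R0 f R00 R0D bf nf; apply: hC => //; first exact: hdec.
  move=> x r r0 _; have /= := hb _ (ballD x r r0).
  rewrite (qball_cap hdiam heta) (PfE x r r0) orlicz_norm_cap.
  under eq_bigr do rewrite orlicz_norm_cap.
  exact: id.
Qed.

(** The bounds for truncated functions are uniform over the radii [RN N], which
    exhaust the space. Fatou's lemma is used twice: inside [potential_le_liminf] for the
    integral defining the potential, and here for the integral of the potential. *)
Lemma potential_bound_scaled : exists2 C : R, 0 <= C & forall (f : 'I_m -> X -> R) (t : 'I_m -> R),
  (forall i, 0 < t i) -> (forall i, measurable_fun [set: X] (f i)) ->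
  (forall i, (\int[mu]_x ((`|f i x| * v i x) `^ p i)%:E <= (t i `^ p i)%:E)%E) ->
  (\int[mu]_x ((`|potential mu K f x| * (u x)%:E) `^ q) <=
    ((\prod_(i < m) t i) `^ q * C)%:E)%E.
Proof.
have [kappa kappa1 tri] := qm_triangle (ht_quasi_metric hX).
have c00 := admissible_gt0 hc0.
have x0 : X by move: hdiam => /ereal_sup_gt/cid2[? /cid2[[]]].
have b1 : 1 < c0^-1 by rewrite invf_gt1//; exact: (admissible_lt1 hX hdiam heta x0 hc0).
have [C C0 hC] := normalized_bound.
exists C => // f t t0 mf nf.
pose g (N : nat) i y := Num.min (`|f i y| / t i) N%:R.
have bg N i : bounded_nonneg (g N i) by exact: truncation_bounded.
have gle N i y : g N i y <= `|f i y| / t i by rewrite ge_min lexx.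
have ng N i : (\int[mu]_x ((g N i x * v i x) `^ p i)%:E <= 1)%E.
  have pi0 : 0 < p i by rewrite (lt_trans ltr01).
  have [mv v0] := hv i; have [mg g0 _] := bg N i.
  apply: (@le_trans _ _ (\int[mu]_x ((t i `^ - p i)%:E * ((`|f i x| * v i x) `^ p i)%:E))%E).
    apply: le_lower_integral => x _; first by rewrite lee_fin powR_ge0.
    rewrite -EFinM lee_fin powRN -powRV ?(ltW (t0 i))// -powRM ?mulr_ge0 ?invr_ge0 ?(ltW (t0 i))//.
    apply: ge0_ler_powR; rewrite ?nnegrE ?(ltW pi0)//.
    - by rewrite mulr_ge0.
    - by rewrite !mulr_ge0 ?invr_ge0// ltW.
    - by rewrite mulrA ler_wpM2r// mulrC.
  rewrite ge0_integralZl_EFin ?powR_ge0//; first last.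
  - apply/measurable_EFinP; apply: (measurableT_comp (measurable_powR (p i))).
    by apply: measurable_funM => //; exact: measurableT_comp.
  - by move=> x _; rewrite lee_fin powR_ge0.
  apply: (le_trans (lee_wpmul2l _ (nf i))); first by rewrite lee_fin powR_ge0.
  by rewrite -EFinM lee_fin powRN mulVf// gt_eqF// powR_gt0.
pose T := \prod_(i < m) t i.
have T0 : 0 < T by exact: prodr_gt0.
pose RN (N : nat) := cap rho eta N.+1%:R.
have RN0 N : 0 < RN N by exact: cap_gt0.
have RND N : ((RN N)%:E <= eta%:E * qdiam rho)%E by exact: cap_le_diam.
have /choice[H hH] := fun N => hC x0 (RN N) (g N) (RN0 N) (RND N) (bg N) (ng N).
pose G N x := ((T%:E * (H N x * (u x)%:E)) `^ q)%E.
have [mu_ u0] := hu.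
have H0 N x : (0 <= H N x)%E by have [_ + _ _] := hH N.
have mHu N : measurable_fun [set: X] (fun x => H N x * (u x)%:E)%E.
  have [mH _ _ _] := hH N.
  by apply: emeasurable_funM => //; exact/measurable_EFinP.
have Hu0 N x : (0 <= H N x * (u x)%:E)%E by rewrite mule_ge0// lee_fin.
pose S N x := (\sum_(k <oo) (Pf x (grid c0^-1 (RN N) k) * vol rho mu x (grid c0^-1 (RN N) k) ^+ m *
        prodavg rho mu (fun i y => t i * g N i y) x (grid c0^-1 (RN N) k))%:E)%E.
have SH N x : qball rho x0 (RN N) x -> (S N x <= T%:E * H N x)%E.
  move=> bx; have [_ _ /(_ x bx) h _] := hH N.
  apply: le_trans (lee_wpmul2l _ h); last by rewrite lee_fin ltW.
  have P0 k : 0 <= Pf x (grid c0^-1 (RN N) k) * vol rho mu x (grid c0^-1 (RN N) k) ^+ m *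
        prodavg rho mu (g N) x (grid c0^-1 (RN N) k).
    have r0 := grid_gt0 b1 k (RN0 N).
    have V0 := vol_gt0 hX x r0.
    apply: mulr_ge0; last exact: (prodavg_ge0 hX).
    apply: mulr_ge0; last by rewrite exprn_ge0// ltW.
    exact: (phi_cap_ge0 hX hdiam kappa1 tri hm hK hgrowth heta hc0).
  rewrite -nneseriesZl; last by move=> k _; rewrite lee_fin.
  rewrite le_eqVlt; apply/orP; left; apply/eqP; apply: eq_eseriesr => k _.
  rewrite (prodavgZ hX)//; last by move=> i; exact: ltW.
  by rewrite -EFinM -/T; congr EFin; rewrite mulrCA.
have TS x : (`|potential mu K f x| <= limn_einf (S ^~ x))%E.
  apply: (potential_le_liminf hX hdiam kappa1 tri hm hK hgrowth heta hc0).
    by move=> N i; apply: bounded_nonnegZ => //; exact: ltW.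
  move=> i y; exists (Num.truncn (`|f i y| / t i)).+1 => N hN.
  rewrite /g min_l; first by rewrite mulrC divfK// gt_eqF.
  by apply: (le_trans (ltW (truncnS_gt _))); rewrite ler_nat.
apply: (@le_trans _ _ (limn_einf (fun N => \int[mu]_x (G N \_ (qball rho x0 (RN N))) x)%E)).
  apply: lower_fatou.
  - by move=> x; exact: poweR_ge0.
  - by move=> N x; rewrite /patch; case: ifP => // _; exact: poweR_ge0.
  - move=> N; apply/(measurable_restrictT _ (measurable_qball hX x0 (RN N))).
    apply: measurable_funTS; apply: (measurableT_comp (measurable_poweR q)).
    by apply: emeasurable_funM.
  move=> x a ha.
  have [a0|a0] := leP a 0.
    exists 0%N => N _; apply: (@le_trans _ _ 0%E); first by rewrite lee_fin.
    by rewrite /patch; case: ifP => // _; exact: poweR_ge0.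
  have ux : 0 < u x.
    rewrite lt_neqAle u0 andbT; apply/eqP => ux; move: ha.
    by rewrite -ux mule0 poweR_EFin powR0 ?gt_eqF// lte_fin ltNge ltW.
  pose a' := a `^ q^-1.
  have a'E : a' `^ q = a by rewrite /a' -powRrM mulVf ?gt_eqF// powRr1// ltW.
  have hT : ((a' / u x)%:E < `|potential mu K f x|)%E.
    rewrite EFinM lte_pdivrMr// ltNge; apply/negP => h.
    have := le_poweR (ltW q0) (mule_ge0 (abse_ge0 _) _) h.
    rewrite poweR_EFin a'E => /(_ _); rewrite lee_fin => /(_ (ltW ux)).
    by rewrite leNgt ha.
  have [N1 hN1] := lt_limn_einf hT (TS x).
  have [N2 hN2] := rho_lt_cap hdiam heta x0 x.
  exists (maxn N1 N2) => N; rewrite geq_max => /andP[/hN1 h1 /hN2 h2].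
  rewrite /patch mem_set//.
  have := le_trans h1 (SH N x h2); rewrite EFinM lee_pdivrMr// -muleA => h.
  have a'0 : (0 <= a'%:E)%E by rewrite lee_fin powR_ge0.
  by have := le_poweR (ltW q0) a'0 h; rewrite poweR_EFin a'E.
apply: limn_einf_le_bound => N; rewrite -integral_mkcond.
have [_ _ _ hI] := hH N.
under eq_integral do rewrite /G poweRM ?lee_fin ?(ltW T0)// poweR_EFin.
rewrite ge0_integralZl_EFin ?powR_ge0//.
- by rewrite EFinM; apply: lee_wpmul2l => //; rewrite lee_fin powR_ge0.
- exact: (measurable_qball hX).
- by move=> x _; exact: poweR_ge0.
- apply: measurable_funTS; apply: (measurableT_comp (measurable_poweR q)).
  exact: mHu.
Qed.

(** [potential_bound_scaled] is applied with [t i] the i-th norm when all norms are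
    positive. If a norm vanishes, its [t i] tends to zero while the others stay fixed. *)
Lemma potential_norm_bound : exists C : R, forall f : 'I_m -> X -> R,
  (forall i, in_weighted_Lp mu (p i) (v i) (f i)) ->
  ((\int[mu]_x ((`|potential mu K f x| * (u x)%:E) `^ q)) `^ q^-1
   <= C%:E * \prod_(k < m) weighted_norm mu (p k) (v k) (f k))%E.
Proof.
have [C C0 hC] := potential_bound_scaled.
exists (C `^ q^-1) => f Lf.
have mf i : measurable_fun [set: X] (f i) by have [] := Lf i.
have pi0 i : 0 < p i by rewrite (lt_trans ltr01).
pose n i := fine (weighted_norm mu (p i) (v i) (f i)).
have I0 i : (0 <= \int[mu]_x ((`|f i x| * v i x) `^ p i)%:E)%E.
  by apply: integral_ge0 => x _; rewrite lee_fin powR_ge0.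
have Ifin i : (\int[mu]_x ((`|f i x| * v i x) `^ p i)%:E)%E \is a fin_num.
  rewrite ge0_fin_numE//; have [_] := Lf i; have [_ v0] := hv i.
  by under eq_integral do rewrite -powRM//.
have n0 i : 0 <= n i by rewrite fine_ge0// poweR_ge0.
have nE i : weighted_norm mu (p i) (v i) (f i) = (n i)%:E.
  by rewrite /n /weighted_norm -(fineK (Ifin i)) poweR_EFin.
have nI i : (\int[mu]_x ((`|f i x| * v i x) `^ p i)%:E = (n i `^ p i)%:E)%E.
  rewrite /n /weighted_norm -(fineK (Ifin i)) poweR_EFin/= -powRrM mulVf ?gt_eqF//.
  by rewrite powRr1// fine_ge0.
set Y := (X in (X <= _)%E).
have key (t : 'I_m -> R) : (forall i, 0 < t i) -> (forall i, n i <= t i) ->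
    (Y <= (C `^ q^-1 * \prod_(i < m) t i)%:E)%E.
  move=> t0 nt.
  have h : (\int[mu]_x ((`|potential mu K f x| * (u x)%:E) `^ q) <=
    ((\prod_(i < m) t i) `^ q * C)%:E)%E.
    apply: hC => // i; rewrite nI lee_fin.
    by apply: ge0_ler_powR; rewrite ?nnegrE ?(ltW (pi0 i)) ?(ltW (t0 i)).
  have T0 : 0 <= \prod_(i < m) t i by apply: prodr_ge0 => i _; exact: ltW.
  have I1 : (0 <= \int[mu]_x ((`|potential mu K f x| * (u x)%:E) `^ q))%E.
    by apply: integral_ge0 => x _; exact: poweR_ge0.
  have q'0 : 0 <= q^-1 by rewrite invr_ge0 ltW.
  have := le_poweR q'0 I1 h; rewrite -/Y => /le_trans; apply.
  rewrite poweR_EFin powRM ?powR_ge0// -powRrM mulfV ?gt_eqF// powRr1//.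
  by rewrite mulrC.
under eq_bigr do rewrite nE.
rewrite prodEFin -EFinM.
have [npos|] := pselect (forall i, 0 < n i); first exact: key.
move=> /existsNP[i0 /negP]; rewrite -leNgt => ni0.
have {}ni0 : n i0 = 0 by apply/le_anti; rewrite ni0 n0.
rewrite (bigD1 i0)//= ni0 mul0r mulr0.
apply/lee_addgt0Pr => s s0; rewrite add0e.
pose M := C `^ q^-1 * \prod_(i < m | i != i0) (n i + 1).
have n1 i : 0 < n i + 1 by rewrite ltr_wpDl.
have M0 : 0 <= M.
  by rewrite mulr_ge0 ?powR_ge0// prodr_ge0// => i _; exact: ltW.
have M1 : 0 < M + 1 by rewrite ltr_wpDl.
have s1 : 0 < s / (M + 1) by rewrite divr_gt0.
apply: le_trans (key (fun i => if i == i0 then s / (M + 1) else n i + 1) _ _) _.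
- by move=> i; case: ifP.
- by move=> i; case: eqP => [->|_]; rewrite ?ni0 ?(ltW s1)// lerDl.
rewrite lee_fin (bigD1 i0)//= eqxx.
rewrite (eq_bigr (fun i => n i + 1)) => [|i /negbTE ->//].
rewrite mulrCA -/M mulrAC ler_pdivrMr// ler_wpM2l ?(ltW s0)//.
by rewrite lerDl.
Qed.

End PotentialInequality.

Unset Implicit Arguments.
Set Strict Implicit.
Set Printing Implicit Defensive.

Theorem theorem3 (R : realType) (m : nat) (p : 'I_m -> R) (pbar q : R)
  (hm : (0 < m)%N)
  (hp : forall i, 1 < p i)
  (hpbar : pbar^-1 = \sum_(i < m) (p i)^-1)
  (hmp : m%:R^-1 < pbar) (hpq : pbar <= q)
  (d : measure_display) (X : measurableType d)
  (rho : X -> X -> R) (mu : {measure set X -> \bar R})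
  (hX : homogeneous_type rho mu)
  (hdiam : (0 < qdiam rho)%E)
  (hrd : reverse_doubling rho mu)
  (K : m.-tuple X -> m.-tuple X -> \bar R)
  (hK : kernel_off_diagonal rho K)
  (hgrowth : growth_conditions rho K)
  (hdecay : decay_condition rho mu K)
  (eta c0 : R) (heta : 1 < eta) (hc0 : phi_admissible rho mu eta c0)
  (Phi : 'I_m -> R -> R) (Psi : R -> R)
  (hPhi : forall i, young_function (Phi i))
  (hPsi : 1 < q -> young_function Psi)
  (htail : exists2 c : R, 0 < c &
     (forall i, (tail_integral (Phi i) (conj_exp (p i)) (p i - 1) c < +oo)%E) /\
     (1 < q -> (tail_integral Psi q (conj_exp q - 1) c < +oo)%E))
  (u : X -> R) (v : 'I_m -> X -> R)
  (hu : weight u) (hv : forall i, weight (v i))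
  (hgt1 : 1 < q ->
    (ereal_sup [set (phi rho K c0 B.1 B.2
        * mu (qball rho B.1 B.2) `^ (q^-1 + \sum_(i < m) (conj_exp (p i))^-1)
        * orlicz_norm rho mu Psi B.1 B.2 (EFin \o u)
        * \prod_(i < m)
            orlicz_norm rho mu (Phi i) B.1 B.2 (fun y => ((v i y)%:E)^-1))%E
      | B in phi_balls rho eta]
     < +oo)%E)
  (hle1 : q <= 1 ->
    (ereal_sup [set (phi rho K c0 B.1 B.2
        * mu (qball rho B.1 B.2) `^ (q^-1 + \sum_(i < m) (conj_exp (p i))^-1)
        * (average rho mu B.1 B.2 (fun y => (u y `^ q)%:E)) `^ q^-1
        * \prod_(i < m)
            orlicz_norm rho mu (Phi i) B.1 B.2 (fun y => ((v i y)%:E)^-1))%E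
      | B in phi_balls rho eta]
     < +oo)%E) :
  exists C : R, forall f : 'I_m -> X -> R,
    (forall i, in_weighted_Lp mu (p i) (v i) (f i)) ->
    ((\int[mu]_x ((`|potential mu K f x| * (u x)%:E) `^ q)) `^ q^-1
     <= C%:E * \prod_(k < m) weighted_norm mu (p k) (v k) (f k))%E.
Proof.
have pbar0 : 0 < pbar by apply: le_lt_trans hmp; rewrite invr_ge0.
have [c c_gt0 [tailPhi tailPsi]] := htail.
exact: (potential_norm_bound hm hp hpbar pbar0 hpq hX hdiam hK hgrowth hdecay heta hc0
  hPhi hPsi c_gt0 tailPhi tailPsi hu hv hgt1 hle1).
Qed.
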